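(* Let $S_{\boldsymbol\lambda}$ be a weighted shift on a directed tree $\mathcal T=(V,E)$ with weights $\boldsymbol\lambda=\{\lambda_v\}_{v \in V^\circ}\subseteq\mathbb C$ such that $\mathscr E_V \subseteq \mathcal D^\infty(S_{\boldsymbol\lambda})$. Assume that $\{\|S_{\boldsymbol\lambda}^{n+1} e_u\|^2\}_{n=0}^\infty$ is a determinate Stieltjes moment sequence for every $u \in V$. Then the following conditions are equivalent: (i) $S_{\boldsymbol\lambda}$ is subnormal, (ii) $\{\|S_{\boldsymbol\lambda}^{n} e_u\|^2\}_{n=0}^\infty$ is a Stieltjes moment sequence for every $u \in V$, (iii) there exist a system $\{\mu_u\}_{u \in V}$ of Borel probability measures on $\mathbb R_+$ and a system $\{\varepsilon_u\}_{u \in V}$ of nonnegative real numbers such that for every $u\in V$, $$\mu_u(\sigma) = \sum_{v \in \mathsf{Chi}(u)} |\lambda_v|^2 \int_\sigma \frac 1 s \, d\mu_v(s) + \varepsilon_u \delta_0(\sigma)\quad\text{for every Borel set } \sigma\subseteq\mathbb R_+.$$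
   Context: A directed tree is a directed graph $\mathcal T=(V,E)$ ($V\neq\varnothing$ the set of vertices, $E\subseteq\{(u,v)\in V\times V: u\neq v\}$ the set of edges) which is connected (as an undirected graph), has no circuits (no finite sequence of $n\geq 2$ distinct vertices $u_1,\dots,u_n$ with $(u_j,u_{j+1})\in E$ for $1\le j<n$ and $(u_n,u_1)\in E$), and such that each vertex $v$ that has an incoming edge has exactly one vertex $\mathsf{par}(v)$ (its parent) with $(\mathsf{par}(v),v)\in E$. A root is a vertex without incoming edges; a directed tree has at most one root, denoted $\mathsf{root}$. $V^\circ=V\setminus\{\mathsf{root}\}$ if there is a root and $V^\circ=V$ otherwise. $\mathsf{Chi}(u)=\{v\in V:(u,v)\in E\}$. $\ell^2(V)$ is the Hilbert space of square summable complex functions on $V$, $e_u$ is the characteristic function of $\{u\}$, and $\mathscr E_V=\operatorname{lin}\{e_u:u\in V\}$. For $\boldsymbol\lambda=\{\lambda_v\}_{v\in V^\circ}\subseteq\mathbb C$ and $f:V\to\mathbb C$ let $(\Lambda_{\mathcal T}f)(v)=\lambda_v f(\mathsf{par}(v))$ for $v\in V^\circ$ and $(\Lambda_{\mathcal T}f)(\mathsf{root})=0$. The weighted shift $S_{\boldsymbol\lambda}$ on $\mathcal T$ with weights $\boldsymbol\lambda$ is the operator in $\ell^2(V)$ with domain $\mathcal D(S_{\boldsymbol\lambda})=\{f\in\ell^2(V):\Lambda_{\mathcal T}f\in\ell^2(V)\}$ and $S_{\boldsymbol\lambda}f=\Lambda_{\mathcal T}f$. For an operator $A$, $\mathcal D^\infty(A)=\bigcap_{n=0}^\infty\mathcal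 D(A^n)$. $\mathbb R_+=[0,\infty)$; $\delta_0$ is the Borel probability measure on $\mathbb R_+$ concentrated at $0$. Conventions: $\frac10=\infty$, $0\cdot\infty=0$, a sum over the empty set is $0$; sums and integrals of nonnegative quantities take values in $[0,\infty]$. A real sequence $\{t_n\}_{n=0}^\infty$ is a Stieltjes moment sequence if there is a positive Borel measure $\mu$ on $\mathbb R_+$ (a representing measure) with $t_n=\int_0^\infty s^n\,d\mu(s)$ for all $n\ge0$; it is determinate if it has only one representing measure. A densely defined operator $S$ in a complex Hilbert space $\mathcal H$ is subnormal if there exist a complex Hilbert space $\mathcal K\supseteq\mathcal H$ (isometric embedding) and a normal operator $N$ in $\mathcal K$ (closed, densely defined, $N^*N=NN^*$) such that $\mathcal D(S)\subseteq\mathcal D(N)$ and $Sh=Nh$ for all $h\in\mathcal D(S)$. *)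

(* Defs.v *)
From HB Require Import structures.
From mathcomp Require Import all_boot all_order all_algebra.
From mathcomp Require Import all_classical all_reals all_analysis.
From mathcomp Require Import sesquilinear complex lra.
Import Order.TTheory GRing.Theory Num.Theory.
Import numFieldNormedType.Exports.
Import ComplexField.Normc.

Set Implicit Arguments.
Unset Strict Implicit.
Unset Printing Implicit Defensive.

Local Open Scope classical_set_scope.
Local Open Scope ring_scope.
Local Open Scope complex_scope.

(* The form is linear in its first argument and conjugate-linear in its
   second one. *)
HB.mixin Record Lmodule_isHilbert (R : realType) H
    of GRing.Lmodule R[i] H := {
  innerp : {dot H for (@Num.conj R[i])} ;
  hilbert_complete : forall x : nat -> H,
    (forall e : R, 0 < e -> exists N, forall m n, (N <= m)%N -> (N <= n)%N ->
       Num.sqrt (complex.Re (innerp (x m - x n) (x m - x n))) < e) ->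
    exists l, forall e : R, 0 < e -> exists N, forall n, (N <= n)%N ->
       Num.sqrt (complex.Re (innerp (x n - l) (x n - l))) < e
}.

#[short(type="hilbertType")]
HB.structure Definition Hilbert (R : realType) :=
  { H of GRing.Lmodule R[i] H & Lmodule_isHilbert R H }.

Definition hnorm (R : realType) (H : hilbertType R) (x : H) : R :=
  Num.sqrt (complex.Re (innerp x x)).

Definition hcvg (R : realType) (H : hilbertType R) (x : nat -> H) (l : H) :=
  forall e : R, 0 < e -> exists N, forall n, (N <= n)%N -> hnorm (x n - l) < e.

(* A possibly unbounded operator; the values of [opfun] outside of [dom]
   carry no meaning, and linearity is the separate predicate
   [linear_operator]. *)
Record operator (T : Type) := Operator { dom : set T ; opfun :> T -> T }.

Section operators.
Context {R : realType} {H : hilbertType R}.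
Implicit Types A B : operator H.

Definition linear_operator A := dom A 0 /\
  forall (a : R[i]) (x y : H), dom A x -> dom A y ->
    dom A (a *: x + y) /\ A (a *: x + y) = a *: A x + A y.

Definition densely_defined A := forall (x : H) (e : R), 0 < e ->
  exists2 y, dom A y & hnorm (x - y) < e.

Definition closed_operator A := forall (x : nat -> H) (l m : H),
  (forall n, dom A (x n)) -> hcvg x l -> hcvg (fun n => A (x n)) m ->
  dom A l /\ A l = m.

Definition op_eq A B := dom A = dom B /\ {in dom A, A =1 B}.

Definition op_id : operator H := Operator setT id.

Definition op_comp A B : operator H :=
  Operator (dom B `&` [set x | dom A (B x)]) (fun x => A (B x)).

Definition op_pow A n : operator H := iter n (op_comp A) op_id.

Definition dom_infty A : set H := \bigcap_n dom (op_pow A n).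

Definition adjoint_spec A (y z : H) :=
  forall x, dom A x -> innerp (A x) y = innerp x z.

(* For a densely defined operator the vector selected by [xget] is the only
   one satisfying the defining identity of the adjoint. *)
Definition op_adj A : operator H :=
  Operator [set y | exists z, adjoint_spec A y z]
           (fun y => xget 0 [set z | adjoint_spec A y z]).

Definition normal_operator A :=
  [/\ linear_operator A, closed_operator A, densely_defined A &
      op_eq (op_comp (op_adj A) A) (op_comp A (op_adj A))].

End operators.

Definition subnormal_operator (R : realType) (H : hilbertType R)
    (S : operator H) :=
  [/\ linear_operator S, densely_defined S &
   exists (K : hilbertType R) (J : {linear H -> K}) (N : operator K),
    [/\ forall x y : H, innerp (J x) (J y) = innerp x y,
        normal_operator N &
        forall h, dom S h -> dom N (J h) /\ N (J h) = J (S h)]].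

(* The Hilbert space of square summable families *)

Section l2_type.
Context {R : realType} {V : choiceType}.

Definition square_summable : {pred V -> R[i]} :=
  fun f => (\esum_(v in [set: V]) ((normc (f v)) ^+ 2)%:E < +oo)%E.

Record l2 := L2 { l2fun :> V -> R[i] ; _ : l2fun \in square_summable }.

HB.instance Definition _ := [isSub for l2fun].
HB.instance Definition _ := [Choice of l2 by <:].

End l2_type.
Arguments l2 : clear implicits.

Section sums.
Context {R : realType} {V : choiceType}.
Implicit Types (f g p q : V -> R) (h k : V -> R[i]).

Let psum f : R := fine (\esum_(v in [set: V]) (f v)%:E).

(* Sum of an absolutely summable family of real (resp. complex) numbers;
   [fine] sends [+oo] to [0], so the value is meaningless otherwise. *)
Definition rsum f : R :=
  fine (\esum_(v in [set: V]) (f^\+ v)%:E) -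
  fine (\esum_(v in [set: V]) (f^\- v)%:E).

Definition csum h : R[i] :=
  rsum (fun v => complex.Re (h v)) +i* rsum (fun v => complex.Im (h v)).

Definition rsummable f := summable [set: V] (EFin \o f).
Definition csummable h := rsummable (fun v => complex.Re (h v)) /\
  rsummable (fun v => complex.Im (h v)).

Lemma rsummable_ge0 f : (forall v, 0 <= f v) ->
  rsummable f = (\esum_(v in [set: V]) (f v)%:E < +oo)%E :> Prop.
Proof.
move=> f0; rewrite /rsummable /summable; congr (is_true (_ < _)%E).
by apply: eq_esum => v _ /=; rewrite ger0_norm.
Qed.

Lemma rsummableD f g : rsummable f -> rsummable g ->
  rsummable (fun v => f v + g v).
Proof. exact: summableD. Qed.

Lemma rsummable_le f g : (forall v, `|f v| <= g v) -> rsummable g ->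
  rsummable f.
Proof.
move=> fg; apply: le_lt_trans; apply: le_esum => v _ /=.
by rewrite lee_fin (le_trans (fg v)) ?ler_norm.
Qed.

Lemma rsummableN f : rsummable f -> rsummable (fun v => - f v).
Proof.
move=> fs; apply: (@rsummable_le _ (fun v => `|f v|)).
  by move=> v; rewrite normrN.
by move: fs; apply: le_lt_trans; apply: le_esum => v _ /=; rewrite normr_id.
Qed.

Let rsummable_pos f : rsummable f -> rsummable f^\+.
Proof.
move=> fs; apply: (@rsummable_le _ (fun v => `|f v|)).
  by move=> v; rewrite ger0_norm ?funrpos_ge0 // /funrpos /= ge_max ler_norm normr_ge0.
by move: fs; apply: le_lt_trans; apply: le_esum => v _ /=; rewrite normr_id.
Qed.

Let rsummable_neg f : rsummable f -> rsummable f^\-.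
Proof. by move=> /rsummableN/rsummable_pos; rewrite [X in X^\+](_ : _ = \- f) ?funrposN. Qed.

Let psum_fin f : (forall v, 0 <= f v) -> rsummable f ->
  (\esum_(v in [set: V]) (f v)%:E)%E = (psum f)%:E.
Proof.
move=> f0; rewrite rsummable_ge0 // => fs.
by rewrite /psum fineK // ge0_fin_numE // esum_ge0 // => v _; rewrite lee_fin.
Qed.

Let psumD f g : (forall v, 0 <= f v) -> (forall v, 0 <= g v) ->
  rsummable f -> rsummable g ->
  psum (fun v => f v + g v) = psum f + psum g.
Proof.
move=> f0 g0 fs gs; apply: EFin_inj; rewrite EFinD -!psum_fin //.
- by rewrite -esumD => [|v _|v _]; rewrite ?lee_fin.
- by move=> v; rewrite addr_ge0.
- exact: rsummableD.
Qed.

Let esumZ_le (a : R) f : 0 <= a -> (forall v, 0 <= f v) ->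
  (\esum_(v in [set: V]) (a * f v)%:E <=
   a%:E * \esum_(v in [set: V]) (f v)%:E)%E.
Proof.
move=> a0 f0; apply: ge_ereal_sup => _ [F Ffs <-].
under eq_fsbigr do rewrite EFinM.
rewrite -ge0_mule_fsumr; last by move=> v; rewrite lee_fin.
rewrite lee_wpmul2l ?lee_fin //.
by apply: ereal_sup_ubound; exists F.
Qed.

Lemma rsummableZ a f : rsummable f -> rsummable (fun v => a * f v).
Proof.
move=> fs; rewrite /rsummable /summable.
rewrite (eq_esum (b := fun v => (`|a| * `|f v|)%:E)); last first.
  by move=> v _ /=; rewrite normrM.
apply: le_lt_trans (esumZ_le _ _) _ => //.
by apply: lte_mul_pinfty; rewrite ?lee_fin.
Qed.

Let psumZ (a : R) f : 0 <= a -> (forall v, 0 <= f v) -> rsummable f ->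
  psum (fun v => a * f v) = a * psum f.
Proof.
move=> a0 f0 fs; have [->|an0] := eqVneq a 0.
  rewrite mul0r /psum esum1 // => v _; by rewrite mul0r.
have ap : 0 < a by rewrite lt_neqAle eq_sym an0.
have af0 v : 0 <= a * f v by rewrite mulr_ge0.
apply/eqP; rewrite eq_le -!lee_fin; apply/andP; split.
  rewrite EFinM -!psum_fin //; first exact: esumZ_le.
  exact: rsummableZ.
have -> : (a * psum f)%:E = (a * psum (fun v => a^-1 * (a * f v)))%:E.
  by congr (a * psum _)%:E; apply/funext => v; rewrite mulKf.
rewrite lee_fin -ler_pdivlMl // -lee_fin EFinM -!psum_fin //.
- by apply: esumZ_le => //; rewrite invr_ge0.
- exact: rsummableZ.
- by move=> v; rewrite mulKf.
- exact/rsummableZ/rsummableZ.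
Qed.

Let rsumE f p q : (forall v, 0 <= p v) -> (forall v, 0 <= q v) ->
  rsummable p -> rsummable q -> (forall v, f v = p v - q v) ->
  rsum f = psum p - psum q.
Proof.
move=> p0 q0 ps qs fE.
have fs : rsummable f.
  rewrite (_ : f = fun v => p v + - q v); last exact/funext.
  exact/rsummableD/rsummableN.
rewrite /rsum -!/(psum _).
apply/eqP; rewrite subr_eq addrAC eq_sym subr_eq -!psumD //;
  try exact: rsummable_pos; try exact: rsummable_neg.
apply/eqP; congr psum; apply/funext => v.
have E : f^\+ v - f^\- v = p v - q v by rewrite -fE -[in RHS](funrposBneg f).
move: E; rewrite /psum; lra.
Qed.

Lemma rsum_ge0E f : (forall v, 0 <= f v) -> rsummable f ->
  (rsum f)%:E = (\esum_(v in [set: V]) (f v)%:E)%E.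
Proof.
move=> f0 fs; rewrite (rsumE (p := f) (q := fun=> 0)) //.
- by rewrite psum_fin // {2}/psum esum1 // subr0.
- by rewrite rsummable_ge0 // esum1 ?ltry.
- by move=> v; rewrite subr0.
Qed.

Lemma rsumD f g : rsummable f -> rsummable g ->
  rsum (fun v => f v + g v) = rsum f + rsum g.
Proof.
move=> fs gs.
rewrite (rsumE (p := fun v => f^\+ v + g^\+ v) (q := fun v => f^\- v + g^\- v)).
- rewrite !psumD //; try exact: rsummable_pos; try exact: rsummable_neg.
  by rewrite /rsum -!/(psum _) opprD addrACA.
- by move=> v; rewrite addr_ge0.
- by move=> v; rewrite addr_ge0.
- by apply: rsummableD; exact: rsummable_pos.
- by apply: rsummableD; exact: rsummable_neg.
- move=> v; rewrite -[in LHS](funrposBneg f) -[in LHS](funrposBneg g).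
  by rewrite opprD addrACA.
Qed.

Lemma rsumN f : rsummable f -> rsum (fun v => - f v) = - rsum f.
Proof.
move=> fs; rewrite (rsumE (p := f^\-) (q := f^\+)) //.
- by rewrite /rsum opprB.
- exact: rsummable_neg.
- exact: rsummable_pos.
- by move=> v; rewrite -[in LHS](funrposBneg f) opprB.
Qed.

Lemma rsumZ a f : rsummable f -> rsum (fun v => a * f v) = a * rsum f.
Proof.
move=> fs.
have pos (b : R) g : 0 <= b -> rsummable g ->
    rsum (fun v => b * g v) = b * rsum g.
  move=> b0 gs.
  rewrite (rsumE (p := fun v => b * g^\+ v) (q := fun v => b * g^\- v)).
  - rewrite !psumZ // ?mulrBr //; first exact: rsummable_neg.
    exact: rsummable_pos.
  - by move=> v; rewrite mulr_ge0.
  - by move=> v; rewrite mulr_ge0.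
  - exact/rsummableZ/rsummable_pos.
  - exact/rsummableZ/rsummable_neg.
  - by move=> v; rewrite -mulrBr -[in LHS](funrposBneg g).
have [a0|a0] := leP 0 a; first exact: pos.
rewrite -[a]opprK mulNr -pos ?oppr_ge0 ?(ltW a0) // -rsumN.
  by congr rsum; apply/funext => v; rewrite mulNr.
exact: rsummableZ.
Qed.

Lemma csummableD h k : csummable h -> csummable k ->
  csummable (fun v => h v + k v).
Proof.
move=> [h1 h2] [k1 k2]; split.
- rewrite (_ : (fun v => _) = fun v => complex.Re (h v) + complex.Re (k v)).
    exact: rsummableD.
  by apply/funext => v; case: (h v) (k v) => ? ? [].
- rewrite (_ : (fun v => _) = fun v => complex.Im (h v) + complex.Im (k v)).
    exact: rsummableD.
  by apply/funext => v; case: (h v) (k v) => ? ? [].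
Qed.

Lemma csumD h k : csummable h -> csummable k ->
  csum (fun v => h v + k v) = csum h + csum k.
Proof.
move=> [h1 h2] [k1 k2]; rewrite /csum; simpc; rewrite -!rsumD //.
by congr (rsum _ +i* rsum _); apply/funext => v; case: (h v) (k v) => ? ? [].
Qed.

Lemma csumZ c h : csummable h -> csum (fun v => c * h v) = c * csum h.
Proof.
suff: forall a b : R, csummable h ->
    csum (fun v => (a +i* b) * h v) = (a +i* b) * csum h.
  by move=> H; case: c => a b; exact: H.
move=> a b [h1 h2].
rewrite /csum; congr (_ +i* _).
- rewrite [X in rsum X](_ : _ = fun v =>
      a * complex.Re (h v) + - (b * complex.Im (h v))).
    rewrite rsumD; [|exact: rsummableZ|exact/rsummableN/rsummableZ].
    by rewrite rsumN ?rsumZ //; exact: rsummableZ.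
  by apply/funext => v; case: (h v).
- rewrite [X in rsum X](_ : _ = fun v =>
      a * complex.Im (h v) + b * complex.Re (h v)).
    by rewrite rsumD ?rsumZ //; exact: rsummableZ.
  by apply/funext => v; case: (h v).
Qed.

Lemma csum_conj h : csummable h ->
  csum (fun v => Num.conj (h v)) = Num.conj (csum h).
Proof.
move=> [h1 h2]; rewrite {2}/csum; simpc; congr (_ +i* _).
  by congr rsum; apply/funext => v; case: (h v).
rewrite -[RHS](rsumN h2).
by congr rsum; apply/funext => v; case: (h v).
Qed.

End sums.

Section l2_hilbert.
Context {R : realType} {V : choiceType}.
Local Notation l2 := (l2 R V).
Implicit Types (f g : V -> R[i]) (x y : l2).

Let sq f v : R := (normc (f v)) ^+ 2.

Let sqE f v : sq f v = complex.Re (f v) ^+ 2 + complex.Im (f v) ^+ 2.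
Proof.
by rewrite /sq; case: (f v) => a b /=; rewrite sqr_sqrtr // addr_ge0 ?sqr_ge0.
Qed.

Let sq_ge0 f v : 0 <= sq f v. Proof. exact: sqr_ge0. Qed.

Let l2P f : (f \in square_summable) <-> rsummable (sq f).
Proof. by rewrite rsummable_ge0. Qed.

Let sqD f g v : sq (f + g) v <= 2 * sq f v + 2 * sq g v.
Proof.
rewrite !sqE fctE; case: (f v) (g v) => a b [c d] /=.
have := sqr_ge0 (a - c); have := sqr_ge0 (b - d); nra.
Qed.

Fact square_summable_submod : submod_closed (@square_summable R V).
Proof.
split.
  apply/l2P; rewrite rsummable_ge0 // esum1 ?ltry // => v _.
  by rewrite sqE /= expr0n addr0.
move=> c f g /l2P fs /l2P gs; apply/l2P.
apply: (@rsummable_le _ _ _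
  (fun v => 2 * (sq (fun=> c) v * sq f v) + 2 * sq g v)).
  move=> v; rewrite ger0_norm //; apply: le_trans (sqD _ _ _) _.
  rewrite lerD2r ler_pM2l // !sqE fctE; case: c (f v) => a b [d e] /=; nra.
rewrite /sq.
apply: rsummableD; apply: rsummableZ => //; exact: rsummableZ.
Qed.

HB.instance Definition _ :=
  GRing.isSubmodClosed.Build R[i] (V -> R[i]) (@square_summable R V)
    square_summable_submod.
HB.instance Definition _ := [SubChoice_isSubLmodule of l2 by <:].

Definition l2_dot x y : R[i] := csum (fun v => x v * Num.conj (y v)).

Let l2_summable x : rsummable (sq x). Proof. exact: (l2P (l2fun x)).1 (valP x). Qed.

Let dot_summable x y : csummable (fun v => x v * Num.conj (y v)).
Proof.
have xys : rsummable (fun v => sq x v + sq y v).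
  by apply: rsummableD; exact: l2_summable.
split; apply: rsummable_le xys => v; rewrite !sqE;
  case: (x v) (y v) => a b [c d] /=; rewrite ler_norml; apply/andP; split;
  have := sqr_ge0 (a - c); have := sqr_ge0 (b - d);
  have := sqr_ge0 (a + c); have := sqr_ge0 (b + d);
  have := sqr_ge0 (a - d); have := sqr_ge0 (b - c);
  have := sqr_ge0 (a + d); have := sqr_ge0 (b + c);
  rewrite !expr2; lra.
Qed.

Let l2_linearP (a : R[i]) x y v : (a *: x + y) v = a * x v + y v.
Proof. by []. Qed.

Let l2_subP x y v : (x - y) v = x v - y v.
Proof. by []. Qed.

Let l2_dotC x y : l2_dot x y = Num.conj (l2_dot y x).
Proof.
rewrite /l2_dot -(csum_conj (dot_summable y x)); congr csum; apply/funext => v.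
rewrite rmorphM /= [X in _ = _ * X](conjCK (x v)); exact: mulrC.
Qed.

Let l2_dot_linearl y : GRing.linear_for *%R (l2_dot ^~ y).
Proof.
move=> a x z; rewrite /= /l2_dot -(csumZ a (dot_summable x y)) -csumD; last first.
- exact: dot_summable.
- have := dot_summable (a *: x) y; congr (csummable _ : Prop).
  by apply/funext => v; rewrite -[a *: x]addr0 l2_linearP addr0 mulrA.
- by congr csum; apply/funext => v; rewrite l2_linearP mulrDl mulrA.
Qed.

Let l2_dot_bilinear : bilinear_for *%R (Num.conj \; *%R) l2_dot.
Proof.
split=> [y|x a y z /=]; first exact: l2_dot_linearl.
by rewrite [LHS]l2_dotC l2_dot_linearl rmorphD rmorphM /= (l2_dotC x y) (l2_dotC x z).
Qed.

HB.instance Definition _ := bilinear_isBilinear.Build R[i] l2 l2 R[i]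
  *%R (Num.conj \; *%R) l2_dot l2_dot_bilinear.

Let l2_dot_herm x y : l2_dot x y = (-1) ^+ false * Num.conj (l2_dot y x).
Proof. by rewrite mul1r -l2_dotC. Qed.

HB.instance Definition _ :=
  isHermitianSesquilinear.Build R[i] l2 false Num.conj l2_dot l2_dot_herm.

Let l2_dotE x : l2_dot x x = (rsum (sq x))%:C.
Proof.
rewrite /l2_dot /csum; congr (rsum _ +i* _).
  by apply/funext => v; rewrite sqE; case: (x v) => a b /=; rewrite !expr2; lra.
rewrite -[RHS](mul0r (rsum (sq x))) -rsumZ //; congr rsum.
by apply/funext => v; rewrite mul0r; case: (x v) => a b /=; lra.
Qed.

Let rsum_sq x : (rsum (sq x))%:E = (\esum_(v in [set: V]) (sq x v)%:E)%E.
Proof. exact: rsum_ge0E. Qed.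

Let rsum_sq_ge0 x : 0 <= rsum (sq x).
Proof.
by rewrite -lee_fin rsum_sq esum_ge0 // => v _; rewrite lee_fin.
Qed.

Let le_rsum_sq x (F : seq V) : uniq F -> \sum_(v <- F) sq x v <= rsum (sq x).
Proof.
move=> uF; rewrite -lee_fin rsum_sq -sumEFin (fsbig_seq _ _ uF) /=.
by apply: ereal_sup_ubound; exists [set` F].
Qed.

Let l2_dot_gt0 x : x != 0 -> 0 < l2_dot x x.
Proof.
move=> x0; rewrite l2_dotE ltcR lt_neqAle rsum_sq_ge0 andbT.
apply: contra_neq x0 => x0; apply/val_inj/funext => v /=.
have := le_rsum_sq x (F := [:: v]) isT; rewrite big_seq1 -x0 => le0.
have /eqP : sq x v = 0 by apply/eqP; rewrite eq_le le0 sq_ge0.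
by rewrite /sq sqrf_eq0 => /eqP/eq0_normc.
Qed.

HB.instance Definition _ := isDotProduct.Build R[i] l2 l2_dot l2_dot_gt0.

Let real_complete (u : nat -> R) :
  (forall e : R, 0 < e -> exists N, forall m n, (N <= m)%N -> (N <= n)%N ->
     `|u m - u n| < e) ->
  exists l, forall e : R, 0 < e -> exists N, forall n, (N <= n)%N ->
     `|u n - l| < e.
Proof.
move=> uc; have /cauchy_cvgP/cvgrPdist_lt ul : cauchy (u @ \oo).
  apply: cauchy_exP => e e0; have [N HN] := uc _ e0.
  exists (u N), N => // n Nn; rewrite -ball_normE /=; exact: HN.
exists (lim (u @ \oo)) => e e0; have [N _ HN] := ul _ e0.
by exists N => n Nn; rewrite distrC; exact: HN.
Qed.

Let abs_lt (r e : R) : 0 < e -> (`|r| < e) = (r ^+ 2 < e ^+ 2).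
Proof.
move=> e0; rewrite -(real_normK (num_real r)).
by rewrite ltr_pXn2r // nnegrE ?normr_ge0 // ltW.
Qed.

Let l2_complete (x : nat -> l2) :
  (forall e : R, 0 < e -> exists N, forall m n, (N <= m)%N -> (N <= n)%N ->
     Num.sqrt (complex.Re (l2_dot (x m - x n) (x m - x n))) < e) ->
  exists l, forall e : R, 0 < e -> exists N, forall n, (N <= n)%N ->
     Num.sqrt (complex.Re (l2_dot (x n - l) (x n - l))) < e.
Proof.
move=> xc.
have sqrt_lt (z : l2) (e : R) : 0 < e ->
    (Num.sqrt (complex.Re (l2_dot z z)) < e) = (rsum (sq z) < e ^+ 2).
  move=> e0; rewrite l2_dotE /= -[in LHS](ger0_norm (ltW e0)) -sqrtr_sqr.
  by rewrite ltr_sqrt // exprn_gt0.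
have pt (z : l2) v e : 0 < e -> rsum (sq z) < e ^+ 2 ->
    `|complex.Re (z v)| < e /\ `|complex.Im (z v)| < e.
  move=> e0 zs; have := le_rsum_sq z (F := [:: v]) isT.
  rewrite big_seq1 => /le_lt_trans/(_ zs); rewrite sqE => zv.
  split; rewrite abs_lt //.
    by have := sqr_ge0 (complex.Im (z v)); lra.
  by have := sqr_ge0 (complex.Re (z v)); lra.
have lE v : exists l : R[i], forall e : R, 0 < e -> exists N, forall n,
    (N <= n)%N -> normc (x n v - l) ^+ 2 < e.
  have [|a Ha] := @real_complete (fun n => complex.Re (x n v)).
    move=> e e0; have [N HN] := xc _ e0; exists N => m n Nm Nn.
    have := HN m n Nm Nn; rewrite sqrt_lt // => /(pt _ v _ e0)[+ _].
    by rewrite l2_subP; case: (x m v) => ? ?; case: (x n v) => ? ?.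
  have [|b Hb] := @real_complete (fun n => complex.Im (x n v)).
    move=> e e0; have [N HN] := xc _ e0; exists N => m n Nm Nn.
    have := HN m n Nm Nn; rewrite sqrt_lt // => /(pt _ v _ e0)[_ +].
    by rewrite l2_subP; case: (x m v) => ? ?; case: (x n v) => ? ?.
  exists (a +i* b) => e e0.
  have e1 : 0 < Num.sqrt (e / 2) by rewrite sqrtr_gt0 divr_gt0.
  have [N HN] := Ha _ e1; have [M HM] := Hb _ e1.
  exists (maxn N M) => n; rewrite geq_max => /andP[/HN + /HM].
  have := sqE (fun=> x n v - (a +i* b)) v; rewrite /sq => ->.
  case: (x n v) => c d /=.
  rewrite !abs_lt // sqr_sqrtr ?divr_ge0 ?ltW //; lra.
have [l Hl] := choice lE.
have fin (F : seq V) (e : R) : 0 < e -> exists N, forall n, (N <= n)%N ->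
    \sum_(v <- F) normc (x n v - l v) ^+ 2 < e.
  elim: F e => [|v F IH] e e0; first by exists 0%N => n _; rewrite big_nil.
  have e1 : 0 < e / 2 by rewrite divr_gt0.
  have [N HN] := IH _ e1; have [M HM] := Hl v _ e1.
  exists (maxn N M) => n; rewrite geq_max => /andP[/HN + /HM].
  by rewrite big_cons; lra.
have key (e : R) : 0 < e -> exists N, forall n, (N <= n)%N ->
    (\esum_(v in [set: V]) (sq (val (x n) - l)%R v)%:E <= (3 * e ^+ 2)%:E)%E.
  move=> e0; have [N HN] := xc _ e0; exists N => n Nn.
  apply: ge_ereal_sup => _ [F [finF _] <-].
  rewrite fsbig_finite //= sumEFin lee_fin.
  set s := finmap.enum_fset _.
  have us : uniq s by exact: finmap.fset_uniq.
  have [M HM] := fin s (e ^+ 2 / 2) (divr_gt0 (exprn_gt0 2 e0) (ltr0n _ 2)).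
  pose m := maxn N M.
  have := HN n m Nn (leq_maxl N M); rewrite sqrt_lt // => xnm.
  have := HM m (leq_maxr N M) => xml.
  have := le_lt_trans (le_rsum_sq (x n - x m) (us)) xnm.
  move=> xnm'.
  apply: (@le_trans _ _ (2 * \sum_(v <- s) sq (x n - x m) v +
     2 * \sum_(v <- s) normc (x m v - l v) ^+ 2)); last by lra.
  rewrite !mulr_sumr -big_split /=; apply: ler_sum => v _.
  have := sqD (val (x n - x m)) (val (x m) - l) v.
  by rewrite (_ : _ + _ = val (x n) - l) //; apply/funext => w; rewrite addrA subrK.
have ll2 : l \in square_summable.
  have [N /(_ N (leqnn _)) HN] := key 1 ltr01.
  have d2 : val (x N) - l \in @square_summable R V.
    by rewrite unfold_in; apply: le_lt_trans HN _; rewrite ltry.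
  by rewrite -[l](subKr (val (x N))) rpredB //; exact: valP.
exists (L2 ll2) => e e0; have [N HN] := key (e / 2) (divr_gt0 e0 (ltr0n _ 2)).
exists N => n /HN xnl; rewrite sqrt_lt //.
apply: (@le_lt_trans _ _ (3 * (e / 2) ^+ 2)).
  by rewrite -lee_fin rsum_sq; exact: xnl.
by have := exprn_gt0 2 e0; rewrite expr_div_n; lra.
Qed.

HB.instance Definition _ := Lmodule_isHilbert.Build R l2
  (innerp := (l2_dot : {dot l2 for (@Num.conj R[i])})) l2_complete.

Fact delta_square_summable (u : V) :
  (fun v => (v == u)%:R : R[i]) \in square_summable.
Proof.
apply/l2P; rewrite rsummable_ge0 // (esumID [set u]); last first.
  by move=> v _; rewrite lee_fin.
rewrite setTI esum_set1 ?lee_fin // setTI esum1 ?adde0 ?ltry // => v /= vu.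
by rewrite sqE; case: eqP vu => //= _ _; rewrite expr0n addr0.
Qed.

Definition l2_delta u : l2 := L2 (delta_square_summable u).

Definition l2_lin_delta : set l2 :=
  [set f | exists (n : nat) (c : 'I_n -> R[i]) (u : 'I_n -> V),
     f = \sum_(i < n) c i *: l2_delta (u i)].

Lemma l2_innerpE x y : innerp x y = csum (fun v => x v * Num.conj (y v)).
Proof. by []. Qed.

Lemma l2_hnormE x :
  (hnorm x ^+ 2)%:E = (\esum_(v in [set: V]) ((normc (x v)) ^+ 2)%:E)%E.
Proof.
have -> : hnorm x = Num.sqrt (complex.Re (l2_dot x x)) by [].
by rewrite -rsum_sq l2_dotE /= sqr_sqrtr //; exact: rsum_sq_ge0.
Qed.

End l2_hilbert.

Section directed_tree.
Context {V : choiceType}.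
Implicit Types E : rel V.

Definition no_circuit E :=
  forall c : seq V, (2 <= size c)%N -> uniq c -> ~~ cycle E c.

Definition tree_connected E := forall u v,
  exists2 p : seq V, path (fun x y => E x y || E y x) u p & last u p = v.

Definition directed_tree E := [/\ [set: V] !=set0,
  irreflexive E,
  tree_connected E,
  no_circuit E &
  forall u u' v, E u v -> E u' v -> u = u'].

Definition is_root E v := forall u, ~~ E u v.

Definition nonroot E : set V := ~` [set v | is_root E v].

Definition Chi E u : set V := [set v | E u v].

(* [par E v] is [v] itself when [v] is a root. *)
Definition par E v : V := xget v [set u | E u v].

End directed_tree.

Section weighted_shift.
Context {R : realType} {V : choiceType}.
Variables (E : rel V) (lambda : V -> R[i]).

(* Only the values of [lambda] on [nonroot E] are used. *)
Definition tree_shift (f : V -> R[i]) : V -> R[i] := fun v =>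
  if v \in nonroot E then lambda v * f (par E v) else 0.

Definition weighted_shift : operator (l2 R V) :=
  Operator [set f : l2 R V | tree_shift f \in square_summable]
           (fun f => insubd (0 : l2 R V) (tree_shift f)).

End weighted_shift.

Section stieltjes.
Context {R : realType}.
Implicit Types t : nat -> R.

(* Borel measures on the half-line are Borel measures on the line that vanish
   on the negative half-line. *)
Definition on_halfline (mu : set (measurableTypeR R) -> \bar R) :=
  mu `]-oo, 0%R[%classic = 0%E.

Definition representing_measure t
    (mu : {measure set (measurableTypeR R) -> \bar R}) :=
  on_halfline mu /\
  forall n, (\int[mu]_(s in `[0%R, +oo[%classic) (s ^+ n)%:E = (t n)%:E)%E.

Definition stieltjes_moment_sequence t := exists mu, representing_measure t mu.

Definition determinate_stieltjes t := stieltjes_moment_sequence t /\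
  forall mu nu, representing_measure t mu -> representing_measure t nu ->
    forall A, measurable A -> mu A = nu A.

End stieltjes.

(* Main.v *)
(* (i) => (ii): for a normal N the moments |N^n h|^2 = <(N^*N)^n h, h> are
   nonnegative on squares p^2 and on s p^2, hence on every polynomial that is
   nonnegative on the half-line; the M. Riesz extension theorem turns such a
   functional into a measure.

   (ii) => (iii): if mu_u represents the moments of e_u, then both s d(mu_u)
   and sum_v |lambda_v|^2 d(mu_v), v in Chi(u), represent the determinate
   sequence |S^(n+1) e_u|^2, so they coincide; dividing by s off the origin
   gives (iii), with eps_u the mass left at 0.

   (iii) => (i): let K be the L^2 space of the disjoint union over v of the
   half-lines with measures mu_v, and let J f be f(v) on the fiber of v. On K
   let M be multiplication by sqrt s and U the tree shift divided by sqrt s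
   (the identity where s = 0). Consistency of the system says that U is an
   isometry; it commutes with M, and J S = U M J. The unitary dilation of U
   commutes with M (+) M, and the product of the two is a normal operator
   extending S. *)
Require Import Defs.
From HB Require Import structures.
From mathcomp Require Import all_boot all_order all_algebra.
From mathcomp Require Import all_classical all_reals all_analysis.
From mathcomp Require Import measurable_realfun sesquilinear complex lra ring.
Import Order.TTheory GRing.Theory Num.Theory.
Import numFieldNormedType.Exports.
Import ComplexField.Normc.

Set Implicit Arguments.
Unset Strict Implicit.
Unset Printing Implicit Defensive.

Local Open Scope classical_set_scope.
Local Open Scope ring_scope.
Local Open Scope complex_scope.

(** * Hilbert space geometry and adjoints *)

(** No spectral theorem is used. In (i) => (ii) what remains is an algebraic task with a domain
    obstacle: [N^*N] has to act on every vector lying in the domain of all powers of [N], and to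
    commute with [N] there. This requires the domain of [N] to lie in that of its adjoint; the
    resolvents of [N^*N], obtained by projecting onto a graph, give it.

    In (ii) => (iii) determinacy concerns the sequence shifted by one because the factor [s] brought
    by the shift removes any mass at 0. Equality of the two measures then forces
    [|lambda_v|^2 mu_v({0}) = 0] for every child [v], so that the convention [1/0 = +oo] is
    harmless.

    In (iii) => (i) the extension is compared with [S] on its whole domain, without passing through
    a core. The factor [1 / sqrt s] is dictated by consistency: its square is the density that turns
    the measures of the children into [mu_u] off the origin. The mass at 0 is not produced by the
    children, hence the identity there. The product [U M] is thus an isometry times a commuting
    nonnegative selfadjoint operator, that is, quasinormal. *)

Section real_inner_product.
Context {R : realType} {H : hilbertType R}.
Implicit Types (x y z : H) (r : R).

(** Order and limit arguments run over [R] with this form; [innerp_ip] recovers the complex product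
    from it. *)
Definition ip x y : R := complex.Re (innerp x y).

Lemma innerpC x y : innerp x y = (innerp y x)^*.
Proof. by rewrite [LHS]hermC expr0 mul1r. Qed.

Lemma ipC x y : ip x y = ip y x.
Proof. by rewrite /ip innerpC; case: (innerp y x). Qed.

Lemma innerpDl x y z : innerp (x + y) z = innerp x z + innerp y z.
Proof. exact: linearDl. Qed.

Lemma innerpZl (a : R[i]) x y : innerp (a *: x) y = a * innerp x y.
Proof. exact: linearZl_LR. Qed.

Lemma innerpNl x y : innerp (- x) y = - innerp x y.
Proof. exact: linearNl. Qed.

Lemma innerpZr (a : R[i]) x y : innerp x (a *: y) = a^* * innerp x y.
Proof. by rewrite innerpC innerpZl rmorphM /= -innerpC. Qed.

Lemma innerpZRr r x y : innerp x (r%:C *: y) = r%:C * innerp x y.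
Proof. by rewrite innerpZr; congr (_ * _); apply/eqP; rewrite eq_complex /= oppr0 !eqxx. Qed.

Lemma ipDl x y z : ip (x + y) z = ip x z + ip y z.
Proof. by rewrite /ip innerpDl; case: (innerp x z) (innerp y z) => ? ? []. Qed.

Lemma ipDr x y z : ip x (y + z) = ip x y + ip x z.
Proof. by rewrite ipC ipDl !(ipC x). Qed.

Lemma ipZl r x y : ip (r%:C *: x) y = r * ip x y.
Proof.
by rewrite /ip innerpZl; case: (innerp x y) => a b /=; rewrite mul0r subr0.
Qed.

Lemma ipZr r x y : ip x (r%:C *: y) = r * ip x y.
Proof. by rewrite ipC ipZl ipC. Qed.

Lemma ipNl x y : ip (- x) y = - ip x y.
Proof. by rewrite /ip innerpNl; case: (innerp x y). Qed.

Lemma ipNr x y : ip x (- y) = - ip x y.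
Proof. by rewrite ipC ipNl ipC. Qed.

Lemma ipBl x y z : ip (x - y) z = ip x z - ip y z.
Proof. by rewrite ipDl ipNl. Qed.

Lemma ipBr x y z : ip x (y - z) = ip x y - ip x z.
Proof. by rewrite ipDr ipNr. Qed.

Lemma ip0l x : ip 0 x = 0. Proof. by have := ipBl x x x; rewrite !subrr. Qed.

Lemma ip0r x : ip x 0 = 0. Proof. by rewrite ipC ip0l. Qed.

Lemma innerp_ip x y : innerp x y = ip x y +i* ip x ('i *: y).
Proof.
rewrite {2}/ip innerpZr /ip /=; case: (innerp x y) => a b /=.
by congr (_ +i* _); ring.
Qed.

Lemma ip_ge0 x : 0 <= ip x x.
Proof.
rewrite /ip; have : 0 <= innerp x x by exact: dnorm_ge0.
by rewrite lecE /= => /andP[].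
Qed.

Lemma ip_eq0 x : ip x x = 0 -> x = 0.
Proof.
move=> x0; have : 0 <= innerp x x by exact: dnorm_ge0.
rewrite lecE /= => /andP[im _]; apply/eqP; rewrite -(dnorm_eq0 innerp).
by rewrite eq_complex [X in X == _]x0 im eqxx.
Qed.

Lemma hnormE x : hnorm x ^+ 2 = ip x x.
Proof. by rewrite /hnorm sqr_sqrtr //; exact: ip_ge0. Qed.

Lemma hnorm_ge0 x : 0 <= hnorm x. Proof. exact: sqrtr_ge0. Qed.

Lemma hnorm_eq0 x : hnorm x = 0 -> x = 0.
Proof. by move=> x0; apply: ip_eq0; rewrite -hnormE x0 expr0n. Qed.

Lemma hnorm_lt x (e : R) : 0 < e -> (hnorm x < e) = (ip x x < e ^+ 2).
Proof.
by move=> e0; rewrite -hnormE ltr_pXn2r // nnegrE ?hnorm_ge0 // ltW.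
Qed.

Lemma hnormN x : hnorm (- x) = hnorm x.
Proof. by congr Num.sqrt; rewrite -!/(ip _ _) ipNl ipNr opprK. Qed.

Lemma hnorm_subC x y : hnorm (x - y) = hnorm (y - x).
Proof. by rewrite -hnormN opprB. Qed.

Lemma ip_Cauchy_Schwarz x y : ip x y ^+ 2 <= ip x x * ip y y.
Proof.
have [y0|y0] := eqVneq (ip y y) 0.
  by rewrite y0 (ip_eq0 y0) ip0r mulr0 expr0n.
have yp : 0 < ip y y by rewrite lt_neqAle eq_sym y0 ip_ge0.
have := ip_ge0 (x - (ip x y / ip y y)%:C *: y).
rewrite !(ipBl, ipBr) !(ipZl, ipZr) (ipC y x).
set a := ip x y; set b := ip y y; set c := ip x x => H0.
have : 0 <= (c - a / b * a - (a / b * a - a / b * (a / b * b))) * b.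
  by rewrite mulr_ge0 // ltW.
rewrite (_ : _ * b = c * b - a ^+ 2) ?subr_ge0 //.
by field.
Qed.

Lemma ip_le_hnorm x y : `|ip x y| <= hnorm x * hnorm y.
Proof.
rewrite -(@ler_pXn2r _ 2) // ?nnegrE ?mulr_ge0 ?hnorm_ge0 //.
by rewrite exprMn !hnormE -normrX ger0_norm ?sqr_ge0 ?ip_Cauchy_Schwarz.
Qed.

Lemma hnormD x y : hnorm (x + y) <= hnorm x + hnorm y.
Proof.
rewrite -(@ler_pXn2r _ 2) // ?nnegrE ?addr_ge0 ?hnorm_ge0 //.
rewrite sqrrD !hnormE ipDl !ipDr (ipC y x).
have := le_trans (ler_norm _) (ip_le_hnorm x y); lra.
Qed.

Lemma hnormB_le x y z : hnorm (x - z) <= hnorm (x - y) + hnorm (y - z).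
Proof. by rewrite -[x - z](subrKA y) hnormD. Qed.

Lemma parallelogram x y :
  ip (x + y) (x + y) + ip (x - y) (x - y) = 2 * ip x x + 2 * ip y y.
Proof. rewrite !(ipDl, ipDr, ipNl, ipNr); ring. Qed.

Lemma polarization x y :
  ip x y = (ip (x + y) (x + y) - ip (x - y) (x - y)) / 4.
Proof. rewrite !(ipDl, ipDr, ipNl, ipNr) (ipC y x); by field. Qed.

Lemma hilbert_cauchy (x : nat -> H) :
  (forall e : R, 0 < e -> exists N, forall m n, (N <= m)%N -> (N <= n)%N ->
     hnorm (x m - x n) < e) -> exists l, hcvg x l.
Proof. exact: hilbert_complete. Qed.

Lemma hcvg_cauchy (x : nat -> H) l : hcvg x l ->
  forall e : R, 0 < e -> exists N, forall m n, (N <= m)%N -> (N <= n)%N ->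
     hnorm (x m - x n) < e.
Proof.
move=> xl e e0; have [|N HN] := xl (e / 2); first by rewrite divr_gt0.
exists N => m n /HN m1 /HN n1; apply: le_lt_trans (hnormB_le _ l _) _.
by rewrite (hnorm_subC l); lra.
Qed.

Lemma hcvg_unique (x : nat -> H) l m : hcvg x l -> hcvg x m -> l = m.
Proof.
move=> xl xm; apply/eqP; rewrite -subr_eq0; apply/eqP/hnorm_eq0.
apply/eqP; rewrite eq_le hnorm_ge0 andbT leNgt; apply/negP => lm0.
have h0 : 0 < hnorm (l - m) / 2 by rewrite divr_gt0.
have [N HN] := xl _ h0; have [M HM] := xm _ h0.
have := HN _ (leq_maxl N M); have := HM _ (leq_maxr N M).
have := hnormB_le l (x (maxn N M)) m.
rewrite (hnorm_subC l (x _)); lra.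
Qed.

Lemma hcvg_cst (l : H) : hcvg (fun _ => l) l.
Proof.
move=> e e0; exists 0%N => n _.
by rewrite subrr hnorm_lt // ip0l exprn_gt0.
Qed.

Lemma hcvg_ip (x y : nat -> H) l m : hcvg x l -> hcvg y m ->
  (fun n => ip (x n) (y n)) @ \oo --> ip l m.
Proof.
move=> xl ym; apply/cvgrPdist_lt => e e0.
pose K := hnorm l + hnorm m + 1.
have K0 : 0 < K by rewrite ltr_wpDl // addr_ge0 ?hnorm_ge0.
pose d := Num.min 1 (e / (2 * K)).
have d0 : 0 < d by rewrite lt_min ltr01 divr_gt0 // mulr_gt0.
have [N HN] := xl _ d0; have [M HM] := ym _ d0.
exists (maxn N M) => // n; rewrite /= geq_max => /andP[/HN xn /HM yn].
have d1 : d <= 1 by rewrite /d ge_min lexx.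
have dK : d * (2 * K) <= e.
  by rewrite -ler_pdivlMr ?mulr_gt0 // /d ge_min lexx orbT.
have -> : ip l m - ip (x n) (y n) =
    - (ip (x n - l) (y n) + ip l (y n - m)) by rewrite ipBl ipBr; ring.
rewrite normrN; apply: le_lt_trans (ler_normD _ _) _.
have := ip_le_hnorm (x n - l) (y n); have := ip_le_hnorm l (y n - m).
have yb : hnorm (y n) <= hnorm m + 1.
  by have := hnormD (y n - m) m; rewrite subrK; lra.
have l0 := hnorm_ge0 l; have m0 := hnorm_ge0 m.
have x0 := hnorm_ge0 (x n - l); have y0 := hnorm_ge0 (y n - m).
have A : hnorm (x n - l) * hnorm (y n) <= d * (hnorm m + 1).
  by rewrite ler_pM ?hnorm_ge0 // ltW.
have B : hnorm l * hnorm (y n - m) <= hnorm l * d.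
  by rewrite ler_wpM2l // ltW.
move: dK; rewrite /K; nra.
Qed.

Definition closed_subspace (C : set H) :=
  [/\ C 0, forall a x y, C x -> C y -> C (a *: x + y) &
      forall (x : nat -> H) l, (forall n, C (x n)) -> hcvg x l -> C l].

End real_inner_product.

(** * Orthogonal projection onto closed subspaces *)

Section projection.
Context {R : realType} {H : hilbertType R}.

(** The parallelogram law, applied through midpoints, makes a minimizing sequence Cauchy. Moving its
    limit along [z] cannot decrease the distance to [x], which forces orthogonality. *)
Lemma projection (C : set H) : closed_subspace C ->
  forall x, exists2 y, C y & forall z, C z -> innerp (x - y) z = 0.
Proof.
move=> [C0 CD Ccl] x.
pose D := [set r | exists2 y, C y & r = ip (x - y) (x - y)].
have D0 : D !=set0 by exists (ip (x - 0) (x - 0)), 0.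
have Dlb : lbound D 0 by move=> _ [y _ ->]; exact: ip_ge0.
have Dinf : has_inf D by split => //; exists 0.
pose d := inf D.
have dle y : C y -> d <= ip (x - y) (x - y).
  by move=> Cy; apply: ge_inf; [exists 0|exists y].
have Cmid y z : C y -> C z -> C ((2^-1)%:C *: (y + z)).
  move=> Cy Cz; rewrite -[X in C X]addr0; apply: (CD) => //.
  by rewrite -[y]scale1r; exact: (CD).
have near_min n : exists y, C y /\ ip (x - y) (x - y) < d + n.+1%:R^-1.
  have n0 : 0 < n.+1%:R^-1 :> R by rewrite invr_gt0 ltr0n.
  have [_ [y Cy ->] yd] := inf_adherent n0 Dinf.
  by exists y.
have [y yP] := choice near_min.
have ydist m n : ip (y m - y n) (y m - y n) <= 2 * (m.+1%:R^-1 + n.+1%:R^-1).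
  have := parallelogram (x - y m) (x - y n).
  have -> : x - y m - (x - y n) = y n - y m by rewrite opprB addrC addrA subrK.
  have -> : x - y m + (x - y n) = 2%:C *: (x - (2^-1)%:C *: (y m + y n)).
    rewrite scalerBr scalerA -rmorphM /= divff // scale1r.
    by rewrite addrACA -opprD rmorph_nat scaler_nat mulr2n.
  rewrite ipZl ipZr -[y n - y m]opprB ipNl ipNr opprK.
  have := dle _ (Cmid _ _ (yP m).1 (yP n).1).
  have := (yP m).2; have := (yP n).2.
  by move: (m.+1%:R^-1) (n.+1%:R^-1) => u v; lra.
have [l yl] : exists l, hcvg y l.
  apply: hilbert_cauchy => e e0.
  have /cvgrPdist_lt/(_ (e ^+ 2 / 4)) := @cvg_harmonic R.
  case=> [|N _ HN]; first by rewrite divr_gt0 // exprn_gt0.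
  exists N => m n Nm Nn; rewrite hnorm_lt //.
  apply: le_lt_trans (ydist m n) _.
  have := HN m Nm; have := HN n Nn; rewrite /= /harmonic !sub0r !normrN.
  rewrite !ger0_norm ?invr_ge0 //.
  by move: (m.+1%:R^-1) (n.+1%:R^-1) (e ^+ 2) => u v w; lra.
have Cl : C l by apply: Ccl yl => n; exact: (yP n).1.
have ld : ip (x - l) (x - l) <= d.
  have c : hcvg (fun n => x - y n) (x - l).
    move=> e /yl[N HN]; exists N => n /HN.
    by rewrite -hnormN [- _](_ : _ = (x - y n) - (x - l)) // !opprB [RHS]addrC subrKA.
  have cd : (fun n => d + n.+1%:R^-1) @ \oo --> d.
    rewrite -[X in _ --> X]addr0; apply: cvgD; first exact: cvg_cst.
    exact: cvg_harmonic.
  apply: (ler_cvg_to (hcvg_ip c c) cd); apply: nearW => n.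
  exact/ltW/(yP n).2.
exists l => //.
have orth z : C z -> ip (x - l) z = 0.
  move=> Cz; have [z0|z0] := eqVneq (ip z z) 0.
    by rewrite (ip_eq0 z0) ip0r.
  have zp : 0 < ip z z by rewrite lt_neqAle eq_sym z0 ip_ge0.
  (* The coefficient that minimizes the distance from [x - l] to the real line through [z]; the gain
     [ip (x - l) z ^+ 2 / ip z z] must therefore be zero. *)
  pose t := ip (x - l) z / ip z z.
  have := dle _ (CD t%:C _ _ Cz Cl); rewrite opprD addrCA addrC.
  have := ld.
  rewrite !(ipBl _ (t%:C *: z)) !(ipBr _ _ (t%:C *: z)) !ipZl !ipZr (ipC z).
  rewrite (_ : t * (t * ip z z) = t * ip (x - l) z); last first.
    by congr (_ * _); rewrite /t mulfVK.
  have -> : t * ip (x - l) z = ip (x - l) z ^+ 2 / ip z z.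
    by rewrite /t mulrAC.
  move=> ld1 ld2; have : ip (x - l) z ^+ 2 / ip z z <= 0 by lra.
  rewrite pmulr_lle0 ?invr_gt0 // => s0.
  by apply/eqP; rewrite -sqrf_eq0 eq_le s0 sqr_ge0.
move=> z Cz; rewrite innerp_ip !orth //.
by rewrite -[_ *: z]addr0; apply: (CD).
Qed.

End projection.

(** * Direct sum of two Hilbert spaces *)

Section product_hilbert.
Context {R : realType} {H1 H2 : hilbertType R}.
Local Notation H := (H1 * H2)%type.
Implicit Types p q : H.

Definition prod_dot p q : R[i] := innerp p.1 q.1 + innerp p.2 q.2.

Let prod_dot_bilinear : bilinear_for *%R (Num.conj \; *%R) prod_dot.
Proof.
split=> [p a q r|p a q r]; rewrite /prod_dot /=.
  by rewrite !innerpDl !innerpZl mulrDr addrACA.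
rewrite !(innerpC p.1) !(innerpC p.2) !innerpDl !innerpZl !rmorphD !rmorphM /=.
by rewrite -!innerpC mulrDr addrACA.
Qed.

HB.instance Definition _ := bilinear_isBilinear.Build R[i] H H R[i]
  *%R (Num.conj \; *%R) prod_dot prod_dot_bilinear.

Let prod_dot_herm p q : prod_dot p q = (-1) ^+ false * Num.conj (prod_dot q p).
Proof.
by rewrite mul1r /prod_dot [in LHS]innerpC [X in _ + X]innerpC rmorphD.
Qed.

HB.instance Definition _ :=
  isHermitianSesquilinear.Build R[i] H false Num.conj prod_dot prod_dot_herm.

Let prod_dot_gt0 p : p != 0 -> 0 < prod_dot p p.
Proof.
case: p => x y; rewrite -pair_eqE /= negb_and /prod_dot /= => /orP[] n0.
  by rewrite ltr_pwDl ?dnorm_gt0 ?dnorm_ge0.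
by rewrite ltr_wpDl ?dnorm_gt0 ?dnorm_ge0.
Qed.

HB.instance Definition _ := isDotProduct.Build R[i] H prod_dot prod_dot_gt0.

Let Re_prod_dot p q : complex.Re (prod_dot p q) = ip p.1 q.1 + ip p.2 q.2.
Proof.
by rewrite /prod_dot /ip; case: (innerp p.1 q.1) (innerp p.2 q.2) => ? ? [].
Qed.

Let prod_complete (x : nat -> H) :
  (forall e : R, 0 < e -> exists N, forall m n, (N <= m)%N -> (N <= n)%N ->
     Num.sqrt (complex.Re (prod_dot (x m - x n) (x m - x n))) < e) ->
  exists l, forall e : R, 0 < e -> exists N, forall n, (N <= n)%N ->
     Num.sqrt (complex.Re (prod_dot (x n - l) (x n - l))) < e.
Proof.
have sqrt_lt (p : H) (e : R) : 0 < e ->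
    (Num.sqrt (complex.Re (prod_dot p p)) < e) =
    (ip p.1 p.1 + ip p.2 p.2 < e ^+ 2).
  move=> e0; rewrite Re_prod_dot -[in LHS](ger0_norm (ltW e0)) -sqrtr_sqr.
  by rewrite ltr_sqrt // exprn_gt0.
move=> xc.
have [a Ha] : exists a, hcvg (fun n => (x n).1) a.
  apply: hilbert_cauchy => e e0; have [N HN] := xc e e0; exists N => m n Nm Nn.
  have := HN m n Nm Nn; rewrite sqrt_lt // hnorm_lt //; apply: le_lt_trans.
  by rewrite lerDl ip_ge0.
have [b Hb] : exists b, hcvg (fun n => (x n).2) b.
  apply: hilbert_cauchy => e e0; have [N HN] := xc e e0; exists N => m n Nm Nn.
  have := HN m n Nm Nn; rewrite sqrt_lt // hnorm_lt //; apply: le_lt_trans.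
  by rewrite lerDr ip_ge0.
exists (a, b) => e e0; have e2 : 0 < e / 2 by rewrite divr_gt0.
have [N HN] := Ha _ e2; have [M HM] := Hb _ e2.
exists (maxn N M) => n; rewrite geq_max => /andP[/HN + /HM].
rewrite sqrt_lt // !hnorm_lt // expr_div_n.
by have := exprn_gt0 2 e0; rewrite /=; lra.
Qed.

HB.instance Definition _ := Lmodule_isHilbert.Build R H
  (innerp := (prod_dot : {dot H for (@Num.conj R[i])})) prod_complete.

Lemma innerp_prod p q : innerp p q = innerp p.1 q.1 + innerp p.2 q.2.
Proof. by []. Qed.

Lemma ip_prod p q : ip p q = ip p.1 q.1 + ip p.2 q.2.
Proof. exact: Re_prod_dot. Qed.

Lemma hcvg_prod (x : nat -> H) l :
  hcvg x l <-> hcvg (fun n => (x n).1) l.1 /\ hcvg (fun n => (x n).2) l.2.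
Proof.
split=> [xl|[Ha Hb]].
  split=> e e0; have [N HN] := xl e e0; exists N => n /HN;
    rewrite !hnorm_lt // ip_prod; apply: le_lt_trans.
  - by rewrite lerDl ip_ge0.
  - by rewrite lerDr ip_ge0.
move=> e e0; have e2 : 0 < e / 2 by rewrite divr_gt0.
have [N HN] := Ha _ e2; have [M HM] := Hb _ e2.
exists (maxn N M) => n; rewrite geq_max => /andP[/HN + /HM].
rewrite !hnorm_lt // ip_prod expr_div_n.
by have := exprn_gt0 2 e0; rewrite /=; lra.
Qed.

End product_hilbert.

(** * Limits in norm *)

Section limits.
Context {R : realType} {H : hilbertType R}.
Implicit Types (x y : nat -> H) (l m : H).

Lemma hcvgP x l :
  hcvg x l <-> (fun n => ip (x n - l) (x n - l)) @ \oo --> (0 : R).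
Proof.
split=> [xl|/cvgrPdist_lt xl].
  rewrite -(ip0l (0 : H)).
  suff c : hcvg (fun n => x n - l) 0 by exact: hcvg_ip.
  by move=> e /xl[N HN]; exists N => n /HN; rewrite subr0.
move=> e e0; have [|N _ HN] := xl (e ^+ 2); first exact: exprn_gt0.
exists N => n /HN; rewrite /= sub0r normrN hnorm_lt // ger0_norm //.
exact: ip_ge0.
Qed.

Lemma hcvgDZ (a : R[i]) x y l m : hcvg x l -> hcvg y m ->
  hcvg (fun n => a *: x n + y n) (a *: l + m).
Proof.
move=> /hcvgP xl /hcvgP ym; apply/hcvgP.
have -> : (0 : R) = 2 * (normc a ^+ 2 * 0) + 2 * 0 by rewrite !mulr0 addr0.
apply: (@squeeze_cvgr _ _ _ _ (fun=> 0) (fun n =>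
    2 * (normc a ^+ 2 * ip (x n - l) (x n - l)) +
    2 * ip (y n - m) (y n - m))).
- apply: nearW => n; rewrite ip_ge0 /=.
  have -> : a *: x n + y n - (a *: l + m) = a *: (x n - l) + (y n - m).
    by rewrite scalerBr opprD addrACA.
  have := parallelogram (a *: (x n - l)) (y n - m).
  have := ip_ge0 (a *: (x n - l) - (y n - m)).
  have -> : ip (a *: (x n - l)) (a *: (x n - l)) =
      normc a ^+ 2 * ip (x n - l) (x n - l).
    rewrite /ip innerpZl innerpZr.
    case: a => b c; case: (innerp _ _) => d e /=.
    by rewrite sqr_sqrtr ?addr_ge0 ?sqr_ge0 //; ring.
  lra.
- by rewrite !mulr0 addr0; exact: cvg_cst.
- by apply: cvgD; apply: cvgMr; first apply: cvgMr.
Qed.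

Lemma hcvgZ (a : R[i]) x l : hcvg x l -> hcvg (fun n => a *: x n) (a *: l).
Proof.
move=> xl; have := hcvgDZ a xl (hcvg_cst 0); rewrite addr0.
by under [X in hcvg X]eq_fun do rewrite addr0.
Qed.

Lemma cvg_innerp_eq0 x l m : hcvg x l -> (forall n, innerp (x n) m = 0) ->
  innerp l m = 0.
Proof.
move=> xl x0.
have ip0 : forall z, (forall n, ip (x n) z = 0) -> ip l z = 0.
  move=> z xz; have := hcvg_ip xl (hcvg_cst z).
  under eq_fun do rewrite xz.
  by move=> /(cvg_unique _ (cvg_cst _)) <-.
rewrite innerp_ip !ip0 // => n; last by rewrite /ip x0.
by rewrite /ip innerpZr x0 mulr0.
Qed.

End limits.

(** * Adjoints of densely defined operators *)

Section adjoint.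
Context {R : realType} {H : hilbertType R}.
Implicit Types (A N : operator H) (x y z w : H).

Lemma innerp_eq0_dense A x : densely_defined A ->
  (forall y, dom A y -> innerp y x = 0) -> x = 0.
Proof.
move=> dA x0; apply: ip_eq0; apply/eqP; rewrite eq_le ip_ge0 andbT leNgt.
apply/negP => xp.
have xn : 0 < hnorm x by rewrite /hnorm sqrtr_gt0.
have [y Ay] := dA x _ xn; have := ip_le_hnorm (x - y) x.
rewrite ipBl {2}/ip (x0 _ Ay) subr0 ger0_norm ?ip_ge0 // -hnormE expr2.
by rewrite ler_pM2r // => /le_lt_trans h /h; rewrite ltxx.
Qed.

Lemma adjoint_specB A x y z w : adjoint_spec A x z -> adjoint_spec A y w ->
  adjoint_spec A (x - y) (z - w).
Proof.
move=> xz yw u Au; rewrite innerpC [RHS]innerpC !(innerpDl, innerpNl).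
by rewrite !rmorphB /= -!innerpC xz ?yw.
Qed.

Lemma adjoint_unique A y z w : densely_defined A ->
  adjoint_spec A y z -> adjoint_spec A y w -> z = w.
Proof.
move=> dA yz yw; apply/eqP; rewrite -subr_eq0; apply/eqP.
apply: (innerp_eq0_dense dA) => x Ax; have := adjoint_specB yz yw.
move=> /(_ x Ax) <-; rewrite subrr innerpC linear0l; exact: conjc0.
Qed.

Lemma op_adjE A y z : densely_defined A -> adjoint_spec A y z ->
  op_adj A y = z.
Proof.
move=> dA yz /=; case: xgetP => [w _ yw|/(_ z)//].
exact: adjoint_unique yw yz.
Qed.

(** The graph of the adjoint is the orthogonal complement in [H * H] of the rotated graph of all
    [(- A x, x)], hence closed. *)
Lemma adjoint_spec_cvg A (y z : nat -> H) l m :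
  (forall n, adjoint_spec A (y n) (z n)) -> hcvg y l -> hcvg z m ->
  adjoint_spec A l m.
Proof.
move=> yz yl zm x Ax; apply/eqP; rewrite -subr_eq0; apply/eqP.
suff: innerp ((- A x, x) : H * H) (l, m) = 0.
  rewrite innerp_prod /= innerpNl => /eqP; rewrite addrC subr_eq0 => /eqP ->.
  exact: subrr.
rewrite innerpC (cvg_innerp_eq0 (x := fun n => (y n, z n) : H * H)).
- exact: conjc0.
- by apply/hcvg_prod.
- move=> n; rewrite innerp_prod /= innerpC [X in _ + X]innerpC innerpNl.
  by rewrite (yz n x Ax) rmorphN addNr.
Qed.

End adjoint.

(** * Resolvents from projections onto a graph *)

Section graph_projection.
Context {R : realType} {H : hilbertType R}.
Variable N : operator H.
Hypothesis Nlin : linear_operator N.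
Hypothesis Nclosed : closed_operator N.
Implicit Types (x y z w : H).

Lemma domB x y : dom N x -> dom N y -> dom N (x - y) /\ N (x - y) = N x - N y.
Proof.
move=> Nx Ny; have := Nlin.2 (-1) y x Ny Nx.
by rewrite !scaleN1r ![- _ + _]addrC.
Qed.

Lemma domZ (a : R[i]) x : dom N x -> dom N (a *: x) /\ N (a *: x) = a *: N x.
Proof.
move=> Nx; have N0 : N 0 = 0.
  have [_] := Nlin.2 (-1) 0 0 Nlin.1 Nlin.1.
  by rewrite scaler0 addr0 scaleN1r addNr.
by have := Nlin.2 a x 0 Nx Nlin.1; rewrite N0 !addr0.
Qed.

Definition graph (a : R[i]) : set (H * H) :=
  [set p | dom N p.1 /\ p.2 = a *: N p.1].

Lemma graph_closed_subspace a : a != 0 -> closed_subspace (graph a).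
Proof.
move=> a0; split.
- split; first exact: Nlin.1.
  by have := (domZ 0 Nlin.1).2; rewrite !scale0r => /= ->; rewrite scaler0.
- move=> b [x x'] [y y'] [/= Nx ->] [/= Ny ->].
  have [D E] := Nlin.2 b x y Nx Ny; split => //=.
  by rewrite E scalerDr !scalerA mulrC.
- move=> p [l m] pC /hcvg_prod[/= pl pm].
  have [|D E] := Nclosed (l := l) (m := a^-1 *: m) (fun n => (pC n).1) pl.
    have -> : (fun n => N (p n).1) = fun n => a^-1 *: (p n).2.
      by apply/funext => n; rewrite (pC n).2 scalerA mulVf // scale1r.
    exact: hcvgZ.
  by split => //=; rewrite E scalerA mulfV // scale1r.
Qed.

(* [y] is [(1 + e N^* N)^-1 x]; it is found by projecting [(x, 0)] onto the
   graph of [sqrt e N]. *)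
Lemma resolvent (e : R) x : 0 < e -> exists y z,
  [/\ dom N y, adjoint_spec N (N y) z, x = y + e%:C *: z &
   forall w, dom N w ->
     ip (x - y) (x - y) <= ip (x - w) (x - w) + e * ip (N w) (N w)].
Proof.
move=> e0; have s0 : (Num.sqrt e)%:C != 0 :> R[i].
  by rewrite -(rmorph0 (real_complex R)) (inj_eq (@complexI R)) gt_eqF ?sqrtr_gt0.
have [[y y'] [/= Ny ->] orth] := projection (graph_closed_subspace s0) (x, 0).
have key w : dom N w -> innerp (x - y) w = e%:C * innerp (N y) (N w).
  move=> Nw; have /= := orth (w, (Num.sqrt e)%:C *: N w) (conj Nw erefl).
  rewrite innerp_prod /= sub0r innerpNl innerpZl innerpZRr mulrA.
  by rewrite -rmorphM -expr2 sqr_sqrtr ?ltW // => /eqP; rewrite subr_eq0 => /eqP.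
have ec0 : e%:C != 0 :> R[i].
  by rewrite -(rmorph0 (real_complex R)) (inj_eq (@complexI R)) gt_eqF.
exists y, (e%:C^-1 *: (x - y)); split => //.
- move=> w Nw; rewrite innerpC [RHS]innerpC innerpZl (key _ Nw) mulrA mulVf //.
  by rewrite mul1r.
- by rewrite scalerA divff // scale1r addrC subrK.
move=> w Nw; have [D E] := domB Ny Nw.
have -> : x - w = (x - y) + (y - w) by rewrite addrA subrK.
have := key _ D; rewrite E => /(congr1 (@complex.Re R)).
rewrite [complex.Re _ in X in X -> _]/= -/(ip _ _) => k1.
have {k1} : ip (x - y) (y - w) = e * (ip (N y) (N y) - ip (N y) (N w)).
  by rewrite k1 -ipBr /ip; case: (innerp _ _) => a b /=; ring.
have := ip_ge0 (y - w); move: (x - y) (y - w) => a b b0 abE.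
rewrite ipDl !ipDr (ipC b a) abE; move: b0; have := ip_ge0 (N y - N w).
rewrite !ipBl !ipBr (ipC (N w)); have := ip_ge0 (N y); nra.
Qed.

(** Pairing the equation with [y] gives [|y|^2 + e |N y|^2 = 0]. *)
Lemma resolvent_unique (e : R) y z : 0 < e -> dom N y ->
  adjoint_spec N (N y) z -> y + e%:C *: z = 0 -> y = 0.
Proof.
move=> e0 Ny yz h; apply: ip_eq0.
have := congr1 (ip y) h; rewrite ipDr ipZr ip0r.
have -> : ip y z = ip (N y) (N y) by rewrite /ip (yz _ Ny).
have := ip_ge0 y; have := ip_ge0 (N y); nra.
Qed.

(** For a fixed [w] the penalty [|N w|^2 / (n + 1)] vanishes in the limit, and density of the domain
    makes [|x - w|] as small as desired. *)
Lemma resolvent_cvg x (y : nat -> H) : densely_defined N ->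
  (forall n w, dom N w -> ip (x - y n) (x - y n) <=
     ip (x - w) (x - w) + n.+1%:R^-1 * ip (N w) (N w)) ->
  hcvg y x.
Proof.
move=> dN yP e e0; have e2 : 0 < e / 2 by rewrite divr_gt0.
have [w Nw xw] := dN x _ e2.
pose K := ip (N w) (N w) + 1.
have K0 : 0 < K by rewrite ltr_wpDl ?ip_ge0.
have /cvgrPdist_lt/(_ (e ^+ 2 / (2 * K))) := @cvg_harmonic R.
case=> [|M _ HM]; first by rewrite divr_gt0 ?exprn_gt0 ?mulr_gt0.
exists M => n /HM; rewrite /= /harmonic sub0r normrN ger0_norm // => nK.
rewrite hnorm_subC hnorm_lt //; apply: le_lt_trans (yP n w Nw) _.
move: xw nK; rewrite hnorm_lt // expr_div_n /K.
have := ip_ge0 (N w).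
have : 0 < n.+1%:R^-1 :> R by rewrite invr_gt0 ltr0n.
move: (n.+1%:R^-1) (ip (N w) (N w)) (ip (x - w) (x - w)) => u v s.
have := exprn_gt0 2 e0; move: (e ^+ 2) => t t0 u0 v0 st.
by rewrite ltr_pdivlMr ?mulr_gt0 ?ltr_wpDl // => ut; lra.
Qed.

End graph_projection.

(** * Moments of normal operators *)

Section normal_moments.
Context {R : realType} {H : hilbertType R}.
Variable N : operator H.
Hypothesis Nnormal : normal_operator N.
Implicit Types (x y z w h : H).

Let Nlin : linear_operator N. Proof. by case: Nnormal. Qed.
Let Nclosed : closed_operator N. Proof. by case: Nnormal. Qed.
Let Ndense : densely_defined N. Proof. by case: Nnormal. Qed.

(** Together with [adjoint_normal] this unfolds the equality of [N^*N] and [N N^*] into its two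
    inclusions, free of the values chosen by [op_adj]. *)
Lemma normal_adjoint y z : dom N y -> adjoint_spec N (N y) z ->
  exists2 w, adjoint_spec N y w & dom N w /\ N w = z.
Proof.
case: Nnormal => _ _ _ [domE valE] Ny yz.
have yD : dom (op_comp (op_adj N) N) y by split => //; exists z.
have : dom (op_comp N (op_adj N)) y by rewrite -domE.
case=> -[w yw] Nw; have {}Nw : dom N w by rewrite -(op_adjE Ndense yw).
exists w => //; split => //.
have E : op_adj N (N y) = N (op_adj N y) by apply: valE; rewrite inE.
by rewrite -(op_adjE Ndense yw) -E (op_adjE Ndense yz).
Qed.

Lemma adjoint_normal y w : adjoint_spec N y w -> dom N w ->
  dom N y /\ adjoint_spec N (N y) (N w).
Proof.
case: Nnormal => _ _ _ [domE valE] yw Nw.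
have : dom (op_comp N (op_adj N)) y.
  split; first by exists w.
  by have := op_adjE Ndense yw => /= ->.
rewrite -domE => yD; have [Ny [z yz]] := yD; split => //.
have E : op_adj N (N y) = N (op_adj N y) by apply: valE; rewrite inE.
by rewrite -(op_adjE Ndense yw) -E (op_adjE Ndense yz).
Qed.

(** On the domain of [N^*N], [|N^* y|^2 = <N N^* y, y> = <N^*N y, y> = |N y|^2]. *)
Lemma normal_adjoint_norm y z w : dom N y -> adjoint_spec N (N y) z ->
  adjoint_spec N y w -> hnorm w = hnorm (N y).
Proof.
move=> Ny yz yw; have [w' yw' [Nw' Nw'z]] := normal_adjoint Ny yz.
rewrite (adjoint_unique Ndense yw yw') /hnorm -!/(ip _ _); congr Num.sqrt.
by rewrite /ip -(yw' _ Nw') Nw'z (yz _ Ny) innerpC; case: (innerp _ _).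
Qed.

(* [D(N^*N)] is a core of [N]: the resolvents [(1 + N^*N / n)^-1 x] tend to
   [x], and since [N N^* = N^*N] they commute with [N]. *)
Lemma normal_core x : dom N x -> exists y z : nat -> H,
  [/\ forall n, dom N (y n) /\ adjoint_spec N (N (y n)) (z n),
      hcvg y x & hcvg (fun n => N (y n)) (N x)].
Proof.
move=> Nx; have n0 n : 0 < n.+1%:R^-1 :> R by rewrite invr_gt0 ltr0n.
have P u n := resolvent Nlin Nclosed u (n0 n).
have [y /choice[z yzP]] := choice (P x).
have [v /choice[w vwP]] := choice (P (N x)).
exists y, z; split.
- by move=> n; have [] := yzP n.
- by apply: (resolvent_cvg Ndense) => n; have [] := yzP n.
rewrite (_ : (fun n => N (y n)) = v).
  by apply: (resolvent_cvg Ndense) => n; have [] := vwP n.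
apply/funext => n; have [Ny yz xE _] := yzP n; have [Nv vw NxE _] := vwP n.
have Nz : dom N (z n).
  have nc0 : (n.+1%:R^-1)%:C != 0 :> R[i].
    by rewrite -(rmorph0 (real_complex R)) (inj_eq (@complexI R)) gt_eqF.
  have -> : z n = (n.+1%:R^-1)%:C^-1 *: (x - y n).
    by rewrite xE addrAC subrr add0r scalerA mulVf // scale1r.
  exact/(domZ Nlin _ _).1/(domB Nlin _ _).1.
have [NNy NyNz] := adjoint_normal yz Nz.
have NxE' : N x = N (y n) + (n.+1%:R^-1)%:C *: N (z n).
  by rewrite {1}xE [_ + _]addrC (Nlin.2 _ _ _ Nz Ny).2 addrC.
(* Both [N (y n)] and [v n] solve the resolvent equation with right-hand side [N x], so their
   difference solves the homogeneous one. *)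
apply/eqP; rewrite -subr_eq0; apply/eqP.
apply: (resolvent_unique (N := N) (n0 n) (z := N (z n) - w n)).
- exact: (domB Nlin _ _).1.
- rewrite (domB Nlin _ _).2 //; exact: adjoint_specB.
- by rewrite scalerBr addrACA -opprD -NxE' -NxE subrr.
Qed.

(** Along the core sequence the adjoint has the same norm as [N], so its values are Cauchy because
    those of [N] are; closedness of the adjoint concludes. *)
Lemma normal_dom_adjoint x : dom N x -> exists w, adjoint_spec N x w.
Proof.
move=> /normal_core[y [z [yz yx Nyx]]].
have P n := normal_adjoint (yz n).1 (yz n).2.
have [w wP] := choice (fun n => let: ex_intro2 w h _ := P n in ex_intro _ w h).
suff [l wl] : exists l, hcvg w l.
  by exists l; exact: adjoint_spec_cvg wP yx wl.
apply: hilbert_cauchy => e e0; have [M HM] := hcvg_cauchy Nyx e0.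
exists M => m n Mm Mn.
have [D E] := domB Nlin (yz m).1 (yz n).1.
rewrite (normal_adjoint_norm D (z := z m - z n)).
- by rewrite E; exact: HM.
- by rewrite E; apply: adjoint_specB; [exact: (yz m).2|exact: (yz n).2].
- exact: adjoint_specB (wP m) (wP n).
Qed.

Definition smooth x := forall k, dom N (iter k N x).

(** This is [|N|^2 = N^*N]; [modulus_sqP] shows that on smooth vectors the adjoint is genuinely
    defined. *)
Definition modulus_sq x : H := op_adj N (N x).

Lemma smooth_image x : smooth x -> smooth (N x).
Proof. by move=> sx k; rewrite -iterSr; exact: sx. Qed.

Lemma modulus_sqP x : smooth x -> adjoint_spec N (N x) (modulus_sq x).
Proof.
move=> sx; have [w wP] := normal_dom_adjoint (sx 1%N).
by rewrite /modulus_sq (op_adjE Ndense wP).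
Qed.

(** Normality at the vector [N x]: [N N^* (N x) = N^*N (N x)]. *)
Lemma modulus_sq_comm x : smooth x ->
  dom N (modulus_sq x) /\ N (modulus_sq x) = modulus_sq (N x).
Proof.
move=> sx; have sNx := smooth_image sx.
have [w xw [Nw NwE]] := normal_adjoint (sNx 0%N) (modulus_sqP sNx).
by rewrite (adjoint_unique Ndense (modulus_sqP sx) xw).
Qed.

Lemma smooth_modulus_sq x : smooth x -> smooth (modulus_sq x).
Proof.
move=> sx k; suff [E s] : iter k N (modulus_sq x) = modulus_sq (iter k N x) /\
    smooth (iter k N x) by rewrite E; exact: (modulus_sq_comm s).1.
elim: k => [//|k [IH s]]; split; last exact: smooth_image.
by rewrite !iterS IH (modulus_sq_comm s).2.
Qed.

Lemma smooth_iter_modulus_sq k x : smooth x -> smooth (iter k modulus_sq x).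
Proof. by move=> sx; elim: k => // k IH; exact: smooth_modulus_sq. Qed.

Lemma ip_modulus_sq x y : smooth x -> smooth y ->
  ip (N x) (N y) = ip x (modulus_sq y).
Proof. by move=> sx sy; rewrite /ip (modulus_sqP sy (sx 0%N)). Qed.

Lemma modulus_sq_sym x y : smooth x -> smooth y ->
  ip (modulus_sq x) y = ip x (modulus_sq y).
Proof.
by move=> sx sy; rewrite -ip_modulus_sq // ipC -ip_modulus_sq // ipC.
Qed.

(** Symmetry collects all factors [N^*N] on one side; since they commute with [N], they can then be
    traded one at a time for a factor [N] on each side. *)
Lemma ip_iter_modulus_sq i j x : smooth x ->
  ip (iter i modulus_sq x) (iter j modulus_sq x) =
  ip (iter (i + j) N x) (iter (i + j) N x).
Proof.
move=> sx; have -> : ip (iter i modulus_sq x) (iter j modulus_sq x) =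
    ip x (iter (i + j) modulus_sq x).
  elim: i j => [//|i IH] j; rewrite iterS modulus_sq_sym.
  - by rewrite -iterS IH addSnnS.
  - exact: smooth_iter_modulus_sq.
  - exact: smooth_iter_modulus_sq.
have comm k y : smooth y ->
    N (iter k modulus_sq y) = iter k modulus_sq (N y).
  move=> sy; elim: k => // k IH; rewrite !iterS -IH.
  by rewrite (modulus_sq_comm (smooth_iter_modulus_sq k sy)).2.
move: (i + j)%N => n; elim: n x sx => [//|n IH] x sx.
rewrite !(iterSr _ N) -(IH _ (smooth_image sx)) -comm //.
by rewrite ip_modulus_sq //; exact: smooth_iter_modulus_sq.
Qed.

(** With [p = sum_i q_i s^i], the two forms are [|p(N^*N) x|^2] and [|N p(N^*N) x|^2]: positivity of
    the Hankel matrices of the moments and of the shifted moments. *)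
Lemma normal_moments_pos (q : nat -> R) n x : smooth x ->
  0 <= \sum_(i < n) \sum_(j < n) q i * q j *
         ip (iter (i + j) N x) (iter (i + j) N x) /\
  0 <= \sum_(i < n) \sum_(j < n) q i * q j *
         ip (iter (i + j).+1 N x) (iter (i + j).+1 N x).
Proof.
move=> sx; have sumE (f : nat -> H) :
    \sum_(i < n) \sum_(j < n) q i * q j * ip (f i) (f j) =
    ip (\sum_(i < n) (q i)%:C *: f i) (\sum_(i < n) (q i)%:C *: f i).
  have ip_suml y (g : 'I_n -> H) : ip (\sum_(i < n) g i) y = \sum_(i < n) ip (g i) y.
    by apply: (big_morph (fun x => ip x y)) => [u v|]; rewrite ?ipDl ?ip0l.
  rewrite ip_suml; apply: eq_bigr => i _.
  rewrite ipC ip_suml; apply: eq_bigr => j _.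
  by rewrite ipZl ipZr ipC mulrCA mulrA.
split.
  under eq_bigr do under eq_bigr do rewrite -ip_iter_modulus_sq //.
  by rewrite (sumE (fun i => iter i modulus_sq x)) ip_ge0.
rewrite (_ : \sum_(i < n) _ = \sum_(i < n) \sum_(j < n) q i * q j *
    ip (N (iter i modulus_sq x)) (N (iter j modulus_sq x))).
  by rewrite (sumE (fun i => N (iter i modulus_sq x))) ip_ge0.
apply: eq_bigr => i _; apply: eq_bigr => j _; congr (_ * _).
rewrite -addnS -ip_iter_modulus_sq // ip_modulus_sq //;
  exact: smooth_iter_modulus_sq.
Qed.

End normal_moments.

(** * Quasinormal operators are subnormal *)

Section unitary_times_selfadjoint.
Context {R : realType} {H : hilbertType R}.
Implicit Types (x y z : H).

(** The equivalence says that [M] and its adjoint have the same graph; closedness of [M] is then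
    automatic. *)
Definition selfadjoint (M : operator H) :=
  [/\ linear_operator M, densely_defined M &
      forall y z, adjoint_spec M y z <-> dom M y /\ M y = z].

Variables (M : operator H) (W Ws : {linear H -> H}).
Hypothesis Msa : selfadjoint M.
Hypothesis WWs : forall x y, innerp (W x) y = innerp x (Ws y).
Hypothesis WK : cancel W Ws.
Hypothesis WsK : cancel Ws W.
Hypothesis WM : forall x, dom M x -> dom M (W x) /\ M (W x) = W (M x).
Hypothesis WsM : forall x, dom M x -> dom M (Ws x) /\ M (Ws x) = Ws (M x).

Let N : operator H := Operator (dom M) (fun x => W (M x)).

Let N_adj y z : adjoint_spec N y z <-> dom M y /\ Ws (M y) = z.
Proof.
have [_ _ Madj] := Msa; transitivity (adjoint_spec M (Ws y) z).
  by split=> h x Mx; have := h x Mx; rewrite /= WWs.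
rewrite Madj; split=> -[D <-].
  have [D' E'] := WM D; rewrite WsK in D' E'.
  by split => //; rewrite E' WK.
by have [D' E'] := WsM D; split.
Qed.

Let N_op_adjE x : dom M x -> op_adj N x = Ws (M x).
Proof. by move=> Mx; apply: op_adjE; [case: Msa | exact/N_adj]. Qed.

Let dom_adj x : dom (op_adj N) x = dom M x.
Proof.
apply/propext; split=> [[z /N_adj[]]//|Mx].
by exists (Ws (M x)); exact/N_adj.
Qed.

(** As [W] is unitary and commutes with [M], the adjoint of [W M] is [W^* M], and the products in
    both orders equal [M^2], with equal domains. *)
Lemma normal_unitary_selfadjoint : normal_operator N.
Proof.
have [Mlin dM Madj] := Msa; split.
- split; first exact: Mlin.1.
  move=> a x y Mx My; have [D E] := Mlin.2 a x y Mx My.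
  by split => //=; rewrite E linearP.
- move=> x l m Mx xl xm.
  have {}xm : hcvg (fun n => M (x n)) (Ws m).
    move=> e /xm[k Hk]; exists k => n /Hk /=.
    have -> : M (x n) - Ws m = Ws (W (M (x n)) - m) by rewrite linearB /= WK.
    by rewrite [hnorm (Ws _)]/hnorm -WWs WsK.
  have lM : adjoint_spec M l (Ws m).
    apply: adjoint_spec_cvg xl xm => n; apply/Madj; split => //; exact: Mx.
  by have [D E] := (Madj _ _).1 lM; split => //=; rewrite E WsK.
- exact: dM.
have domE : dom (op_comp (op_adj N) N) = [set x | dom M x /\ dom M (M x)].
  apply/seteqP; split=> x [Mx h]; split => //.
    by move: h; rewrite /mkset dom_adj => /WsM[+ _]; rewrite /= WK.
  by rewrite /mkset dom_adj; exact: (WM h).1.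
split.
  rewrite domE; apply/seteqP; split=> x [].
    move=> Mx MMx; split; first by rewrite dom_adj.
    by have := N_op_adjE Mx => /= ->; exact: (WsM MMx).1.
  rewrite dom_adj => Mx h; split => //.
  have {}h : dom M (Ws (M x)) by rewrite -N_op_adjE.
  by have [] := WM h; rewrite WsK.
move=> x; rewrite domE inE => -[Mx MMx].
change (op_adj N (W (M x)) = W (M (op_adj N x))).
rewrite !N_op_adjE //; last exact: (WM MMx).1.
by rewrite (WM MMx).2 WK (WsM MMx).2 WsK.
Qed.

End unitary_times_selfadjoint.

(** * The adjoint of an isometry *)

Section isometry.
Context {R : realType} {H : hilbertType R}.
Variable U : {linear H -> H}.
Hypothesis Uiso : forall x y, innerp (U x) (U y) = innerp x y.
Implicit Types (x y z : H).

(** [Us y] is the preimage under [U] of the projection of [y] onto the range of [U], which is closed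
    because [U] preserves norms. *)
Lemma isometry_adjoint : exists Us : {linear H -> H},
  (forall x y, innerp (U x) y = innerp x (Us y)) /\ cancel U Us.
Proof.
have hnormU x : hnorm (U x) = hnorm x by rewrite /hnorm Uiso.
have Cl : closed_subspace (range U).
  split; first by exists 0; rewrite ?linear0.
  - by move=> a _ _ [x _ <-] [y _ <-]; exists (a *: x + y); rewrite ?linearP.
  - move=> y l yU yl; have [x xy] := choice (fun n => let: ex_intro2 x _ h := yU n in ex_intro (fun x => U x = y n) x h).
    have [m xm] : exists m, hcvg x m.
      apply: hilbert_cauchy => e e0; have [k Hk] := hcvg_cauchy yl e0.
      by exists k => i j ki kj; rewrite -hnormU linearB /= !xy; exact: Hk.
    exists m => //; apply: hcvg_unique yl => e /xm[k Hk]; exists k => n /Hk.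
    by rewrite -xy -linearB /= hnormU.
have ex y : exists z, forall x, innerp (U x) y = innerp x z.
  have [_ [z _ <-] orth] := projection Cl y; exists z => x.
  rewrite -[RHS]Uiso; have := orth (U x); rewrite innerpDl innerpNl => h.
  rewrite innerpC [RHS]innerpC; congr (_ ^*); apply/eqP.
  by rewrite -subr_eq0; apply/eqP/h; exists x.
have [Us UsP] := choice ex.
have uniq y z : (forall x, innerp (U x) y = innerp x z) -> Us y = z.
  move=> yz; apply/eqP; rewrite -subr_eq0; apply/eqP/ip_eq0.
  by rewrite {1}ipBr /ip -UsP -yz subrr.
have Us_lin : linear Us.
  move=> a x y; apply: uniq => z.
  rewrite innerpC [RHS]innerpC !innerpDl !innerpZl !rmorphD !rmorphM /=.
  by rewrite -!innerpC !UsP.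
pose f : {linear H -> H} := HB.pack Us (GRing.isLinear.Build R[i] H H *:%R Us Us_lin).
exists f; split; first by move=> x y; exact: UsP.
by move=> x; apply: uniq => y; exact: Uiso.
Qed.

End isometry.

(** * Unitary dilation *)

Section normal_extension.
Context {R : realType} {H : hilbertType R}.
Variables (M : operator H) (U : {linear H -> H}).
Hypothesis Msa : selfadjoint M.
Hypothesis Uiso : forall x y, innerp (U x) (U y) = innerp x y.
Hypothesis UM : forall x, dom M x -> dom M (U x) /\ M (U x) = U (M x).

(* The unitary dilation [[U, 1 - U U^*], [0, U^*]] of [U] commutes with
   [M (+) M], because so do [U] and hence [U^*]. *)
Lemma quasinormal_extension : exists (K : hilbertType R) (J : {linear H -> K})
  (N : operator K), [/\ forall x y, innerp (J x) (J y) = innerp x y,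
    normal_operator N &
    forall x, dom M x -> dom N (J x) /\ N (J x) = J (U (M x))].
Proof.
have [Us [UUs UK]] := isometry_adjoint Uiso.
have [Mlin dM Madj] := Msa.
(* For [y] in the domain of [M], [<M y, U^* x> = <M U y, x> = <U y, M x> = <y, U^* M x>];
   selfadjointness of [M] then yields the domain as well as the value. *)
have UsM x : dom M x -> dom M (Us x) /\ M (Us x) = Us (M x).
  move=> Mx; apply/Madj => y My; have [UD UE] := UM My.
  by rewrite -!UUs -UE; apply: (Madj _ _).2 => //.
have UsUs x y : innerp (Us x) y = innerp x (U y).
  by rewrite innerpC -UUs -innerpC.
pose K := (H * H)%type.
pose M2 : operator K := Operator [set p | dom M p.1 /\ dom M p.2]
  (fun p => (M p.1, M p.2)).
pose w (p : K) : K := (U p.1 + (p.2 - U (Us p.2)), Us p.2).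
(* The adjoint matrix [[[U^*, 0], [1 - U U^*, U]]]; it is also the inverse, because [U^* U = 1]. *)
pose ws (p : K) : K := (Us p.1, p.1 - U (Us p.1) + U p.2).
have UP a x y : U (a *: x + y) = a *: U x + U y by exact: linearP.
have UsP a x y : Us (a *: x + y) = a *: Us x + Us y by exact: linearP.
have w_lin : linear w.
  move=> a [p1 p2] [q1 q2]; congr pair => /=; last exact: UsP.
  rewrite UP UsP UP; rewrite scalerDr [RHS]addrACA scalerBr.
  by congr (_ + _); rewrite addrACA -opprD.
have ws_lin : linear ws.
  move=> a [p1 p2] [q1 q2]; congr pair => /=; first exact: UsP.
  rewrite !UP UsP UP; rewrite scalerDr [RHS]addrACA scalerBr.
  by congr (_ + _); rewrite addrACA -opprD.
pose W : {linear K -> K} := HB.pack w (GRing.isLinear.Build R[i] K K *:%R w w_lin).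
pose Ws : {linear K -> K} := HB.pack ws (GRing.isLinear.Build R[i] K K *:%R ws ws_lin).
have M2sa : selfadjoint M2.
  split.
  - split; first by split; exact: Mlin.1.
    move=> a [x1 x2] [y1 y2] [/= Mx1 Mx2] [/= My1 My2].
    have [D1 E1] := Mlin.2 a _ _ Mx1 My1; have [D2 E2] := Mlin.2 a _ _ Mx2 My2.
    by split; [split|rewrite /= E1 E2].
  - move=> [x1 x2] e e0; have e2 : 0 < e / 2 by rewrite divr_gt0.
    have [y1 My1 xy1] := dM x1 _ e2; have [y2 My2 xy2] := dM x2 _ e2.
    exists (y1, y2) => //; move: xy1 xy2; rewrite !hnorm_lt // ip_prod /=.
    by rewrite expr_div_n; have := exprn_gt0 2 e0; lra.
  move=> [y1 y2] [z1 z2]; split=> [h|[[/= My1 My2] [<- <-]]].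
    have M0 : M 0 = 0.
      by have := (domZ Mlin 0 Mlin.1).2; rewrite !scale0r.
    have /Madj[D1 E1] : adjoint_spec M y1 z1.
      move=> x Mx; have := h (x, 0) (conj Mx Mlin.1).
      by rewrite !innerp_prod /= M0 !linear0l !addr0.
    have /Madj[D2 E2] : adjoint_spec M y2 z2.
      move=> x Mx; have := h (0, x) (conj Mlin.1 Mx).
      by rewrite !innerp_prod /= M0 !linear0l !add0r.
    by split => //; rewrite /= E1 E2.
  move=> [x1 x2] [/= Mx1 Mx2]; rewrite !innerp_prod /=.
  by congr (_ + _); apply: (Madj _ _).2.
have WWs p q : innerp (W p) q = innerp p (Ws q).
  case: p q => [p1 p2] [q1 q2]; rewrite !innerp_prod /= /w /ws /=.
  rewrite !innerpDl innerpNl !UUs UsUs.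
  have innerpDr (x y z : H) : innerp x (y + z) = innerp x y + innerp x z.
    by rewrite innerpC innerpDl rmorphD /= -!innerpC.
  rewrite !innerpDr (linearNr innerp) /= -addrA; congr (_ + (_ - _ + _)).
  by rewrite UsUs.
have MU2 x : dom M x -> dom M (U (Us x)) /\ M (U (Us x)) = U (Us (M x)).
  move=> /UsM[D E]; have [D' E'] := UM D.
  by split => //; rewrite E' E.
have M2D x y : dom M x -> dom M y -> dom M (x + y) /\ M (x + y) = M x + M y.
  by move=> Mx My; have := Mlin.2 1 x y Mx My; rewrite !scale1r.
have UB x y : U (x - y) = U x - U y by exact: linearB.
have UD x y : U (x + y) = U x + U y by exact: linearD.
have UsB x y : Us (x - y) = Us x - Us y by exact: linearB.
have UsD x y : Us (x + y) = Us x + Us y by exact: linearD.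
have WK : cancel W Ws.
  move=> [p1 p2]; rewrite /= /w /ws /=; congr pair.
    by rewrite UsD UsB UK UK subrr addr0.
  by rewrite UsD UsB !UK subrr addr0 [U p1 + _]addrC addrK subrK.
have WsK : cancel Ws W.
  move=> [p1 p2]; rewrite /= /w /ws /=; congr pair.
    by rewrite UsD UsB !UK subrr add0r addrK addrC subrK.
  by rewrite UsD UsB !UK subrr add0r.
have WM p : dom M2 p -> dom M2 (W p) /\ M2 (W p) = W (M2 p).
  move: p => [p1 p2] [/= Mp1 Mp2]; rewrite /w /=.
  have [D1 E1] := UM Mp1; have [D2 E2] := MU2 _ Mp2; have [D3 E3] := UsM _ Mp2.
  have [D4 E4] := domB Mlin Mp2 D2; have [D5 E5] := M2D _ _ D1 D4.
  by split; [split|rewrite E5 E4 E3 E2 E1].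
have WsM p : dom M2 p -> dom M2 (Ws p) /\ M2 (Ws p) = Ws (M2 p).
  move: p => [p1 p2] [/= Mp1 Mp2]; rewrite /ws /=.
  have [D1 E1] := UM Mp2; have [D2 E2] := MU2 _ Mp1; have [D3 E3] := UsM _ Mp1.
  have [D4 E4] := domB Mlin Mp1 D2; have [D5 E5] := M2D _ _ D4 D1.
  by split; [split|rewrite E5 E4 E3 E2 E1].
have J_lin : linear (fun x : H => (x, 0) : K).
  by move=> a x y; congr pair; rewrite /= scaler0 addr0.
pose J : {linear H -> K} := HB.pack (fun x : H => (x, 0) : K)
  (GRing.isLinear.Build R[i] H K *:%R _ J_lin).
exists K, J, (Operator (dom M2) (fun x => W (M2 x))); split.
- by move=> x y; rewrite innerp_prod /= linear0l addr0.
- exact: normal_unitary_selfadjoint.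
move=> x Mx; split; first by split => //; exact: Mlin.1.
have M0 : M 0 = 0 by have := (domZ Mlin 0 Mlin.1).2; rewrite !scale0r.
have U0 : U 0 = 0 by exact: linear0.
have Us0 : Us 0 = 0 by exact: linear0.
by rewrite /= /w /= M0 Us0 U0 subr0 addr0.
Qed.

End normal_extension.

(** * The Stieltjes moment problem *)

Section nonnegative_polynomials.
Context {R : realType}.
Implicit Types (p q : {poly R}).

(** The cone of all [a + X b] with [a], [b] sums of squares, presented inductively so that
    positivity of a functional need only be tested on the two kinds of generators. *)
Inductive halfline_sos : {poly R} -> Prop :=
| halfline_sos_sqr q : halfline_sos (q ^+ 2)
| halfline_sos_Xsqr q : halfline_sos ('X * q ^+ 2)
| halfline_sosD p q : halfline_sos p -> halfline_sos q -> halfline_sos (p + q).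

(** The one product of generators that is not immediately a generator is
    [X p^2 X q^2 = (X p q)^2]. *)
Lemma halfline_sosM p q :
  halfline_sos p -> halfline_sos q -> halfline_sos (p * q).
Proof.
move=> sp sq; elim: sp q sq => {p} [p|p|p p' _ IH _ IH'] q sq.
- elim: sq => {q} [q|q|q q' _ IH _ IH'].
  + by rewrite -exprMn; constructor.
  + by rewrite mulrCA -exprMn; constructor.
  + by rewrite mulrDr; constructor.
- elim: sq => {q} [q|q|q q' _ IH _ IH'].
  + by rewrite -mulrA -exprMn; constructor.
  + rewrite (_ : _ * _ = ('X * p * q) ^+ 2); last by ring.
    by constructor.
  + by rewrite mulrDr; constructor.
- by rewrite mulrDl; constructor; [exact: IH|exact: IH'].
Qed.

Lemma halfline_sosC (c : R) : 0 <= c -> halfline_sos c%:P.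
Proof. by move=> c0; rewrite -(sqr_sqrtr c0) rmorphXn; constructor. Qed.

Lemma halfline_sosX : halfline_sos 'X.
Proof.
rewrite (_ : 'X = 'X * (1 : {poly R}) ^+ 2); first by constructor.
by rewrite expr1n mulr1.
Qed.

Lemma horner_ge0_limit q (a e : R) : 0 < e ->
  (forall x, a < x -> x < a + e -> 0 <= q.[x]) -> 0 <= q.[a].
Proof.
move=> e0 qx; rewrite leNgt; apply/negP => qa.
have /cvgrPdist_lt/(_ (- q.[a])) := @continuous_horner R q a.
rewrite oppr_gt0 => /(_ qa)[d /= d0 Hd].
pose y := a + Num.min d e / 2.
have m0 : 0 < Num.min d e by rewrite lt_min d0 e0.
have md : Num.min d e <= d by rewrite ge_min lexx.
have me : Num.min d e <= e by rewrite ge_min lexx orbT.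
have h : `|q.[a] - q.[y]| < - q.[a].
  by apply: Hd; rewrite /ball /= ltr_norml /y; apply/andP; split; lra.
have y0 : a < y by rewrite /y; lra.
have ye : y < a + e by rewrite /y; lra.
by have := qx _ y0 ye; move: h; rewrite ltr_norml => /andP[]; lra.
Qed.

(** The remainder modulo the quadratic is real, of degree at most one, and vanishes at a point off
    the real axis, so it is zero. *)
Lemma complex_root_factor p (a b : R) : b != 0 ->
  root (map_poly (real_complex R) p) (a +i* b) ->
  exists q, p = q * (('X - a%:P) ^+ 2 + (b ^+ 2)%:P).
Proof.
move=> b0 rp; pose d := ('X - a%:P) ^+ 2 + (b ^+ 2)%:P.
have sd : size d = 3%N.
  by rewrite size_polyDl ?size_exp_XsubC // size_polyC; case: (_ != _).
have d0 : d != 0 by rewrite -size_poly_eq0 sd.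
have sr : (size (p %% d)%R < 3)%N by rewrite -sd ltn_modp.
have [u0 [u1 rE]] : exists u0 u1, p %% d = u1%:P * 'X + u0%:P.
  exists (p %% d)`_0, (p %% d)`_1.
  apply/polyP => i; rewrite coefD coefMX !coefC.
  case: i => [|[|i]] /=; rewrite ?add0r ?addr0 //.
  by rewrite nth_default // -ltnS (leq_trans sr).
have [r0 r1] : u1 * a + u0 = 0 /\ u1 * b = 0.
  move: rp; rewrite rootE {1}(divp_eq p d) rmorphD rmorphM /= !hornerE.
have -> : (map_poly (real_complex R) d).[a +i* b] = 0.
  rewrite /d rmorphD rmorphXn /= rmorphB /= map_polyX !map_polyC /= !hornerE.
  by rewrite expr2; simpc; apply/eqP; rewrite eq_complex /=; apply/andP; split; apply/eqP; ring.
rewrite mulr0 add0r rE rmorphD rmorphM /= map_polyX !map_polyC /= !hornerE.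
by simpc => /=; rewrite eq_complex /= => /andP[/eqP r0 /eqP r1].
have u10 : u1 = 0 by apply/eqP; move/eqP: r1; rewrite mulf_eq0 (negPf b0) orbF.
have u00 : u0 = 0 by move: r0; rewrite u10 mul0r add0r.
have E := divp_eq p d; rewrite rE u00 u10 !polyC0 mul0r !addr0 in E.
by exists (p %/ d).
Qed.

(** Induction on the size, splitting off a complex root. A nonreal root gives a factor
    [(X - a)^2 + b^2]; a real root [a <= 0] gives [X + (- a)]; at a root [a > 0] a sign change is
    excluded, so the root is at least double and a square splits off. The cofactor stays
    nonnegative, at the root itself by continuity. *)
Lemma nonneg_halfline_sos p : (forall x, 0 <= x -> 0 <= p.[x]) ->
  halfline_sos p.
Proof.
have [n] := ubnP (size p); elim: n p => // n IH p sp p0.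
have [s1|s1] := leqP (size p) 1%N.
  rewrite (size1_polyC s1); apply: halfline_sosC.
  by have := p0 0 (lexx _); rewrite horner_coef0.
have [[a b] rz] : exists z, root (map_poly (real_complex R) p) z.
  by apply/closed_rootP; rewrite size_map_poly neq_ltn s1 orbT.
have pn0 : p != 0 by rewrite -size_poly_gt0 (ltn_trans _ s1).
have [b0|b0] := eqVneq b 0; last first.
  have [q pE] := complex_root_factor b0 rz.
  have qn0 : q != 0 by apply: contraNneq pn0 => q0; rewrite pE q0 mul0r.
  have dx x : 0 < (x - a) ^+ 2 + b ^+ 2 :> R.
    by rewrite ltr_wpDl ?sqr_ge0 // lt_neqAle sqr_ge0 eq_sym sqrf_eq0 b0.
  have sd : size (('X - a%:P) ^+ 2 + (b ^+ 2)%:P : {poly R}) = 3%N.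
    by rewrite size_polyDl ?size_exp_XsubC // size_polyC; case: (_ != _).
  rewrite pE; apply: halfline_sosM.
    apply: IH.
      move: sp; rewrite pE size_proper_mul ?sd; last first.
        by rewrite mulf_eq0 !lead_coef_eq0 (negPf qn0) /= -size_poly_eq0 sd.
      by rewrite addnC /= ltnS => /ltnW.
    move=> x x0; have := p0 x x0; rewrite pE !hornerE /=.
    by rewrite pmulr_lge0 // dx.
  constructor; first by constructor.
  exact/halfline_sosC/sqr_ge0.
have {}rz : root p a.
  move: rz; rewrite b0 -[a +i* 0]/(a%:C) /root horner_map /=.
  by rewrite -(rmorph0 (real_complex R)) (inj_eq (@complexI R)).
have [q pE] := factor_theorem _ _ rz.
have qn0 : q != 0 by apply: contraNneq pn0 => q0; rewrite pE /= q0 mul0r.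
have sq : (size p = (size q).+1)%N.
  by rewrite pE size_Mmonic ?monicXsubC // size_XsubC addn2.
have qx x : p.[x] = q.[x] * (x - a) by rewrite pE !hornerE.
have [a0|a0] := leP a 0.
  rewrite pE; apply: halfline_sosM; last first.
    rewrite -polyCN; constructor; first exact: halfline_sosX.
    by apply: halfline_sosC; rewrite oppr_ge0.
  apply: IH => [|x x0]; first by rewrite -ltnS -sq.
  have pos y : 0 < y -> 0 <= q.[y].
    move=> y0; have := p0 y (ltW y0); rewrite qx pmulr_lge0 //.
    by rewrite subr_gt0 (le_lt_trans a0).
  have [->|xn0] := eqVneq x 0; last by apply: pos; rewrite lt_neqAle eq_sym xn0.
  by apply: (horner_ge0_limit ltr01) => y y0 _; exact: pos.
have qge x : a < x -> 0 <= q.[x].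
  move=> ax; have := p0 x (ltW (lt_trans a0 ax)).
  by rewrite qx pmulr_lge0 // subr_gt0.
have qle x : 0 <= x -> x < a -> q.[x] <= 0.
  by move=> x0 xa; have := p0 x x0; rewrite qx nmulr_lge0 // subr_lt0.
have qa0 : q.[a] = 0.
  apply/eqP; rewrite eq_le; apply/andP; split; last first.
    by apply: (horner_ge0_limit ltr01) => x ax _; exact: qge.
  (* Reflection about [a] turns the limit from the left into the limit from the right. *)
  have := @horner_ge0_limit (- q \Po ((a + a)%:P - 'X)) a a a0.
  rewrite horner_comp !hornerE addrK oppr_ge0; apply => x ax xa.
  by rewrite horner_comp !hornerE oppr_ge0; apply: qle; lra.
have [q' qE] := factor_theorem _ _ (introT eqP qa0).
have q'n0 : q' != 0 by apply: contraNneq qn0 => q0; rewrite qE /= q0 mul0r.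
have pE' : p = q' * ('X - a%:P) ^+ 2 by rewrite pE qE expr2 mulrA.
rewrite pE'; apply: halfline_sosM; last by constructor.
apply: IH => [|x x0].
  rewrite -ltnS; apply: leq_trans sp; rewrite sq ltnS qE.
  by rewrite size_Mmonic ?monicXsubC // size_XsubC addn2.
have pos y : 0 <= y -> y != a -> 0 <= q'.[y].
  move=> y0 ya; have := p0 y y0; rewrite pE' hornerM horner_exp hornerXsubC pmulr_lge0 //.
  by rewrite exprn_even_gt0 //= subr_eq0.
have [->|xa] := eqVneq x a; last exact: pos.
apply: (horner_ge0_limit ltr01) => y y0 _.
by apply: pos; [exact: ltW (lt_trans a0 y0)|rewrite gt_eqF].
Qed.

End nonnegative_polynomials.

(** * The M. Riesz extension theorem *)

Section positive_extension.
Context {R : realType} {V : lmodType R}.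
Variable C : set V.
Hypothesis C0 : C 0.
Hypothesis CD : forall v w, C v -> C w -> C (v + w).
Hypothesis CZ : forall (a : R) v, 0 <= a -> C v -> C (a *: v).
Implicit Types (G : set (V * R)) (v w : V).

(* Linear functionals on subspaces of [V] are represented by their graphs. *)
Definition positive_graph G :=
  [/\ G (0, 0), forall a v w r s, G (v, r) -> G (w, s) ->
        G (a *: v + w, a * r + s) & forall v r, G (v, r) -> C v -> 0 <= r].

Lemma positive_graph_unique G v r s : positive_graph G ->
  G (v, r) -> G (v, s) -> r = s.
Proof.
move=> [G0 GD Gpos]; suff le r' s' : G (v, r') -> G (v, s') -> r' <= s'.
  by move=> Gr Gs; apply/eqP; rewrite eq_le !le.
move=> Gr Gs; have := GD (-1) _ _ _ _ Gr Gs.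
rewrite scaleN1r addNr mulN1r => /Gpos/(_ C0).
by rewrite addrC subr_ge0.
Qed.

(** The new value at [v] is the infimum of the values at elements above [v]; values at elements
    below [v] are lower bounds for it. Positivity at [w + a v] follows by dividing by [|a|] and
    comparing with one of the two families, according to the sign of [a]. *)
Lemma positive_graph_extend G v : positive_graph G ->
  (exists w r, G (w, r) /\ C (w - v)) -> (exists w r, G (w, r) /\ C (v - w)) ->
  exists G' r, [/\ positive_graph G', G `<=` G' & G' (v, r)].
Proof.
move=> [G0 GD Gpos] [w1 [r1 [Gw1 Cw1]]] [w2 [r2 [Gw2 Cw2]]].
have GZ a w r : G (w, r) -> G (a *: w, a * r).
  by move=> Gw; have := GD a _ _ _ _ Gw G0; rewrite !addr0.
have GB w r w' r' : G (w, r) -> G (w', r') -> G (w - w', r - r').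
  move=> Gw Gw'; have := GD (-1) _ _ _ _ Gw' Gw.
  by rewrite scaleN1r mulN1r ![- _ + _]addrC.
pose S := [set r | exists2 w, G (w, r) & C (w - v)].
have Slb w r : G (w, r) -> C (v - w) -> lbound S r.
  move=> Gw Cw s [w' Gw' Cw']; rewrite -subr_ge0.
  apply: Gpos (GB _ _ _ _ Gw' Gw) _.
  by have := CD Cw' Cw; rewrite subrKA.
have Sinf : has_inf S by split; [exists r1, w1|exists r2; exact: Slb Gw2 Cw2].
pose c := inf S.
pose G' := [set p : V * R | exists w r a,
  [/\ G (w, r), p.1 = w + a *: v & p.2 = r + a * c]].
exists G', c; split.
- split.
  + by exists 0, 0, 0; split => //=; rewrite ?scale0r ?mul0r addr0.
  + move=> a _ _ _ _ [w [r [b [Gw /= -> ->]]]] [w' [r' [b' [Gw' /= -> ->]]]].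
    exists (a *: w + w'), (a * r + r'), (a * b + b'); split => /=.
    * exact: GD.
    * by rewrite scalerDr scalerA addrACA scalerDl.
    * ring.
  move=> _ _ [w [r [a [Gw /= -> ->]]]] Cwav.
  have [a0|a0|a0] := ltgtP a 0.
  + have b0 : 0 < - a by rewrite oppr_gt0.
    have : c <= (- a)^-1 * r.
      apply: ge_inf; first by case: Sinf.
      exists ((- a)^-1 *: w); first exact: GZ.
      have := CZ (ltW (_ : 0 < (- a)^-1)) Cwav; rewrite invr_gt0 => /(_ b0).
      by rewrite scalerDr scalerA invrN mulNr mulVf ?lt_eqF // scaleN1r.
    by rewrite ler_pdivlMl // mulNr; lra.
  + have : a^-1 * - r <= c.
      apply: lb_le_inf; first by case: Sinf.
      apply: (Slb (a^-1 *: - w)).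
        by apply: (GZ); have := GZ (-1) _ _ Gw; rewrite scaleN1r mulN1r.
      have := CZ (ltW (_ : 0 < a^-1)) Cwav; rewrite invr_gt0 => /(_ a0).
      by rewrite scalerDr scalerA mulVf ?gt_eqF // scale1r scalerN opprK addrC.
    by rewrite ler_pdivrMl //; lra.
  + by move: Cwav; rewrite a0 scale0r mul0r !addr0; exact: Gpos.
- by move=> [w r] Gw; exists w, r, 0; split => //=; rewrite ?scale0r ?mul0r addr0.
- by exists 0, 0, 1; split => //=; rewrite ?scale1r ?mul1r add0r.
Qed.

(** A maximal extension contains every vector squeezed between two elements of the domain of [G],
    since otherwise one more step would enlarge it. *)
Lemma positive_graph_maximal G : positive_graph G ->

  exists G', [/\ positive_graph G', G `<=` G' &
    forall v, (exists w r, G (w, r) /\ C (w - v)) ->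
      (exists w r, G (w, r) /\ C (v - w)) -> exists r, G' (v, r)].
Proof.
move=> Gpos.
pose P (X : set (V * R)) := X = set0 \/ positive_graph X /\ G `<=` X.
have [F FP Ftot|X [XP Xmax]] := @Zorn_bigcup _ P.
  have [[X FX X0]|F0] := pselect (exists2 X, F X & X !=set0); last first.
    left; apply/seteqP; split=> // x [X FX Xx]; case: F0.
    by exists X => //; exists x.
  have FPn Y y : F Y -> Y y -> positive_graph Y /\ G `<=` Y.
    by move=> /FP[->//|].
  have join a b : (\bigcup_(X in F) X) a -> (\bigcup_(X in F) X) b ->
      exists Y, [/\ F Y, Y a & Y b].
    move=> [A FA Aa] [B FB Bb]; have [AB|BA] := Ftot _ _ FA FB.
      by exists B; split => //; exact: AB.
    by exists A; split => //; exact: BA.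
  right; have [x Xx] := X0; have [Xp GX] := FPn _ _ FX Xx; split; last first.
    by move=> p Gp; exists X => //; exact: GX.
  split.
  - by exists X => //; case: Xp.
  - move=> a v w r s vU wU; have [Y [FY Yv Yw]] := join _ _ vU wU.
    exists Y => //; have [[_ YD _] _] := FPn _ _ FY Yv; exact: YD.
  - by move=> v r [Y FY Yv] Cv; have [[_ _ H] _] := FPn _ _ FY Yv; exact: H Yv Cv.
have {XP} [Xp GX] : positive_graph X /\ G `<=` X.
  case: XP => // X0; exfalso; apply: (Xmax G); last by right; split.
  rewrite X0; split=> // G0; have [z _ _] := Gpos; exact: G0 z.
exists X; split => // v [w [r [Gw Cw]]] [w' [r' [Gw' Cw']]].
have [||Y [s [Yp XY Yv]]] := @positive_graph_extend X v Xp.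
- by exists w, r; split => //; exact: GX.
- by exists w', r'; split => //; exact: GX.
exists s; apply: contrapT => Xv; apply: (Xmax Y).
  by split => // YX; apply/Xv/YX.
by right; split => //; exact: subset_trans XY.
Qed.

End positive_extension.

(** * Extending a positive functional beyond polynomials *)

Section halfline_functional.
Context {R : realType}.
Implicit Types (f g : R -> R) (p q : {poly R}).

(** These functions are squeezed between two polynomials on the half-line, as the extension theorem
    demands. They include the discontinuous cut-offs of polynomials, whose values give distribution
    functions. *)
Definition poly_dominated f :=
  exists p : {poly R}, forall x : R, 0 <= x -> `|f x| <= p.[x].

Lemma poly_dominated_le f g : poly_dominated g ->
  (forall x, 0 <= x -> `|f x| <= `|g x|) -> poly_dominated f.
Proof.
by move=> [p pg] fg; exists p => x x0; apply: le_trans (fg x x0) (pg x x0).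
Qed.

Lemma poly_dominatedDZ (a : R) f g : poly_dominated f -> poly_dominated g ->
  poly_dominated (fun x => a * f x + g x).
Proof.
move=> [p pf] [q qg]; exists (`|a| *: p + q) => x x0.
rewrite !hornerE; apply: le_trans (ler_normD _ _) _; rewrite normrM.
by rewrite lerD ?qg // ler_wpM2l // pf.
Qed.

Lemma poly_dominated_horner p : poly_dominated (horner p).
Proof.
exists (\poly_(i < size p) `|p`_i|) => x x0.
rewrite [p.[x]]horner_coef horner_poly; apply: le_trans (ler_norm_sum _ _ _) _.
by apply: ler_sum => i _; rewrite normrM normrX (ger0_norm x0).
Qed.

Variable L : {poly R} -> R.
Hypothesis L_linear : forall a p q, L (a *: p + q) = a * L p + L q.
Hypothesis L_ge0 : forall p, (forall x : R, 0 <= x -> 0 <= p.[x]) -> 0 <= L p.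

Lemma halfline_functional : exists Lambda : (R -> R) -> R,
  [/\ forall a f g, poly_dominated f -> poly_dominated g ->
        Lambda (fun x => a * f x + g x) = a * Lambda f + Lambda g,
      forall f, poly_dominated f -> (forall x, 0 <= x -> 0 <= f x) ->
        0 <= Lambda f &
      forall p, Lambda (horner p) = L p].
Proof.
pose V : lmodType R := (R -> R^o).
pose C : set V := [set f : V | forall x : R, 0 <= x -> 0 <= f x :> R].
pose G : set (V * R) := [set fr | exists2 p, fr.1 = horner p & fr.2 = L p].
have C0 : C 0 by move=> x _; exact: lexx.
have CD v w : C v -> C w -> C (v + w).
  by move=> Cv Cw x x0; rewrite addr_ge0 ?Cv ?Cw.
have CZ (a : R) v : 0 <= a -> C v -> C (a *: v).
  by move=> a0 Cv x x0; rewrite mulr_ge0 ?Cv.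
have Gpos : positive_graph C G.
  split.
  - exists 0 => /=; first by apply/funext => x; rewrite horner0.
    have := L_linear (-1) 0 0; rewrite scaler0 addr0 mulN1r => ->.
    by rewrite addNr.
  - move=> a _ _ _ _ [p /= -> ->] [q /= -> ->]; exists (a *: p + q) => //=.
    by apply/funext => x; rewrite !hornerE.
  - by move=> _ _ [p /= -> ->] h; apply: L_ge0 => x x0; exact: h.
have [G' [Gp GG' tot]] := positive_graph_maximal CD CZ Gpos.
have {}tot f : poly_dominated f -> exists r, G' (f : V, r).
  move=> [p pf]; apply: tot.
    exists (horner p), (L p); split; first by exists p.
    move=> x x0; have := pf x x0; rewrite ler_norml => /andP[_].
    by rewrite -subr_ge0.
  exists (horner (- p)), (L (- p)); split; first by exists (- p).
  move=> x x0; have := pf x x0; rewrite ler_norml => /andP[+ _].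
  rewrite -subr_ge0 => h; have -> : (((f : V) - (horner (- p) : V)) x = f x + p.[x] :> R).
    by rewrite !fctE hornerN opprK.
  by move: h; rewrite opprK.
pose Lambda f : R := xget 0 [set r | G' (f : V, r)].
have LP f : poly_dominated f -> G' (f : V, Lambda f).
  by move=> /tot[r Gr]; rewrite /Lambda; case: xgetP => [s _ //|/(_ r)].
have [G0 GD Gge] := Gp.
exists Lambda; split.
- move=> a f g fd gd; have D := poly_dominatedDZ a fd gd.
  apply: (positive_graph_unique C0 Gp (LP _ D)).
  exact: GD (LP _ fd) (LP _ gd).
- by move=> f fd f0; exact: Gge (LP _ fd) f0.
- move=> p; apply: (positive_graph_unique C0 Gp (LP _ (poly_dominated_horner p))).
  by apply: GG'; exists p.
Qed.

End halfline_functional.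

(** * Right-continuous regularization *)

Section right_limit.
Context {R : realType}.
Implicit Types (F K : R -> R).

Definition rlim F x := inf [set F y | y in `]x, +oo[].

Variable F : R -> R.
Hypothesis F_ndecr : forall x y, x <= y -> F x <= F y.
Hypothesis F_ge0 : forall x, 0 <= F x.

Let has_inf_F x : has_inf [set F y | y in `]x, +oo[].
Proof.
split; first by exists (F (x + 1)), (x + 1); rewrite //= in_itv /= andbT ltrDl.
by exists 0 => _ [y _ <-].
Qed.

Lemma rlim_le x y : x < y -> rlim F x <= F y.
Proof.
move=> xy; apply: ge_inf; first by case: (has_inf_F x).
by exists y => //=; rewrite in_itv /= andbT.
Qed.

Lemma le_rlim x : F x <= rlim F x.
Proof.
apply: lb_le_inf; first by case: (has_inf_F x).
by move=> _ [y /= + <-]; rewrite in_itv /= andbT => /ltW; exact: F_ndecr.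
Qed.

Lemma rlim_nondecreasing : nondecreasing (rlim F).
Proof.
move=> x y; rewrite le_eqVlt => /orP[/eqP -> //|xy].
exact: le_trans (rlim_le xy) (le_rlim y).
Qed.

Lemma cvg_rlim x : F @ x^'+ --> rlim F x.
Proof.
apply: (@nondecreasing_at_right_cvgr _ F x +oo%O) => //.
- by move=> y z _ _; exact: F_ndecr.
- by case: (has_inf_F x).
Qed.

Lemma rlim_right_continuous x : rlim F @ x^'+ --> rlim F x.
Proof.
apply/cvgrPdist_lt => e e0.
have [_ [y xy <-] ye] := inf_adherent e0 (has_inf_F x).
move: xy; rewrite /= in_itv /= andbT => xy.
near=> z; have xz : x < z by near: z; exact: nbhs_right_gt.
have zy : z < y by near: z; exact: nbhs_right_lt.
rewrite ltr_norml; apply/andP; split.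
  by have := rlim_le zy; move: ye; rewrite -/(rlim F x); lra.
by have := rlim_nondecreasing (ltW xz); lra.
Unshelve. all: by end_near. Qed.

Lemma cvg_rlim_shift x : (fun h => F (x + h)) @ (0 : R)^'+ --> rlim F x.
Proof.
have /cvgrPdist_lt Fx := @cvg_rlim x.
apply/cvgrPdist_lt => e /Fx[d /= d0 Hd]; exists d => //= h.
rewrite /ball /= sub0r normrN => hd h0; apply: Hd; last by rewrite ltrDl.
by rewrite /ball /= opprD addrA subrr sub0r normrN.
Qed.

End right_limit.

Lemma horner_lipschitz {R : realType} (p : {poly R}) (M : R) : 0 <= M ->
  exists2 K, 0 <= K & forall x y, `|x| <= M -> `|y| <= M ->
    `|p.[x] - p.[y]| <= K * `|x - y|.
Proof.
(* A bound [B] for [p] is carried through the induction because it enters the Lipschitz constant of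
   [p * 'X + c]. *)
move=> M0; suff [K [B [K0 B0 KB]]] : exists K B, [/\ 0 <= K, 0 <= B &
    forall x y, `|x| <= M -> `|y| <= M ->
      `|p.[x]| <= B /\ `|p.[x] - p.[y]| <= K * `|x - y|].
  by exists K => // x y xM yM; have [] := KB x y xM yM.
elim/poly_ind: p => [|p c [K [B [K0 B0 KB]]]].
  exists 0, 0; split => // x y _ _.
  by rewrite !horner0 subrr normr0 mul0r.
exists (B + K * M), (B * M + `|c|); split.
- by rewrite addr_ge0 ?mulr_ge0.
- by rewrite addr_ge0 ?mulr_ge0.
move=> x y xM yM; have [px pxy] := KB x y xM yM; rewrite !hornerE; split.
  apply: le_trans (ler_normD _ _) _; rewrite lerD2r normrM.
  by rewrite ler_pM.
have -> : p.[x] * x + c - (p.[y] * y + c) =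
    p.[x] * (x - y) + (p.[x] - p.[y]) * y by ring.
apply: le_trans (ler_normD _ _) _; rewrite !normrM mulrDl lerD //.
  by rewrite ler_wpM2r.
by rewrite mulrAC ler_pM.
Qed.

(** * The representing measure as a Lebesgue-Stieltjes measure *)

Section representing_measure.
Context {R : realType}.
Implicit Types (f g : R -> R) (p q : {poly R}).
Local Notation mT := (measurableTypeR R).

Variable L : {poly R} -> R.
Hypothesis L_linear : forall a p q, L (a *: p + q) = a * L p + L q.
Hypothesis L_ge0 : forall p, (forall x : R, 0 <= x -> 0 <= p.[x]) -> 0 <= L p.
Variable Lambda : (R -> R) -> R.
Hypothesis Lambda_linear : forall a f g,
  poly_dominated f -> poly_dominated g ->
  Lambda (fun x => a * f x + g x) = a * Lambda f + Lambda g.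
Hypothesis Lambda_ge0 : forall f, poly_dominated f ->
  (forall x : R, 0 <= x -> 0 <= f x) -> 0 <= Lambda f.
Hypothesis LambdaE : forall p, Lambda (horner p) = L p.

Let Lambda_le f g : poly_dominated f -> poly_dominated g ->
  (forall x : R, 0 <= x -> f x <= g x) -> Lambda f <= Lambda g.
Proof.
move=> fd gd fg; rewrite -subr_ge0.
have := Lambda_linear (-1) fd gd; rewrite mulN1r addrC => <-.
apply: Lambda_ge0; first exact: poly_dominatedDZ.
by move=> x x0; rewrite mulN1r addrC subr_ge0 fg.
Qed.

Let cut (f : R -> R) (y x : R) : R := (x <= y)%R%:R * f x.

Let cut_dominated f y : poly_dominated f -> poly_dominated (cut f y).
Proof.
move=> fd; apply: (poly_dominated_le fd) => x _; rewrite /cut normrM.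
by case: (x <= y); rewrite ?normr1 ?mul1r // normr0 mul0r.
Qed.

Section distribution.
Variable f : R -> R.
Hypothesis f_dom : poly_dominated f.
Hypothesis f_ge0 : forall x : R, 0 <= x -> 0 <= f x.

(** Stands for the integral of [f] over []-oo, y]]. [Lambda] is only finitely additive, so this
    function need not be right-continuous; [rlim] repairs that. *)
Definition distribution y := Lambda (cut f y).

Lemma distribution_ndecr x y : x <= y -> distribution x <= distribution y.
Proof.
move=> xy; apply: Lambda_le; try exact: cut_dominated.
move=> z z0; rewrite /cut; have [zx|zx] := leP z x.
  by rewrite (le_trans zx xy).
by rewrite mul0r mulr_ge0 ?f_ge0.
Qed.

Lemma distribution_ge0 x : 0 <= distribution x.
Proof.
apply: Lambda_ge0 => [|z z0]; first exact: cut_dominated.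
by rewrite /cut mulr_ge0 ?f_ge0.
Qed.

Lemma distribution_le x : distribution x <= Lambda f.
Proof.
apply: Lambda_le => // [|z z0]; first exact: cut_dominated.
by rewrite /cut; case: (z <= x); rewrite ?mul1r // mul0r f_ge0.
Qed.

Lemma distribution_lt0 x : x < 0 -> distribution x = 0.
Proof.
move=> x0; apply/eqP; rewrite eq_le distribution_ge0 andbT.
have Z : poly_dominated (fun _ : R => 0 : R) by exists 0 => z _; rewrite horner0 normr0.
have <- : Lambda (fun=> 0) = 0.
  transitivity (Lambda (fun=> -1 * 0 + 0)).
    by congr Lambda; apply/funext => z; rewrite mulr0 addr0.
  by rewrite (Lambda_linear (-1) Z Z) mulN1r addNr.
apply: Lambda_le => // [|z z0]; first exact: cut_dominated.
by rewrite /cut (lt_geF (lt_le_trans x0 z0)) mul0r.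
Qed.

End distribution.

Let one : R -> R := fun=> 1.

Let one_dom : poly_dominated one.
Proof. by exists 1 => x _; rewrite hornerE normr1. Qed.

Let one_ge0 (x : R) : 0 <= x -> 0 <= one x. Proof. by []. Qed.

Let Lambda_one : Lambda one = L 1.
Proof. by rewrite -LambdaE; congr Lambda; apply/funext => x; rewrite hornerE. Qed.

Let one_ndecr := distribution_ndecr one_dom one_ge0.
Let dist_ge0 := distribution_ge0 one_dom one_ge0.

Let G : R -> R := rlim (distribution one).

Let G_cumulative : cumulative R R := HB.pack G (isCumulative.Build R _ R G
  (rlim_nondecreasing one_ndecr
     dist_ge0)
  (rlim_right_continuous one_ndecr
     dist_ge0)).

Let mu : {measure set mT -> \bar R} := lebesgue_stieltjes_measure G_cumulative.

Let mu_itv (a b : R) : a <= b -> mu `]a, b]%classic = (G b - G a)%:E.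
Proof.
move=> ab; transitivity (wlength G_cumulative `]a, b]%classic).
  exact: (measurable_mu_extE (wlength G_cumulative) (is_ocitv a b)).
exact: wlength_itv_bnd.
Qed.

Let G_lt0 x : x < 0 -> G x = 0.
Proof.
move=> x0; apply/eqP; rewrite eq_le; apply/andP; split; last first.
  exact: le_trans (dist_ge0 x) (le_rlim one_ndecr dist_ge0 x).
have x2 : x < x / 2 by lra.
rewrite -(distribution_lt0 one_dom one_ge0 (_ : x / 2 < 0)); last by lra.
exact: (rlim_le dist_ge0).
Qed.

Let G_le x : G x <= L 1.
Proof.
rewrite -Lambda_one; apply: le_trans (distribution_le one_dom one_ge0 (x + 1)).
by apply: (rlim_le dist_ge0); rewrite ltrDl.
Qed.

(* [rlim (distribution f)] is the distribution function of [f mu] *)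
Let G_ge x : 0 < x -> L 1 - L 'X / x <= G x.
Proof.
move=> x0; apply: le_trans (le_rlim one_ndecr dist_ge0 x).
rewrite lerBlDr -lerBlDl.
have -> : L 1 - distribution one x = Lambda (fun y => -1 * cut one x y + one y).
  by rewrite Lambda_linear ?Lambda_one ?mulN1r 1?addrC //; exact: cut_dominated.
have -> : L 'X / x = Lambda (horner (x^-1 *: 'X)).
  rewrite LambdaE -[_ *: 'X]addr0 L_linear.
  have -> : L 0 = 0.
    by have := L_linear (-1) 0 0; rewrite scaler0 addr0 mulN1r addNr.
  by rewrite addr0 mulrC.
(* Markov's inequality: on the half-line the indicator of [y > x] is at most [y / x]. *)
apply: Lambda_le => [||y y0].
- by apply: poly_dominatedDZ => //; exact: cut_dominated.
- exact: poly_dominated_horner.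
rewrite /cut /one hornerZ hornerX mulr1 mulN1r; have [yx|yx] := leP y x.
  by rewrite addNr mulr_ge0 // invr_ge0 ltW.
by rewrite oppr0 add0r ler_pdivlMl // mulr1 ltW.
Qed.

(** The inequality holds for the unregularized distributions at [a + h] and [b + h], where [Lambda]
    is monotone, and passes to the limit as [h] decreases to 0. The margin [e] is there because
    [b + h] lies beyond [b]. *)
Let rlim_distribution_ge f (c a b e : R) : poly_dominated f ->
  (forall x : R, 0 <= x -> 0 <= f x) -> a <= b -> 0 < e ->
  (forall x : R, 0 <= x -> a < x -> x < b + e -> c <= f x) ->
  c * (G b - G a) <= rlim (distribution f) b - rlim (distribution f) a.
Proof.
move=> fd f0 ab e0 cf.
have cG x := cvg_rlim_shift (x := x) one_ndecr
  dist_ge0.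
have cK x := cvg_rlim_shift (x := x) (distribution_ndecr fd f0)
  (distribution_ge0 fd f0).
have l1 : (fun h => c * (distribution one (b + h) - distribution one (a + h)))
    @ (0 : R)^'+ --> c * (G b - G a).
  by apply: cvgM; [exact: cvg_cst|apply: cvgB; exact: cG].
have l2 : (fun h => distribution f (b + h) - distribution f (a + h))
    @ (0 : R)^'+ --> rlim (distribution f) b - rlim (distribution f) a.
  by apply: cvgB; exact: cK.
apply: (ler_cvg_to l1 l2).
near=> h; have h0 : 0 < h by near: h; exact: nbhs_right_gt.
have he : h < e by near: h; exact: nbhs_right_lt.
rewrite /distribution.
have D g y : poly_dominated g -> poly_dominated (cut g y) by exact: cut_dominated.
have BE g : poly_dominated g ->
    Lambda (cut g (b + h)) - Lambda (cut g (a + h)) =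
    Lambda (fun x => -1 * cut g (a + h) x + cut g (b + h) x).
  by move=> gd; rewrite Lambda_linear ?mulN1r 1?addrC //; exact: D.
have cutE g y x : cut g y x = (x <= y)%R%:R * g x by [].
rewrite !BE // -[leLHS]addr0.
have Zd : poly_dominated (fun _ : R => 0 : R).
  by exists 0 => z _; rewrite horner0 normr0.
have {1}<- : Lambda (fun=> 0) = 0.
  transitivity (Lambda (fun=> -1 * 0 + 0)).
    by congr Lambda; apply/funext => z; rewrite mulr0 addr0.
  by rewrite (Lambda_linear (-1) Zd Zd) mulN1r addNr.
have Bd g : poly_dominated g ->
    poly_dominated (fun x => -1 * cut g (a + h) x + cut g (b + h) x).
  by move=> gd; apply: poly_dominatedDZ; exact: D.
rewrite -Lambda_linear //; last exact: Bd.
apply: Lambda_le => [||x x0].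
- by apply: poly_dominatedDZ => //; exact: Bd.
- exact: Bd.
rewrite addr0 !cutE /one !mulr1 !mulN1r.
have [xa|xa] := leP x (a + h).
  by rewrite (le_trans xa) ?lerD2r // !addNr mulr0.
rewrite !mul0r !oppr0 !add0r; have [xb|xb] := leP x (b + h); last by rewrite !mul0r mulr0.
have ax : a < x by apply: lt_trans xa; rewrite ltrDl.
have xe : x < b + e by apply: le_lt_trans xb _; rewrite ltrD2l.
by rewrite mulr1n mulr1 mul1r; exact: cf.
Unshelve. all: by end_near. Qed.

Section moment_inequality.
Variable p : {poly R}.
Hypothesis p_ge0 : forall x : R, 0 <= x -> 0 <= p.[x].

(** Freezing [p] at [p.[0]] on the negative half-line makes it nonnegative everywhere; [Lambda]
    depends only on the half-line and does not see the change. *)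
Let P (x : R) : R := p.[Num.max 0 x].

Let P_ge0 x : 0 <= P x.
Proof. by apply: p_ge0; rewrite le_max lexx. Qed.

Let PE x : 0 <= x -> P x = p.[x].
Proof. by move=> x0; rewrite /P max_r. Qed.

Let P_dom : poly_dominated P.
Proof.
by apply: poly_dominated_le (poly_dominated_horner p) _ => x x0; rewrite PE.
Qed.

Let Lambda_P : Lambda P = L p.
Proof.
rewrite -LambdaE; apply/eqP; rewrite eq_le.
by apply/andP; split; apply: Lambda_le => // *; rewrite ?PE //;
  exact: poly_dominated_horner.
Qed.

Let mP (D : set mT) : measurable_fun D (fun x : mT => (P x)%:E).
Proof.
apply: measurable_funTS; apply/measurable_EFinP.
apply: (@measurableT_comp _ _ _ _ _ _ (horner p)); first exact: measurable_poly.
exact: measurable_maxr.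
Qed.

Let K := rlim (distribution P).

Let P_ndecr := distribution_ndecr P_dom (fun x _ => P_ge0 x).
Let P_dist_ge0 := distribution_ge0 P_dom (fun x _ => P_ge0 x).

(** The integral is at most [P b + e] times the mass, while [P b - e] times the mass is at most
    [K b - K a]. The oscillation is controlled up to [b + (b - a)] to provide the margin of
    [rlim_distribution_ge]. *)
Let int_step (a b e : R) : a < b -> 0 <= e ->
  (forall x, a < x -> x < b + (b - a) -> `|P x - P b| <= e) ->
  (\int[mu]_(x in `]a, b]%classic) (P x)%:E <=
     (K b - K a + 2 * e * (G b - G a))%:E)%E.
Proof.
move=> ab e0 Pe.
apply: (@le_trans _ _ (\int[mu]_(x in `]a, b]%classic) cst (P b + e)%:E x)%E).
  apply: ge0_le_integral => //=.
  - by move=> x _; rewrite lee_fin.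
  - move=> x; rewrite /= in_itv /= => /andP[ax xb]; rewrite lee_fin.
    have xb' : x < b + (b - a) by lra.
    by have := Pe x ax xb'; rewrite ler_norml => /andP[_]; lra.
rewrite integral_cst // (mu_itv (ltW ab)) -EFinM lee_fin.
have : (P b - e) * (G b - G a) <= K b - K a.
  apply: (@rlim_distribution_ge P _ _ _ (b - a)) => //.
  - exact: ltW.
  - by rewrite subr_gt0.
  - move=> x _ ax xb; have := Pe x ax xb; rewrite ler_norml => /andP[+ _]; lra.
lra.
Qed.

(** Over a fine equal partition the bounds of [int_step] telescope. The segment starts at [-1] so
    that half-open intervals catch an atom at 0. *)
Let int_segment (M : nat) : (\int[mu]_(x in `](-1)%R, M%:R]%classic) (P x)%:E <=
  (L p)%:E)%E.
Proof.
have M0 : 0 <= M%:R :> R by [].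
have L10 : 0 <= L 1 by apply: le_trans (G_le 0); exact: le_trans (dist_ge0 0) (le_rlim one_ndecr dist_ge0 0).
have K_le x : K x <= L p.
  rewrite -Lambda_P; apply: le_trans (distribution_le P_dom (fun x _ => P_ge0 x) (x + 1)).
  by apply: (rlim_le P_dist_ge0); rewrite ltrDl.
have K_ge0 x : 0 <= K x.
  exact: le_trans (P_dist_ge0 x) (le_rlim P_ndecr P_dist_ge0 x).
have G_N1 : G (-1) = 0 by apply: G_lt0; rewrite ltrN10.
(* The margin of [int_step] is one step, of length at most [M + 1], so arguments reach at most
   [2 M + 1]. *)
pose r : R := 2 * M%:R + 2.
have r0 : 0 <= r by rewrite /r; lra.
have [C C0 HC] := horner_lipschitz p r0.
have PC x y : `|x| <= r -> `|y| <= r -> `|P x - P y| <= C * `|x - y|.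
  move=> xr yr; have mr z : `|z| <= r -> `|Num.max 0 z| <= r.
    by move=> zr; case: (leP 0 z) => // _; rewrite normr0.
  apply: le_trans (HC _ _ (mr _ xr) (mr _ yr)) _; rewrite ler_wpM2l //.
  rewrite ler_norml; have := ler_norm (x - y); have := ler_norm (y - x).
  rewrite (distrC y); case: (leP 0 x) => x0; case: (leP 0 y) => y0 h1 h2;
    by apply/andP; split; lra.
(* The total error is [2 e1] times a mass at most [L 1]; the added 1 keeps the denominator
   positive. *)
apply/lee_addgt0Pr => e e0; pose e1 := e / (2 * L 1 + 1).
have d0 : 0 < 2 * L 1 + 1 by lra.
have e10 : 0 < e1 by rewrite divr_gt0.
have [n n0 Hn] : exists2 n : nat, (0 < n)%N & C * (M%:R + 1) / n%:R <= e1.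
  have h : 0 <= C * (M%:R + 1) / e1.
    by apply: divr_ge0; [apply: mulr_ge0 => //; lra|exact: ltW].
  exists (Num.bound (C * (M%:R + 1) / e1)).+1 => //.
  rewrite ler_pdivrMr // [e1 * _]mulrC -ler_pdivrMr //.
  by apply: le_trans (ltW (archi_boundP h)) _; rewrite ler_nat.
have n0' : 0 < n%:R :> R by rewrite ltr0n.
pose d : R := (M%:R + 1) / n%:R.
have dp : 0 < d by rewrite divr_gt0 //; lra.
have dM : d <= M%:R + 1.
  by rewrite ler_pdivrMr // ler_peMr ?ler1n //; lra.
pose x k := -1 + k%:R * d : R.
have xS k : x k.+1 = x k + d by rewrite /x -natr1; ring.
have xM k : (k <= n)%N -> x k <= M%:R.
  move=> kn; rewrite /x -lerBrDl opprK mulrA ler_pdivrMr // mulrC.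
  by rewrite ler_wpM2l ?ler_nat //; lra.
have x_ge k : -1 <= x k by rewrite /x lerDl mulr_ge0 // ltW.
have step k : (k <= n)%N ->
    (\int[mu]_(s in `](-1)%R, x k]%classic) (P s)%:E <=
     (K (x k) - K (-1) + 2 * e1 * (G (x k) - G (-1)))%:E)%E.
  elim: k => [_|k IH kn].
    by rewrite /x mul0r addr0 set_itvoc0 integral_set0 !subrr mulr0 addr0.
  have xk : x k < x k.+1 by rewrite xS ltrDl.
  rewrite (@itv_bndbnd_setU _ _ (BRight (-1)) (BRight (x k)));
    rewrite ?bnd_simp //; last exact: ltW.
  rewrite ge0_integral_setU //=.
  - have -> : K (x k.+1) - K (-1) + 2 * e1 * (G (x k.+1) - G (-1)) =
       (K (x k) - K (-1) + 2 * e1 * (G (x k) - G (-1))) +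
       (K (x k.+1) - K (x k) + 2 * e1 * (G (x k.+1) - G (x k))) by ring.
    rewrite EFinD; apply: leeD; first by apply: IH; exact: ltnW.
    apply: int_step => //; first exact: ltW.
    move=> y; rewrite xS => y1 y2; have := x_ge k; have := xM _ kn.
    rewrite xS => h1 h2.
    apply: le_trans (PC _ _ _ _) _.
    + by rewrite ler_norml /r; apply/andP; split; lra.
    + by rewrite ler_norml /r; apply/andP; split; lra.
    + apply: le_trans (ler_wpM2l C0 (_ : _ <= d)) _.
        by rewrite ler_norml; apply/andP; split; lra.
      by rewrite /d mulrA.
  - by move=> y _; rewrite lee_fin.
  - by apply/disj_setPS => y [/=]; rewrite !in_itv /= => /andP[_ h1] /andP[]; rewrite ltNge h1.
have := step n (leqnn n); have -> : x n = M%:R by rewrite /x /d; field; rewrite gt_eqF.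
move=> /le_trans; apply; rewrite -EFinD lee_fin.
have h1 := K_le M%:R; have h2 := K_ge0 (-1); have h3 := G_le M%:R.
rewrite G_N1 subr0; have h4 : 2 * e1 * G M%:R <= e.
  have : 2 * e1 * G M%:R <= 2 * e1 * L 1 by rewrite ler_wpM2l // mulr_ge0 // ltW.
  have : e1 * (2 * L 1 + 1) = e by rewrite /e1 mulfVK // gt_eqF.
  lra.
lra.
Qed.

(** Exhausting by bounded segments yields only an upper bound, since mass could still be lost at
    infinity; [halfline_representation] supplies the converse for monomials. *)
Lemma int_halfline :
  (\int[mu]_(x in `[0%R, +oo[%classic) (p.[x])%:E <= (L p)%:E)%E.
Proof.
rewrite (eq_integral (fun x : mT => (P x)%:E)); last first.
  by move=> x; rewrite inE /= in_itv /= andbT => x0; rewrite PE.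
apply: (@le_trans _ _ (\int[mu]_(x in \bigcup_m `](-1)%R, m%:R]%classic) (P x)%:E)%E).
  apply: ge0_subset_integral.
  - exact: measurable_itv.
  - by apply: bigcup_measurable => k _; exact: measurable_itv.
  - exact: mP.
  - by move=> x _; rewrite lee_fin.
  move=> x; rewrite /= in_itv /= andbT => x0; exists (Num.bound x) => //.
  rewrite /= in_itv /=; apply/andP; split; first by apply: lt_le_trans x0; rewrite ltrN10.
  exact: ltW (archi_boundP x0).
have cv : (\int[mu]_(x in `](-1)%R, m%:R]%classic) (P x)%:E @[m --> \oo] -->
    \int[mu]_(x in \bigcup_m `](-1)%R, m%:R]%classic) (P x)%:E)%E.
  apply: ge0_nondecreasing_set_cvg_integral.
  - move=> m m' mm'; apply/subsetPset => x; rewrite /= !in_itv /=.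
    by move=> /andP[-> /= xm]; apply: le_trans xm _; rewrite ler_nat.
  - by move=> m; exact: measurable_itv.
  - by move=> m; exact: mP.
  - by move=> m x _; rewrite lee_fin.
rewrite -(cvg_lim _ cv) //; apply: lime_le; first by apply/cvg_ex; eexists; exact: cv.
by apply: nearW => m; exact: int_segment.
Qed.

End moment_inequality.

Let mu_lt0 : on_halfline mu.
Proof.
rewrite /on_halfline; apply/eqP; rewrite eq_le measure_ge0 andbT.
pose F m := `](- m%:R), - m.+1%:R^-1]%classic : set mT.
have F0 m : mu (F m.+1) = 0%E.
  have h : 0 < m.+2%:R^-1 :> R by rewrite invr_gt0 ltr0n.
  rewrite /F mu_itv ?G_lt0 ?subrr ?oppr_lt0 //.
  by rewrite lerN2 (@le_trans _ _ 1) ?invf_le1 ?ltr0n ?ler1n.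
have mF m : measurable (F m) by exact: measurable_itv.
have sub : (`]-oo, 0%R[%classic : set mT) `<=` \bigcup_m F m.+1.
  move=> x; rewrite /= in_itv /= => x0.
  exists (maxn (Num.bound (- x)) (Num.bound (- x)^-1)) => //.
  have nx0 : 0 <= - x by lra.
  have nx0' : 0 <= (- x)^-1 by rewrite invr_ge0.
  rewrite /F /= in_itv /=; apply/andP; split.
    rewrite ltrNl; apply: lt_le_trans (archi_boundP nx0) _.
    by rewrite ler_nat (leq_trans (leq_maxl _ _) (leqnSn _)).
  rewrite lerNr invf_ple ?posrE ?oppr_gt0 ?ltr0n //.
  apply: le_trans (ltW (archi_boundP nx0')) _.
  rewrite ler_nat; apply: leq_trans (leq_maxr (Num.bound (- x)) _) _.
  exact: leq_trans (leqnSn _) (leqnSn _).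
apply: le_trans (measure_sigma_subadditive mu (fun m => mF m.+1) (measurable_itv _) sub) _.
by rewrite eseries0.
Qed.

(** No mass escapes to infinity: by [G_ge] at most [L 'X / m] is missing on []-1, m]]. *)
Let mu_ge : ((L 1)%:E <= mu `[0%R, +oo[%classic)%E.
Proof.
apply/lee_addgt0Pr => e e0.
have [m m0 mP] : exists2 m : nat, (0 < m)%N & L 'X / m%:R <= e.
  have h : 0 <= L 'X / e.
    by rewrite divr_ge0 ?(ltW e0) // L_ge0 // => x x0; rewrite hornerX.
  exists (Num.bound (L 'X / e)).+1 => //.
  rewrite ler_pdivrMr ?ltr0n // [e * _]mulrC -ler_pdivrMr //.
  by apply: le_trans (ltW (archi_boundP h)) _; rewrite ler_nat.
have h : (mu `](-1)%R, m%:R]%classic <= mu `[0%R, +oo[%classic)%E.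
  rewrite (_ : `](-1)%R, m%:R]%classic =
      `](-1)%R, 0%R[%classic `|` `[0%R, m%:R]%classic); last first.
    rewrite -itv_bndbnd_setU // bnd_simp //; exact: ltW (ltrN10 _).
  apply: le_trans (measureU2 _ _ _) _; try exact: measurable_itv.
  rewrite -[leRHS]add0e; apply: leeD.
    rewrite -[leRHS]mu_lt0; apply: le_measure; rewrite ?inE; try exact: measurable_itv.
    by move=> x; rewrite /= !in_itv /= => /andP[].
  apply: le_measure; rewrite ?inE; try exact: measurable_itv.
  by move=> x; rewrite /= !in_itv /= => /andP[->].
rewrite -leeBlDr //; apply: le_trans h.
rewrite mu_itv; last by rewrite (@le_trans _ _ 0) ?lerN10.
rewrite -EFinB lee_fin (G_lt0 (ltrN10 R)) subr0.
have m0' : 0 < m%:R :> R by rewrite ltr0n.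
by apply: le_trans (G_ge m0'); rewrite lerD2l lerN2.
Qed.

Let L0 : L 0 = 0.
Proof.
by have := L_linear (-1) 0 0; rewrite scaler0 addr0 mulN1r addNr.
Qed.

(** For the lower bound, [int_halfline] is applied to the nonnegative polynomial
    [C + d X^(n+1) - X^n]. The terms [C * L 1] cancel because the mass is at least [L 1], and the
    remaining error [d * t] is at most [e]. *)
Lemma halfline_representation :
  exists nu : {measure set mT -> \bar R}, on_halfline nu /\
  forall n, (\int[nu]_(s in `[0%R, +oo[%classic) (s ^+ n)%:E = (L 'X^n)%:E)%E.
Proof.
exists mu; split; first exact: mu_lt0.
move=> n.
have mX k D : measurable_fun (D : set mT) (fun s : mT => (s ^+ k)%:E : \bar R).
  by apply/measurable_EFinP; exact: measurable_funX.
have mD : measurable (`[0%R, +oo[%classic : set mT) by exact: measurable_itv.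
apply/eqP; rewrite eq_le; apply/andP; split.
  have /int_halfline : forall x : R, 0 <= x -> 0 <= ('X^n : {poly R}).[x].
    by move=> x x0; rewrite hornerXn exprn_ge0.
  by under eq_integral do rewrite hornerXn.
apply/lee_addgt0Pr => e e0.
pose t := L 'X^(n.+1).
have t0 : 0 <= t by apply: L_ge0 => x x0; rewrite hornerXn exprn_ge0.
pose d := e / (t + 1).
have d0 : 0 < d by rewrite divr_gt0 //; lra.
(* [C] dominates [x^n] for [x <= 1/d], and [d x^(n+1)] dominates it beyond. *)
pose C := (d^-1) ^+ n.
have C0 : 0 <= C by rewrite exprn_ge0 // invr_ge0 ltW.
pose q : {poly R} := C%:P + d *: 'X^(n.+1).
pose p : {poly R} := q - 'X^n.
have pE (x : R) : p.[x] = C + d * x ^+ n.+1 - x ^+ n by rewrite !hornerE.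
have p_ge0 (x : R) : 0 <= x -> 0 <= p.[x].
  move=> x0; rewrite pE; have [xd|xd] := leP x d^-1.
    have : x ^+ n <= C by rewrite lerXn2r // nnegrE // invr_ge0 ltW.
    have : 0 <= d * x ^+ n.+1 by rewrite mulr_ge0 ?exprn_ge0 // ltW.
    lra.
  have : x ^+ n <= d * x ^+ n.+1.
    rewrite exprS mulrA ler_peMl ?exprn_ge0 //.
    by rewrite -ler_pdivrMl // mulr1 ltW.
  lra.
have Lp : L p = C * L 1 + d * t - L 'X^n.
  rewrite /p /q -[_ - _]addrC -scaleN1r L_linear -[C%:P]alg_polyC L_linear.
  by rewrite -[d *: _]addr0 L_linear L0 /t; ring.
have := int_halfline p_ge0.
have : (\int[mu]_(s in `[0%R, +oo[%classic) (p.[s])%:E +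
        \int[mu]_(s in `[0%R, +oo[%classic) (s ^+ n)%:E =
        \int[mu]_(s in `[0%R, +oo[%classic) (q.[s])%:E)%E.
  rewrite -ge0_integralD //=.
  - by apply: eq_integral => s _; rewrite -EFinD /p !hornerE subrK.
  - by move=> x; rewrite in_itv /= andbT => x0; rewrite lee_fin p_ge0.
  - by apply/measurable_EFinP; exact: measurable_poly.
  - by move=> x; rewrite in_itv /= andbT => x0; rewrite lee_fin exprn_ge0.
have : (C%:E * (L 1)%:E <= \int[mu]_(s in `[0%R, +oo[%classic) (q.[s])%:E)%E.
  apply: (@le_trans _ _ (\int[mu]_(s in `[0%R, +oo[%classic) (cst C%:E s))%E).
    by rewrite integral_cst //; apply: lee_wpmul2l mu_ge; rewrite lee_fin.
  apply: ge0_le_integral => //=.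
  - by apply/measurable_EFinP; exact: measurable_poly.
  - move=> x; rewrite in_itv /= andbT => x0; rewrite lee_fin /q !hornerE.
    by rewrite lerDl mulr_ge0 ?exprn_ge0 // ltW.
rewrite Lp; move: (\int[mu]_(s in `[0%R, +oo[%classic) (s ^+ n)%:E)%E => I.
have dt : d * t <= e.
  by rewrite /d mulrAC ler_pdivrMr ?ler_pM2l //; lra.
move=> + e1; rewrite -e1 => h1 h2; have {h1 h2 e1} := le_trans h1 (leeD2r I h2).
case: I => [i| |] //=; rewrite -?EFinM -?EFinD ?lee_fin ?leey //.
lra.
Qed.

End representing_measure.

(** * Stieltjes' criterion *)

Section stieltjes_existence.
Context {R : realType}.
Variable t : nat -> R.
Hypothesis t_pos : forall (q : nat -> R) n,
  0 <= \sum_(i < n) \sum_(j < n) q i * q j * t (i + j)%N.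
Hypothesis t_pos_shift : forall (q : nat -> R) n,
  0 <= \sum_(i < n) \sum_(j < n) q i * q j * t (i + j).+1.
Implicit Types p q : {poly R}.

Let L p : R := \sum_(i < size p) p`_i * t i.

Let L_widen p n : (size p <= n)%N -> L p = \sum_(i < n) p`_i * t i.
Proof.
move=> pn; rewrite /L (big_ord_widen n (fun i => p`_i * t i)) // big_mkcond.
apply: eq_bigr => i _; case: ifPn => //.
by rewrite -leqNgt => h; rewrite nth_default // mul0r.
Qed.

Let L_linear a p q : L (a *: p + q) = a * L p + L q.
Proof.
pose n := maxn (size p) (size q).
have pn : (size p <= n)%N by exact: leq_maxl.
have qn : (size q <= n)%N by exact: leq_maxr.
have pqn : (size (a *: p + q)%R <= n)%N.
  apply: leq_trans (size_polyD _ _) _; rewrite geq_max qn andbT.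
  exact: leq_trans (size_scale_leq _ _) pn.
rewrite (L_widen pqn) (L_widen pn) (L_widen qn) mulr_sumr -big_split /=.
by apply: eq_bigr => i _; rewrite coefD coefZ mulrDl mulrA.
Qed.

Let LD p q : L (p + q) = L p + L q.
Proof. by rewrite -[p]scale1r L_linear mul1r scale1r. Qed.

Let L0 : L 0 = 0.
Proof. by rewrite /L size_poly0 big_ord0. Qed.

Let LX k : L 'X^k = t k.
Proof.
rewrite /L size_polyXn (bigD1 ord_max) //= coefXn eqxx mul1r big1 ?addr0 //.
by move=> i ik; rewrite coefXn (_ : (_ == _) = false) ?mul0r //; apply/negbTE.
Qed.

Let L_Xmul k q : L ('X^k * q) = \sum_(j < size q) q`_j * t (k + j)%N.
Proof.
rewrite -{1}[q]coefK poly_def mulr_sumr (big_morph L LD L0).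
apply: eq_bigr => j _; rewrite -scalerAr -exprD -[_ *: _]addr0 L_linear L0 addr0.
by rewrite LX.
Qed.

Let L_mulXsqr k q : L ('X^k * q ^+ 2) =
  \sum_(i < size q) \sum_(j < size q) q`_i * q`_j * t (k + (i + j))%N.
Proof.
rewrite expr2 -{1}[q]coefK poly_def mulr_suml mulr_sumr (big_morph L LD L0).
apply: eq_bigr => i _; rewrite -scalerAl -scalerAr mulrA -exprD.
rewrite -[_ *: _]addr0 L_linear L0 addr0 L_Xmul mulr_sumr.
by apply: eq_bigr => j _; rewrite mulrA addnA.
Qed.

Lemma stieltjes_existence : stieltjes_moment_sequence t.
Proof.
have L_ge0 p : (forall x : R, 0 <= x -> 0 <= p.[x]) -> 0 <= L p.
  move=> /nonneg_halfline_sos; elim=> {p} [q|q|p q _ Lp _ Lq].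
  - by rewrite -[q ^+ 2]mul1r -(expr0 'X) L_mulXsqr; exact: t_pos.
  - by rewrite -['X]expr1 L_mulXsqr; exact: t_pos_shift.
  - by rewrite LD addr_ge0.
have [Lambda [lin pos LE]] := halfline_functional L_linear L_ge0.
have [mu [mu0 muE]] := halfline_representation L_linear L_ge0 lin pos LE.
by exists mu; split => // n; rewrite muE LX.
Qed.

End stieltjes_existence.

(** [J] carries [S^n h] to [N^n (J h)], so these are the moments of a smooth vector of a normal
    operator. *)
Lemma subnormal_stieltjes (R : realType) (H : hilbertType R) (S : operator H)
    (h : H) : subnormal_operator S -> dom_infty S h ->
  stieltjes_moment_sequence (fun n => hnorm (op_pow S n h) ^+ 2).
Proof.
move=> [_ _ [K [J [N [Jiso Nnormal JS]]]]] Sh.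
have pow n : iter n N (J h) = J (op_pow S n h).
  elim: n => // n IH; rewrite iterS IH.
  have [_ Snh] := Sh n.+1 I; exact: (JS _ Snh).2.
have smo : smooth N (J h).
  by move=> n; rewrite pow; have [_ Snh] := Sh n.+1 I; exact: (JS _ Snh).1.
have tE n : hnorm (op_pow S n h) ^+ 2 = ip (iter n N (J h)) (iter n N (J h)).
  by rewrite pow hnormE /ip Jiso.
by apply: stieltjes_existence => q n; under eq_bigr do under eq_bigr do rewrite tE;
  have [] := normal_moments_pos Nnormal q n smo.
Qed.

(** * Sums of measures over trees *)

Section esum_limits.
Context {R : realType} {V : choiceType}.
Local Open Scope ereal_scope.

(** Monotone convergence over an index set of any cardinality: limits commute with each finite
    subsum, and the sum is their supremum. *)
Lemma cvg_esum (I : set V) (g : nat -> V -> \bar R) :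
  (forall n i, I i -> 0 <= g n i) ->
  (forall i, I i -> {homo g ^~ i : n m / (n <= m)%N >-> n <= m}) ->
  \esum_(i in I) g n i @[n --> \oo] --> \esum_(i in I) limn (g ^~ i).
Proof.
move=> g0 gndecr.
have gle n i : I i -> g n i <= limn (g ^~ i).
  move=> Ii; have /cvg_lim -> // := ereal_nondecreasing_cvgn (gndecr i Ii).
  by apply: ereal_sup_ubound; exists n.
have sndecr : {homo (fun n => \esum_(i in I) g n i) : n m / (n <= m)%N >-> n <= m}.
  by move=> n m nm; apply: le_esum => i Ii; exact: gndecr.
suff -> : \esum_(i in I) limn (g ^~ i) =
    ereal_sup (range (fun n => \esum_(i in I) g n i)).
  exact: ereal_nondecreasing_cvgn.
apply/eqP; rewrite eq_le; apply/andP; split; last first.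
  by apply: ge_ereal_sup => _ [n _ <-]; apply: le_esum => i Ii; exact: gle.
apply: ge_ereal_sup => _ [F [finF FI] <-].
rewrite fsbig_finite //=; set s := finmap.enum_fset _.
have sI i : i \in s -> I i.
  by move=> h; apply: FI; rewrite /s in_fset_set // inE in h.
have us : uniq s by exact: finmap.fset_uniq.
rewrite big_seq.
have cs : \sum_(i <- s | i \in s) g n i @[n --> \oo] -->
    \sum_(i <- s | i \in s) limn (g ^~ i).
  apply: cvg_nnesum => i /sI Ii; first by apply: nearW => n; exact: g0.
  by apply: ereal_nondecreasing_is_cvgn; exact: gndecr.
rewrite -(cvg_lim _ cs) //; apply: lime_le; first by apply/cvg_ex; eexists; exact: cs.
apply: nearW => n; apply: (@le_trans _ _ (\esum_(i in I) g n i)).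
  by apply: ereal_sup_ubound; exists F; rewrite // fsbig_finite //= -big_seq.
by apply: ereal_sup_ubound; exists n.
Qed.

Lemma esumZl (I : set V) (c : R) (a : V -> \bar R) : (0 <= c)%R ->
  (forall i, I i -> 0 <= a i) ->
  \esum_(i in I) (c%:E * a i) = c%:E * \esum_(i in I) a i.
Proof.
have le (b : R) (f : V -> \bar R) : (0 <= b)%R -> (forall i, I i -> 0 <= f i) ->
    \esum_(i in I) (b%:E * f i) <= b%:E * \esum_(i in I) f i.
  move=> b0 f0; apply: ge_ereal_sup => _ [F [finF FI] <-].
  rewrite fsbig_finite //= big_seq -ge0_sume_distrr; last first.
    by move=> i; rewrite in_fset_set // inE => /FI; exact: f0.
  rewrite lee_wpmul2l ?lee_fin // -big_seq; apply: ereal_sup_ubound.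
  by exists F; rewrite // fsbig_finite.
move=> c0 a0; have [->|cn0] := eqVneq c 0%R.
  by rewrite mul0e esum1 // => i _; rewrite mul0e.
have cp : (0 < c)%R by rewrite lt_neqAle eq_sym cn0.
apply/eqP; rewrite eq_le le //=.
rewrite -(@lee_pmul2l _ (c^-1)%R%:E) ?lte_fin ?invr_gt0 // muleA -EFinM mulVf // mul1e.
rewrite (eq_esum (b := fun i => (c^-1)%R%:E * (c%:E * a i))); last first.
  by move=> i _; rewrite muleA -EFinM mulVf // mul1e.
by apply: le => [|i Ii]; [rewrite invr_ge0|rewrite mule_ge0 ?lee_fin ?a0].
Qed.

Lemma exchange_esum (W : choiceType) (a : V -> W -> \bar R) (I : set V) (J : set W) :
  (forall i j, I i -> J j -> 0 <= a i j) ->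
  \esum_(i in I) \esum_(j in J) a i j = \esum_(j in J) \esum_(i in I) a i j.
Proof.
move=> a0; rewrite !esum_esum //; last by move=> j i Jj Ii; exact: a0.
rewrite (@reindex_esum _ _ _ (J `*` I) (I `*` J) (fun p => (p.2, p.1))) //.
split.
- by move=> [j i] [].
- by move=> [j i] [j' i'] _ _ [-> ->].
- by move=> [i j] [Ii Jj]; exists (j, i).
Qed.

End esum_limits.

Import HBNNSimple.

(** * Integration against a sum of measures with density *)

Section integral_esum.
Context {R : realType} {d : measure_display} {T : measurableType d}.
Local Open Scope ereal_scope.

Lemma integral_nnsfun_density (m : {measure set T -> \bar R}) (D : set T)
    (k : T -> R) (h : {nnsfun T >-> R}) :
  measurable D -> measurable_fun D k -> (forall x, D x -> (0 <= k x)%R) ->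
  \int[m]_(x in D) (h x * k x)%:E =
  \sum_(r \in range h) (`|r|%:E * \int[m]_(x in D `&` h @^-1` [set r]) (k x)%:E).
Proof.
move=> mD mk k0.
have mB r : measurable (h @^-1` [set r]) by exact: measurable_sfunP.
have mi r : measurable_fun D (\1_(h @^-1` [set r]) : T -> R).
  by apply: measurable_funTS; exact: measurable_indic.
rewrite (eq_integral (fun x => \sum_(r \in range h)
    (`|r| * (\1_(h @^-1` [set r]) x * k x))%:E)); last first.
  move=> x _; rewrite fsumEFin // [in LHS]fimfunE; congr EFin.
  rewrite !fsbig_finite //= mulr_suml big_seq [RHS]big_seq.
  apply: eq_bigr => r; rewrite in_fset_set // inE => -[y _ <-].
  by rewrite mulrA ger0_norm.
rewrite ge0_integral_fsum //.
- apply: eq_fsbigr => r _.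
  under eq_integral do rewrite EFinM.
  rewrite ge0_integralZl_EFin //.
  + congr (_ * _); rewrite integral_mkcondr; apply: eq_integral => x _.
    rewrite /patch indicE; case: ifP => xr; last by rewrite mul0r.
    by rewrite mul1r.
  + by move=> x Dx; rewrite lee_fin mulr_ge0 ?k0.
  + by apply/measurable_EFinP; exact: measurable_funM.
- move=> r; apply/measurable_EFinP; apply: measurable_funM; first exact: measurable_cst.
  exact: measurable_funM.
- by move=> r x Dx; rewrite lee_fin !mulr_ge0 ?k0.
Qed.

Variables (V : choiceType) (I : set V) (c : V -> R).
Variables (m : V -> {measure set T -> \bar R}) (mu : {measure set T -> \bar R}).
Variables (D : set T) (k : T -> R).
Hypothesis c_ge0 : forall i, I i -> (0 <= c i)%R.
Hypothesis mD : measurable D.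
Hypothesis mk : measurable_fun D k.
Hypothesis k_ge0 : forall x, D x -> (0 <= k x)%R.
Hypothesis muE : forall A, measurable A -> A `<=` D ->
  mu A = \esum_(i in I) ((c i)%:E * \int[m i]_(x in A) (k x)%:E).

(** Linearity extends [muE] from sets to simple functions, and monotone convergence, in the
    integrals and in the sum, to all nonnegative [f]. Since everything is confined to [D], the
    density [1/s] can be used off the origin. *)
Lemma integral_esum (f : T -> \bar R) : measurable_fun D f ->
  (forall x, D x -> 0 <= f x) ->
  \int[mu]_(x in D) f x =
  \esum_(i in I) ((c i)%:E * \int[m i]_(x in D) (f x * (k x)%:E)).
Proof.
move=> mf f0; pose h := nnsfun_approx mD mf.
have int_ge0 i A g : (forall x, A x -> 0 <= g x) -> I i ->
    0 <= (c i)%:E * \int[m i]_(x in A) g x.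
  by move=> g0 Ii; rewrite mule_ge0 ?lee_fin ?c_ge0 // integral_ge0.
have simple n : \int[mu]_(x in D) (h n x)%:E =
    \esum_(i in I) ((c i)%:E * \int[m i]_(x in D) (h n x * k x)%:E).
  have mB r : measurable (D `&` h n @^-1` [set r]).
    by apply: measurableI => //; exact: measurable_sfunP.
  have := @integral_nnsfun_density mu D (cst 1%R) (h n) mD _ _.
  under eq_integral do rewrite mulr1.
  move=> -> //; rewrite (eq_esum (b := fun i => \sum_(r \in range (h n))
    (`|r|%:E * ((c i)%:E * \int[m i]_(x in D `&` h n @^-1` [set r]) (k x)%:E)))).
    rewrite [RHS](eq_esum (b := fun i => \sum_(r <- finmap.enum_fset (fset_set (range (h n))))
      (`|r|%:E * ((c i)%:E * \int[m i]_(x in D `&` h n @^-1` [set r]) (k x)%:E)))); last first.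
      by move=> i Ii; rewrite fsbig_finite.
    rewrite esum_sum; last first.
      move=> i r Ii _; rewrite mule_ge0 ?lee_fin //; apply: int_ge0 => // x [Dx _].
      by rewrite lee_fin k_ge0.
    rewrite fsbig_finite //=; apply: eq_bigr => r _; rewrite esumZl //; last first.
      by move=> i Ii; apply: int_ge0 => // x [Dx _]; rewrite lee_fin k_ge0.
    congr (_ * _); rewrite integral_cst // mul1e.
    by apply: muE.
  move=> i Ii; rewrite (integral_nnsfun_density (m i) (h n) mD mk k_ge0).
  rewrite !fsbig_finite //= ge0_sume_distrr.
    by apply: eq_bigr => r _; rewrite muleCA.
  move=> r _; rewrite mule_ge0 // integral_ge0 // => x [Dx _].
  by rewrite lee_fin k_ge0.
have hndecr x : {homo (fun n => h n x) : a b / (a <= b)%N >-> (a <= b)%R}.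
  by move=> a b ab; have /lefP := nd_nnsfun_approx mD mf ab; exact.
have hcvg x : D x -> (h n x)%:E @[n --> \oo] --> f x.
  by move=> Dx; exact: cvg_nnsfun_approx.
have lhs : \int[mu]_(x in D) (h n x)%:E @[n --> \oo] --> \int[mu]_(x in D) f x.
  rewrite (eq_integral (fun x => limn (fun n => (h n x)%:E))); last first.
    by move=> x; rewrite inE => Dx; rewrite (cvg_lim _ (hcvg x Dx)).
  apply: cvg_monotone_convergence => //.
  - by move=> n; apply/measurable_EFinP; exact: measurable_funTS.
  - by move=> n x _; rewrite lee_fin.
  - by move=> x _ a b ab; rewrite lee_fin hndecr.
have hk x n : D x -> 0 <= (h n x * k x)%:E.
  by move=> Dx; rewrite lee_fin mulr_ge0 ?k_ge0.
have hkndecr x : D x -> {homo (fun n => (h n x * k x)%:E) : a b / (a <= b)%N >-> a <= b}.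
  by move=> Dx a b ab; rewrite lee_fin ler_wpM2r ?k_ge0 ?hndecr.
have mhk n : measurable_fun D (fun x => (h n x * k x)%:E).
  apply/measurable_EFinP; apply: measurable_funM => //.
  exact: measurable_funTS.
have rhsi i : I i -> (c i)%:E * \int[m i]_(x in D) (h n x * k x)%:E @[n --> \oo] -->
    (c i)%:E * \int[m i]_(x in D) (f x * (k x)%:E).
  move=> Ii; apply: cvgeZl => //.
  rewrite (eq_integral (fun x => limn (fun n => (h n x * k x)%:E))); last first.
    move=> x; rewrite inE => Dx; apply/esym/cvg_lim => //.
    by under eq_fun do rewrite EFinM; apply: cvgeZr => //; exact: hcvg.
  apply: cvg_monotone_convergence => //.
  by move=> n x Dx; exact: hk.
have rhs : \esum_(i in I) ((c i)%:E * \int[m i]_(x in D) (h n x * k x)%:E)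
    @[n --> \oo] --> \esum_(i in I) ((c i)%:E * \int[m i]_(x in D) (f x * (k x)%:E)).
  rewrite [X in _ --> X](eq_esum (b := fun i => limn (fun n =>
      (c i)%:E * \int[m i]_(x in D) (h n x * k x)%:E))); last first.
    by move=> i Ii; rewrite (cvg_lim _ (rhsi i Ii)).
  apply: cvg_esum => [n i Ii|i Ii a b ab].
    by apply: int_ge0 => // x; exact: hk.
  apply: lee_wpmul2l; first by rewrite lee_fin c_ge0.
  by apply: ge0_le_integral => // x Dx; [exact: hk|exact: hkndecr].
by move: lhs; rewrite (funext simple) => /(cvg_unique _)/(_ rhs) ->.
Qed.

End integral_esum.

(** * Norms of iterated tree shifts *)

Section tree.
Context {V : choiceType} {E : rel V}.
Hypothesis treeE : directed_tree E.

Lemma parE u v : E u v -> par E v = u.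
Proof.
move=> uv; have [_ _ _ _ uniq] := treeE.
by rewrite /par; case: xgetP => [w _ wv|/(_ u)//]; exact: uniq wv uv.
Qed.

Lemma nonrootP v : nonroot E v <-> E (par E v) v.
Proof.
split=> [nv|pv r]; last by have := r (par E v); rewrite pv.
have [u uv] : exists u, E u v.
  by apply: contrapT => h; apply: nv => u; apply/negP => uv; apply: h; exists u.
by rewrite (parE uv).
Qed.

(** The map [v |-> (par v, v)] is a bijection from the non-root vertices to the edges. *)
Lemma esum_nonroot {R : realType} (a : V -> V -> \bar R) :
  (forall u v, 0 <= a u v)%E ->
  (\esum_(v in nonroot E) a (par E v) v =
   \esum_(u in [set: V]) \esum_(v in Chi E u) a u v)%E.
Proof.
move=> a0; rewrite esum_esum //.
rewrite (@reindex_esum _ _ _ (nonroot E) _ (fun v => (par E v, v))) //.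
split.
- by move=> v /nonrootP pv.
- by move=> v w _ _ [].
- by move=> [u v] [_ /= uv]; exists v; [apply/nonrootP|]; rewrite (parE uv).
Qed.

Section shift.
Context {R : realType} (lambda : V -> R[i]).
Implicit Types f : V -> R[i].
Local Notation shift := (tree_shift E lambda).

(** Extended values allow iterates of the shift to be measured before any domain condition is
    known. *)
Definition normsq f : \bar R :=
  (\esum_(v in [set: V]) ((normc (f v)) ^+ 2)%:E)%E.

Lemma normsq_ge0 f : (0 <= normsq f)%E.
Proof. by apply: esum_ge0 => v _; rewrite lee_fin sqr_ge0. Qed.

Definition basis_normsq n (u : V) : \bar R :=
  normsq (iter n shift (l2_delta u : l2 R V)).

Lemma esum_delta u (a : V -> \bar R) : (forall v, 0 <= a v)%E ->
  (\esum_(v in [set: V])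
     ((normc ((l2_delta u : l2 R V) v) ^+ 2)%:E * a v) = a u)%E.
Proof.
move=> a0; rewrite (esumID [set u]); last first.
  by move=> v _; rewrite mule_ge0 // lee_fin sqr_ge0.
rewrite setTI esum_set1; last by rewrite mule_ge0 // lee_fin sqr_ge0.
rewrite /= eqxx normc1 expr1n mul1e setTI esum1 ?adde0 // => v /= vu.
by rewrite (negbTE (introN eqP vu)) normc0 expr0n mul0e.
Qed.

(** The weight makes the formula iterable: a shift replaces [a] by the sum of [|lambda_v|^2 a_v]
    over the children. *)
Lemma normsq_shift_weighted f (a : V -> \bar R) : (forall v, 0 <= a v)%E ->
  (\esum_(v in [set: V]) ((normc (shift f v) ^+ 2)%:E * a v) =
   \esum_(u in [set: V]) ((normc (f u) ^+ 2)%:E *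
     \esum_(v in Chi E u) ((normc (lambda v) ^+ 2)%:E * a v)))%E.
Proof.
move=> a0; pose b u v := ((normc (f u) ^+ 2)%:E *
  ((normc (lambda v) ^+ 2)%:E * a v))%E.
have b0 u v : (0 <= b u v)%E by rewrite !mule_ge0 // lee_fin sqr_ge0.
rewrite [RHS](eq_esum (b := fun u => \esum_(v in Chi E u) b u v)%E); last first.
  move=> u _; rewrite -esumZl ?sqr_ge0 // => v _.
  by rewrite mule_ge0 // lee_fin sqr_ge0.
rewrite -esum_nonroot // [RHS]esum_mkcond; apply: eq_esum => v _.
rewrite /tree_shift; case: ifP => vr; last by rewrite normc0 expr0n mul0e.
by rewrite normcM exprMn EFinM /b -muleA muleCA.
Qed.

(** A Pythagoras identity: the [n]-th iterates of distinct basis vectors have disjoint supports. The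
    induction obtains it from the weighted formula. *)
Lemma normsq_shift_iter n f : (normsq (iter n shift f) =
  \esum_(u in [set: V]) ((normc (f u) ^+ 2)%:E * basis_normsq n u))%E.
Proof.
elim: n f => [|n IH] f.
  apply: eq_esum => u _; rewrite /basis_normsq /= /normsq.
  have := esum_delta u (a := fun=> 1%E); under eq_esum do rewrite mule1.
  by move=> ->; rewrite ?mule1.
have key g : (normsq (iter n.+1 shift g) =
    \esum_(u in [set: V]) ((normc (g u) ^+ 2)%:E * \esum_(v in Chi E u)
      ((normc (lambda v) ^+ 2)%:E * basis_normsq n v)))%E.
  by rewrite iterSr IH normsq_shift_weighted // => v; exact: normsq_ge0.
rewrite key; apply: eq_esum => u _; congr (_ * _)%E.
rewrite /basis_normsq key esum_delta // => v; apply: esum_ge0 => w _.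
by rewrite mule_ge0 ?lee_fin ?sqr_ge0 // normsq_ge0.
Qed.

(** This recursion is why the sum of [|lambda_v|^2 mu_v] over the children of [u] represents the
    shifted sequence at [u]. *)
Lemma basis_normsqS n u : (basis_normsq n.+1 u =
  \esum_(v in Chi E u) ((normc (lambda v) ^+ 2)%:E * basis_normsq n v))%E.
Proof.
rewrite /basis_normsq iterSr normsq_shift_iter normsq_shift_weighted.
  rewrite esum_delta // => v; apply: esum_ge0 => w _.
  by rewrite mule_ge0 ?lee_fin ?sqr_ge0 // normsq_ge0.
by move=> v; exact: normsq_ge0.
Qed.

Lemma basis_normsq0 u : basis_normsq 0 u = 1%E.
Proof.
rewrite /basis_normsq /= /normsq.
have := esum_delta u (a := fun=> 1%E); under eq_esum do rewrite mule1.
exact.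
Qed.

Local Notation S := (weighted_shift E lambda).

Lemma weighted_shiftE (f : l2 R V) : dom S f -> val (S f) = shift f.
Proof. by move=> Sf; rewrite /= insubdK. Qed.

Lemma op_pow_shift n (f : l2 R V) : dom (op_pow S n) f ->
  val (op_pow S n f) = iter n shift f.
Proof.
elim: n => // n IH [Snf SSnf].
by rewrite iterS -IH //; exact: weighted_shiftE.
Qed.

Lemma hnorm_op_pow n (f : l2 R V) : dom (op_pow S n) f ->
  ((hnorm (op_pow S n f) ^+ 2)%:E = normsq (iter n shift f))%E.
Proof. by move=> /op_pow_shift <-; exact: l2_hnormE. Qed.

Lemma l2_lin_delta_basis u : l2_lin_delta (l2_delta u : l2 R V).
Proof.
by exists 1%N, (fun=> 1), (fun=> u); rewrite big_ord1 scale1r.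
Qed.

Lemma hnorm_pow_basis n u : dom_infty S (l2_delta u) ->
  ((hnorm (op_pow S n (l2_delta u)) ^+ 2)%:E = basis_normsq n u)%E.
Proof. by move=> Su; apply: hnorm_op_pow; exact: Su n I. Qed.

End shift.
End tree.

(** * Measures given by densities and by sums *)

Section derived_measures.
Context {R : realType} {d : measure_display} {T : measurableType d}.
Local Open Scope ereal_scope.

Section density.
Variables (m : {measure set T -> \bar R}) (k : T -> R).
Hypothesis mk : measurable_fun setT k.
Hypothesis k_ge0 : forall x, (0 <= k x)%R.

Definition density (A : set T) : \bar R := \int[m]_(x in A) (k x)%:E.

Lemma density_measure : exists nu : {measure set T -> \bar R},
  forall A, nu A = density A.
Proof.
have d0 : density set0 = 0 by exact: integral_set0.
have dge A : 0 <= density A by apply: integral_ge0 => x _; rewrite lee_fin.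
have ds : semi_sigma_additive density.
  move=> F mF tF mUF; rewrite /density ge0_integral_bigcup //.
  - apply: is_cvg_nneseries => n _ _; exact: dge.
  - by apply/measurable_EFinP; exact: measurable_funTS.
  - by move=> x _; rewrite lee_fin.
pose nu : {measure set T -> \bar R} :=
  HB.pack density (isMeasure.Build _ _ _ density d0 dge ds).
by exists nu.
Qed.

Lemma integral_density (nu : {measure set T -> \bar R}) D (f : T -> \bar R) :
  (forall A, measurable A -> nu A = density A) -> measurable D ->
  measurable_fun D f -> (forall x, D x -> 0 <= f x) ->
  \int[nu]_(x in D) f x = \int[m]_(x in D) (f x * (k x)%:E).
Proof.
move=> nuE mD mf f0.
rewrite (@integral_esum _ _ _ unit [set tt] (fun=> 1%R) (fun=> m) nu D k) //.
- rewrite esum_set1 mul1e // integral_ge0 // => x Dx.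
  by rewrite mule_ge0 ?f0 // lee_fin.
- exact: measurable_funTS.
- move=> A mA _; rewrite nuE // esum_set1 mul1e //.
  by rewrite integral_ge0 // => x _; rewrite lee_fin.
Qed.

End density.

Section sum.
Variables (V : choiceType) (I : set V) (c : V -> R).
Variable m : V -> {measure set T -> \bar R}.
Hypothesis c_ge0 : forall i, (0 <= c i)%R.

Lemma esum_measure : exists nu : {measure set T -> \bar R},
  forall A, nu A = \esum_(i in I) ((c i)%:E * m i A).
Proof.
pose nu A := \esum_(i in I) ((c i)%:E * m i A).
have ge0 i A : 0 <= (c i)%:E * m i A by rewrite mule_ge0 ?lee_fin.
have nu0 : nu set0 = 0 by apply: esum1 => i _; rewrite measure0 mule0.
have nuge A : 0 <= nu A by apply: esum_ge0 => i _.
have nus : semi_sigma_additive nu.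
  move=> F mF tF mUF.
  rewrite [X in _ --> X](_ : _ = \sum_(0 <= n <oo) nu (F n)).
    by apply: is_cvg_nneseries => n _ _; exact: nuge.
  rewrite nneseries_esumT //.
  rewrite [RHS]exchange_esum //; apply: eq_esum => i Ii.
  rewrite esumZl //; congr (_ * _).
  rewrite measure_bigcup // nneseries_esum //.
  by congr esum; apply/seteqP; split=> // x _ /=; rewrite inE.
pose nu' : {measure set T -> \bar R} :=
  HB.pack nu (isMeasure.Build _ _ _ nu nu0 nuge nus).
by exists nu'.
Qed.

Lemma integral_esum_measure (nu : {measure set T -> \bar R}) D (f : T -> \bar R) :
  (forall A, measurable A -> nu A = \esum_(i in I) ((c i)%:E * m i A)) ->
  measurable D -> measurable_fun D f -> (forall x, D x -> 0 <= f x) ->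
  \int[nu]_(x in D) f x = \esum_(i in I) ((c i)%:E * \int[m i]_(x in D) f x).
Proof.
move=> nuE mD mf f0.
rewrite (@integral_esum _ _ _ V I c m nu D (cst 1%R)) //.
- by apply: eq_esum => i _; under eq_integral do rewrite mule1.
- move=> A mA _; rewrite nuE //; apply: eq_esum => i _.
  by rewrite -[m i A]mul1e -integral_cst.
Qed.

End sum.

Section normalized.
Variables (m : {measure set T -> \bar R}) (m1 : m setT = 1).

(** Nothing is rescaled: this is a copy of [m], indexed by the proof of mass one, that can carry the
    probability structure. *)
Definition normalized_measure (_ : m setT = 1) (A : set T) : \bar R := m A.

HB.instance Definition _ := Measure.copy (normalized_measure m1) m.
HB.instance Definition _ :=
  Measure_isProbability.Build _ _ _ (normalized_measure m1) m1.

Lemma normalized_measureP : exists P : probability T R, forall A, P A = m A.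
Proof. by exists (normalized_measure m1). Qed.

End normalized.

End derived_measures.

(** * From determinacy to a consistent system *)

Section consistent_system.
Context {R : realType} {V : choiceType} {E : rel V} {lambda : V -> R[i]}.
Hypothesis treeE : directed_tree E.
Local Notation S := (weighted_shift E lambda).
Local Notation mT := (measurableTypeR R).
Local Notation w := (fun v => normc (lambda v) ^+ 2).
Hypothesis S_basis : @l2_lin_delta R V `<=` dom_infty S.

Lemma stieltjes_consistent_system :
  (forall u, determinate_stieltjes (fun n =>
     hnorm (op_pow S n.+1 (l2_delta u)) ^+ 2)) ->
  (forall u, stieltjes_moment_sequence (fun n =>
     hnorm (op_pow S n (l2_delta u)) ^+ 2)) ->
  exists (mu : V -> probability (measurableTypeR R) R) (eps : V -> R),
    [/\ forall u, on_halfline (mu u),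
        forall u, 0 <= eps u &
        forall u (sigma : set (measurableTypeR R)),
          measurable sigma -> sigma `<=` `[0%R, +oo[%classic ->
          (mu u sigma =
            \esum_(v in Chi E u) ((normc (lambda v) ^+ 2)%:E *
               \int[mu v]_(s in sigma) (s%:E)^-1)
            + (eps u)%:E * \d_(0%R : R) sigma)%E].
Proof.
move=> det /choice[m mP].
have Su u : dom_infty S (l2_delta u) by apply: S_basis; exact: l2_lin_delta_basis.
have mom u n : (\int[m u]_(s in `[0%R, +oo[%classic) (s ^+ n)%:E =
    basis_normsq (E := E) lambda n u)%E.
  by rewrite -hnorm_pow_basis //; exact: (mP u).2.
have mI : measurable (`[0%R, +oo[%classic : set mT) by exact: measurable_itv.
have mN : measurable (`]-oo, 0%R[%classic : set mT) by exact: measurable_itv.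
have splitT : [set: mT] = `]-oo, 0%R[%classic `|` `[0%R, +oo[%classic.
  by rewrite -itv_bndbnd_setU // set_itvE.
(* The moment of order 0 is [|e_u|^2 = 1]. *)
have m1 u : m u [set: mT] = 1%E.
  rewrite splitT measureU //; last first.
    by rewrite -subset0 => x [/=]; rewrite !in_itv /= andbT ltNge => /negbTE ->.
  rewrite [X in (X + _)%E](mP u).1 add0e -[LHS]mul1e.
  rewrite -(@integral_cst _ _ _ (m u) _ mI 1%E).
  have h := mom u 0%N; rewrite basis_normsq0 in h; rewrite -[RHS]h.
  by apply: eq_integral => x _; rewrite expr0.
have [P PE] := choice (fun u => normalized_measureP (m1 u)).
have intP u (A : set mT) (f : mT -> \bar R) :
    (\int[P u]_(s in A) f s = \int[m u]_(s in A) f s)%E.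
  by apply: eq_measure_integral => B mB _; exact: PE.
have mX (D : set mT) n : measurable_fun D (fun s : mT => (s ^+ n)%:E : \bar R).
  by apply/measurable_EFinP; exact: measurable_funX.
(* [s d(mu_u)] and [sum |lambda_v|^2 mu_v] represent the same determinate
   sequence. *)
pose k (s : mT) : R := Num.max s 0.
have mk : measurable_fun setT k by apply: measurable_maxr.
have k0 s : 0 <= k s by rewrite /k le_max lexx orbT.
have w0 v : 0 <= w v by exact: sqr_ge0.
have same u : exists rho nu : {measure set mT -> \bar R},
    [/\ forall A, rho A = density (m u) k A,
        forall A, nu A = (\esum_(v in Chi E u) ((w v)%:E * m v A))%E &
        forall A, measurable A -> rho A = nu A].
  have [rho rhoE] := density_measure (m u) mk k0.
  have [nu nuE] := esum_measure (Chi E u) m w0.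
  exists rho, nu; split=> // A mA; apply: (det u).2 mA.
  - split=> [|n].
      rewrite /on_halfline rhoE /density.
      rewrite (eq_integral (fun=> 0%E)) ?integral0 // => x.
      by rewrite inE /= in_itv /= /k => x0; rewrite max_r // ltW.
    rewrite (integral_density mk k0 (fun A _ => rhoE A)) //; last first.
      by move=> x; rewrite /= in_itv /= andbT => x0; rewrite lee_fin exprn_ge0.
    rewrite hnorm_pow_basis // -mom; apply: eq_integral => x.
    rewrite inE /= in_itv /= andbT => x0.
    by rewrite -EFinM /k max_l // exprSr.
  - split=> [|n].
      rewrite /on_halfline nuE esum1 // => v _.
      by rewrite [X in (_ * X)%E](mP v).1 mule0.
    rewrite (integral_esum_measure w0
      (fun A _ => nuE A)) //; last first.
      by move=> x; rewrite /= in_itv /= andbT => x0; rewrite lee_fin exprn_ge0.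
    rewrite hnorm_pow_basis // basis_normsqS //; apply: eq_esum => v _.
    by rewrite mom.
have m0 : measurable ([set 0%R] : set mT) by exact: measurable_set1.
(* The mass at the origin is the only part of [mu_u] that the children do not produce. *)
exists P, (fun u => fine (m u [set 0%R])); split.
- by move=> u; rewrite /on_halfline PE; exact: (mP u).1.
- by move=> u; rewrite fine_ge0.
move=> u sigma ms s0; rewrite PE.
rewrite (eq_esum (b := fun v => ((w v)%:E * \int[m v]_(s in sigma) (s%:E)^-1)%E)); last first.
  by move=> v _; rewrite intP.
pose sp := sigma `&` `]0%R, +oo[%classic; pose sz := sigma `&` [set 0%R].
have msp : measurable sp by apply: measurableI => //; exact: measurable_itv.
have msz : measurable sz by exact: measurableI.
have sE : sigma = sz `|` sp.
  apply/seteqP; split=> x; last by move=> [[]|[]].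
  move=> sx; have := s0 _ sx; rewrite /= in_itv /= andbT le_eqVlt.
  move=> /orP[/eqP x0|x0]; [left; split => //; exact/esym|right; split => //].
  by rewrite /= in_itv /= x0.
have dis : [disjoint sz & sp].
  by apply/disj_setPS => x [[_ /= ->] [_]]; rewrite /= in_itv /= ltxx.
have mpos : measurable (`]0%R, +oo[%classic : set mT) by exact: measurable_itv.
have minvp : measurable_fun (`]0%R, +oo[%classic : set mT) (fun s : mT => s^-1 : R).
  apply: open_continuous_measurable_fun; first exact: interval_open.
  move=> x; rewrite inE /= in_itv /= andbT => x0.
  by apply: inv_continuous; rewrite gt_eqF.
have minv : measurable_fun sigma (fun s : mT => (s%:E)^-1%E : \bar R).
  rewrite sE; apply/measurable_funU => //; split.
    apply: (eq_measurable_fun (cst +oo%E)) => // x.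
    by rewrite inE => -[_ /= ->]; rewrite inve0.
  apply: (eq_measurable_fun (fun s : mT => (s^-1)%:E)) => [x|].
    rewrite inE => -[_]; rewrite /= in_itv /= andbT => x0.
    by rewrite inver gt_eqF.
  apply/measurable_EFinP; apply: measurable_funS mpos _ minvp.
  exact: subIsetr.
have [rho [nu [rhoE nuE rhonu]]] := same u.
(* The measure [s d(mu_u)] does not charge 0, hence neither does the equal sum over the children;
   this neutralizes the value [+oo] of [1/s] at 0. *)
have wsz v : Chi E u v -> ((w v)%:E * m v sz = 0)%E.
  move=> uv; apply/eqP; rewrite eq_le mule_ge0 ?lee_fin ?w0 // andbT.
  apply: (@le_trans _ _ (nu sz)).
    rewrite nuE; apply: esum_ge; exists [set v]; last by rewrite fsbig_set1.
    by split => // _ ->.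
  rewrite -rhonu // rhoE /density (eq_integral (fun=> 0%E)) ?integral0 // => x.
  by rewrite inE => -[_ /= ->]; rewrite /k max_r.
have wint v : Chi E u v ->
    ((w v)%:E * \int[m v]_(s in sigma) (s%:E)^-1 =
     (w v)%:E * \int[m v]_(s in sp) (s^-1)%:E)%E.
  move=> uv; rewrite {1}sE ge0_integral_setU //; last 2 first.
  - by rewrite -sE.
  - by move=> x; rewrite -sE => /s0; rewrite /= in_itv /= andbT inve_ge0 lee_fin.
  have I0 : (0 <= \int[m v]_(s in sz) (s%:E)^-1)%E.
    apply: integral_ge0 => x [/s0]; rewrite /= in_itv /= andbT => x0 _.
    by rewrite inve_ge0 lee_fin.
  have I1 : (0 <= \int[m v]_(s in sp) (s%:E)^-1)%E.
    apply: integral_ge0 => x [/s0]; rewrite /= in_itv /= andbT => x0 _.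
    by rewrite inve_ge0 lee_fin.
  rewrite ge0_muleDr // [X in (X + _)%E](_ : _ = 0%E) ?add0e.
    congr (_ * _)%E; apply: eq_integral => x.
    by rewrite inE => -[_]; rewrite /= in_itv /= andbT => x0; rewrite inver gt_eqF.
  have /eqP := wsz v uv; rewrite mule_eq0 => /orP[/eqP -> |/eqP mz].
    by rewrite mul0e.
  rewrite null_set_integral ?mule0 //.
  by apply: measurable_funS minv => // x [].
rewrite {1}sE measureU //; last exact/disj_set2P.
rewrite [LHS]addeC; congr (_ + _)%E.
  (* On the positive part, [s^-1] undoes the density of [rho], and [rho] can be replaced by [nu]. *)
  transitivity (\int[rho]_(s in sp) (s^-1)%:E)%E.
    rewrite (integral_density mk k0 (fun A _ => rhoE A)) //; last 2 first.
    - by apply/measurable_EFinP; apply: measurable_funS mpos _ minvp; exact: subIsetr.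
    - by move=> x [_]; rewrite /= in_itv /= andbT => x0; rewrite lee_fin invr_ge0 ltW.
    rewrite (eq_integral (cst 1%E)) ?integral_cst ?mul1e // => x.
    rewrite inE => -[_]; rewrite /= in_itv /= andbT => x0.
    by rewrite -EFinM /k max_l ?ltW // mulVf // gt_eqF.
  rewrite (eq_measure_integral nu); last by move=> A mA _; exact: rhonu.
  rewrite (integral_esum_measure w0 (fun A _ => nuE A)) //; last 2 first.
  - by apply/measurable_EFinP; apply: measurable_funS mpos _ minvp; exact: subIsetr.
  - by move=> x [_]; rewrite /= in_itv /= andbT => x0; rewrite lee_fin invr_ge0 ltW.
  by apply: eq_esum => v uv; rewrite wint.
have fin0 : m u [set 0%R] \is a fin_num.
  by rewrite ge0_fin_numE // (@le_lt_trans _ _ 1%E) ?ltry // -(m1 u) le_measure // inE.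
rewrite fineK // diracE; have [s00|s00] := boolP ((0 : R) \in sigma).
  rewrite mule1; congr (m u _); apply/seteqP; split=> [x []//|x /= ->].
  by split => //; rewrite inE in s00.
rewrite mule0 (_ : sz = set0) ?measure0 //; apply/seteqP; split=> // x [sx /= x0].
by move: s00; rewrite notin_setE; apply; rewrite -x0.
Qed.

End consistent_system.

(** * The Hilbert space of square integrable functions *)

Section semi_hilbert.
Context {R : realType} {W : lmodType R[i]}.
Variable B : W -> W -> R[i].

Record semi_hilbert : Prop := SemiHilbert {
  semi_linear : forall a x y z, B (a *: x + y) z = a * B x z + B y z;
  semi_herm : forall x y, B x y = (B y x)^*;
  semi_ge0 : forall x, 0 <= complex.Re (B x x);
  semi_complete : forall x : nat -> W,
    (forall e : R, 0 < e -> exists N, forall m n, (N <= m)%N -> (N <= n)%N ->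
       complex.Re (B (x m - x n) (x m - x n)) < e) ->
    exists l, forall e : R, 0 < e -> exists N, forall n, (N <= n)%N ->
       complex.Re (B (x n - l) (x n - l)) < e }.

Hypothesis hB : semi_hilbert.
Implicit Types x y z : W.

Lemma semi_linearr a x y z : B z (a *: x + y) = a^* * B z x + B z y.
Proof.
by rewrite (semi_herm hB) (semi_linear hB) rmorphD rmorphM /= -!(semi_herm hB).
Qed.

(** For a null vector [x] the nonnegative real part of [B (t x + z) (t x + z)] is affine in [t], so
    its slope vanishes. Taking ['i *: y] as well handles the imaginary part. *)
Lemma semi_null_orth x y : complex.Re (B x x) = 0 -> B x y = 0.
Proof.
move=> x0; have re0 z : complex.Re (B x z) = 0.
  have key (t : R) : 0 <= 2 * t * complex.Re (B x z) + complex.Re (B z z).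
    have := semi_ge0 hB (t%:C *: x + z).
    rewrite (semi_linear hB) !semi_linearr (semi_herm hB z x).
    move: x0; case: (B x x) (B x z) (B z z) => a b [c d] [e f] /= ->.
    rewrite !(mulr0, mul0r, add0r, addr0, subr0, oppr0, opprK, sub0r).
    by congr (_ <= _); ring.
  apply/eqP; apply: contraT => c0.
  (* At this [t] the affine function takes the value [-1]. *)
  have := key (- (complex.Re (B z z) + 1) / (2 * complex.Re (B x z))).
  rewrite (_ : 2 * _ * _ = - (complex.Re (B z z) + 1)); last by field.
  by rewrite opprD addrAC addNr add0r oppr_ge0 ler10.
have := re0 y; have := re0 ('i *: y); rewrite -[_ *: y]addr0 semi_linearr.
have -> : B x 0 = 0.
  have := semi_linearr (-1) 0 0 x.
  by rewrite scaler0 addr0 rmorphN1 mulN1r addNr.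
case: (B x y) => a b /=; rewrite !(mul0r, oppr0, add0r, addr0) mulN1r opprK.
by move=> -> ->.
Qed.

(* The Hilbert space is realized inside the linear functionals [B x]. *)
Definition semi_functional : {pred W -> R[i]} := fun f => `[< exists x, f = B x >].

Fact semi_functional_submod : submod_closed semi_functional.
Proof.
split.
  apply/asboolP; exists 0; apply/funext => z.
  have := semi_linear hB (-1) 0 0 z.
  by rewrite scaler0 addr0 mulN1r addNr => ->.
move=> a f g /asboolP[x ->] /asboolP[y ->]; apply/asboolP.
by exists (a *: x + y); apply/funext => z; rewrite (semi_linear hB).
Qed.
End semi_hilbert.

Section semi_hilbert_quotient.
Context {R : realType} {W : lmodType R[i]} {B : W -> W -> R[i]}.
Context (hB : semi_hilbert B).

(** The proof argument lets the submodule structure, which depends on [hB], be attached to the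
    predicate. *)
Definition semi_pred (_ : semi_hilbert B) := semi_functional B.

HB.instance Definition _ := GRing.isSubmodClosed.Build R[i] (W -> R[i])
  (semi_pred hB) (semi_functional_submod hB).

Record semi_quotient (h : semi_hilbert B) := SemiQuotient {
  semi_fun :> W -> R[i]; _ : semi_fun \in semi_pred h }.

Local Notation Q := (semi_quotient hB).

HB.instance Definition _ := [isSub for @semi_fun hB].
HB.instance Definition _ := [Choice of Q by <:].
HB.instance Definition _ := [SubChoice_isSubLmodule of Q by <:].
Implicit Types p q : Q.

Let ex_rep p : exists x, val p = B x.
Proof. by apply/asboolP; exact: (valP p). Qed.

Let rep p : W := projT1 (cid (ex_rep p)).

Let repE p : val p = B (rep p).
Proof. exact: (projT2 (cid (ex_rep p))). Qed.

Let proj_subproof x : B x \in semi_pred hB.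
Proof. by apply/asboolP; exists x. Qed.

Let proj x : Q := SemiQuotient (proj_subproof x).

(** The value of [B] at representatives. Only [q] needs a chosen one, so linearity in [p] is
    immediate, and [dot_proj] shows independence of the choice. *)
Definition semi_dot p q : R[i] := val p (rep q).

Let semi_dotC p q : semi_dot p q = Num.conj (semi_dot q p).
Proof. by rewrite /semi_dot !repE; exact: semi_herm. Qed.

Let dot_proj x y : semi_dot (proj x) (proj y) = B x y.
Proof.
rewrite /semi_dot /= (semi_herm hB) -repE.
by rewrite /= -(semi_herm hB).
Qed.

Let semi_dot_bilinear : bilinear_for *%R (Num.conj \; *%R) semi_dot.
Proof.
split=> [q a p r|p a q r]; first by [].
by rewrite [LHS]semi_dotC [semi_dot _ _ in LHS]/= rmorphD rmorphM /=
  -!semi_dotC.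
Qed.

HB.instance Definition _ := bilinear_isBilinear.Build R[i] Q Q R[i]
  *%R (Num.conj \; *%R) semi_dot semi_dot_bilinear.

Let semi_dot_herm p q : semi_dot p q = (-1) ^+ false * Num.conj (semi_dot q p).
Proof. by rewrite mul1r -semi_dotC. Qed.

HB.instance Definition _ :=
  isHermitianSesquilinear.Build R[i] Q false Num.conj semi_dot semi_dot_herm.

Let semi_dot_gt0 p : p != 0 -> 0 < semi_dot p p.
Proof.
move=> p0; have dE : semi_dot p p = B (rep p) (rep p) by rewrite /semi_dot repE.
have im0 : complex.Im (B (rep p) (rep p)) = 0.
  have := semi_herm hB (rep p) (rep p).
  by case: (B _ _) => a b /= [bb]; lra.
rewrite dE ltcE /= im0 eqxx /= lt_neqAle semi_ge0 // andbT.
apply: contra_neq p0 => /esym p0; apply/val_inj; rewrite repE.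
by apply/funext => z; rewrite (semi_null_orth hB z p0).
Qed.

HB.instance Definition _ := isDotProduct.Build R[i] Q semi_dot semi_dot_gt0.

Let proj_rep p : proj (rep p) = p.
Proof. by apply/val_inj; rewrite /= -repE. Qed.

Let projB x y : proj x - proj y = proj (x - y).
Proof.
apply/val_inj/funext => z /=; rewrite [x - y]addrC -scaleN1r (semi_linear hB).
by rewrite mulN1r addrC.
Qed.

Let sqrt_lt p (e : R) : 0 < e ->
  (Num.sqrt (complex.Re (semi_dot p p)) < e) =
  (complex.Re (B (rep p) (rep p)) < e ^+ 2).
Proof.
move=> e0; have -> : semi_dot p p = B (rep p) (rep p) by rewrite /semi_dot repE.
rewrite -[in LHS](ger0_norm (ltW e0)) -sqrtr_sqr.
by rewrite ltr_sqrt // exprn_gt0.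
Qed.

Let semi_quotient_complete (x : nat -> Q) :
  (forall e : R, 0 < e -> exists N, forall m n, (N <= m)%N -> (N <= n)%N ->
     Num.sqrt (complex.Re (semi_dot (x m - x n) (x m - x n))) < e) ->
  exists l, forall e : R, 0 < e -> exists N, forall n, (N <= n)%N ->
     Num.sqrt (complex.Re (semi_dot (x n - l) (x n - l))) < e.
Proof.
have dotE u v : semi_dot (proj u - proj v) (proj u - proj v) = B (u - v) (u - v).
  by rewrite projB dot_proj.
move=> xc; have [|l Hl] := semi_complete hB (x := fun n => rep (x n)).
  move=> e e0; have s0 : 0 < Num.sqrt e by rewrite sqrtr_gt0.
  have [N HN] := xc _ s0; exists N => m n Nm Nn.
  have := HN m n Nm Nn; rewrite -(proj_rep (x m)) -(proj_rep (x n)) dotE.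
  by rewrite ltr_sqrt // !proj_rep.
exists (proj l) => e e0; have [N HN] := Hl _ (exprn_gt0 2 e0).
exists N => n /HN; rewrite -[x n in X in _ -> X]proj_rep dotE => h.
by rewrite -[ltRHS](ger0_norm (ltW e0)) -sqrtr_sqr ltr_sqrt // exprn_gt0.
Qed.

HB.instance Definition _ := Lmodule_isHilbert.Build R Q
  (innerp := (semi_dot : {dot Q for (@Num.conj R[i])})) semi_quotient_complete.

Lemma semi_hilbert_quotient : exists (K : hilbertType R) (pi : {linear W -> K}),
  (forall x y, innerp (pi x) (pi y) = B x y) /\ (forall z, exists x, pi x = z).
Proof.
have proj_linear : linear proj.
  by move=> a x y; apply/val_inj/funext => z; rewrite /= (semi_linear hB).
pose pi : {linear W -> Q} :=
  HB.pack proj (GRing.isLinear.Build R[i] W Q *:%R proj proj_linear).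
exists Q, pi; split; first exact: dot_proj.
by move=> z; exists (rep z); exact: proj_rep.
Qed.

End semi_hilbert_quotient.

Section square_norm.
Context {R : realType}.
Implicit Types z w : R[i].

Definition sqnorm z : R := complex.Re z ^+ 2 + complex.Im z ^+ 2.

Lemma sqnorm_normc z : normc z ^+ 2 = sqnorm z.
Proof.
by case: z => a b; rewrite /sqnorm /= sqr_sqrtr // addr_ge0 ?sqr_ge0.
Qed.

Lemma sqnorm_ge0 z : 0 <= sqnorm z.
Proof. by rewrite addr_ge0 ?sqr_ge0. Qed.

Lemma sqnormM z w : sqnorm (z * w) = sqnorm z * sqnorm w.
Proof. by rewrite -!sqnorm_normc normcM exprMn. Qed.

Lemma sqnorm_real (r : R) z : sqnorm (r%:C * z) = r ^+ 2 * sqnorm z.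
Proof.
by rewrite sqnormM; congr (_ * _); rewrite /sqnorm /= [0 ^+ 2]expr0n addr0.
Qed.

Lemma sqnorm0 : sqnorm 0 = 0.
Proof. by rewrite /sqnorm /= expr0n addr0. Qed.

Lemma sqnormD_le z w : sqnorm (z + w) <= 2 * sqnorm z + 2 * sqnorm w.
Proof.
case: z w => a b [c d]; rewrite /sqnorm /=.
have := sqr_ge0 (a - c); have := sqr_ge0 (b - d); nra.
Qed.

Lemma Re_mulJ_le z w : `|complex.Re (z * w^*)| <= sqnorm z + sqnorm w.
Proof.
case: z w => a b [c d]; rewrite /sqnorm /= ler_norml.
have := sqr_ge0 (a - c); have := sqr_ge0 (b - d).
have := sqr_ge0 (a + c); have := sqr_ge0 (b + d).
have := sqr_ge0 a; have := sqr_ge0 b; have := sqr_ge0 c; have := sqr_ge0 d.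
by move=> *; apply/andP; split; nra.
Qed.

Lemma Im_mulJ_le z w : `|complex.Im (z * w^*)| <= sqnorm z + sqnorm w.
Proof.
case: z w => a b [c d]; rewrite /sqnorm /= ler_norml.
have := sqr_ge0 (a - d); have := sqr_ge0 (b - c).
have := sqr_ge0 (a + d); have := sqr_ge0 (b + c).
have := sqr_ge0 a; have := sqr_ge0 b; have := sqr_ge0 c; have := sqr_ge0 d.
by move=> *; apply/andP; split; nra.
Qed.

End square_norm.

(** * Square integrable complex functions *)

Section square_integrable.
Context {R : realType} {d : measure_display} {T : measurableType d}.
Variable m : {measure set T -> \bar R}.
Implicit Types f g h : T -> R[i].

Definition cmeasurable f := measurable_fun setT (fun x => complex.Re (f x)) /\
  measurable_fun setT (fun x => complex.Im (f x)).

Lemma cmeasurableD f g : cmeasurable f -> cmeasurable g ->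
  cmeasurable (fun x => f x + g x).
Proof.
move=> [f1 f2] [g1 g2]; split.
  rewrite (_ : (fun x => _) = (fun x => complex.Re (f x) + complex.Re (g x))).
    exact: measurable_funD.
  by apply/funext => x; case: (f x) (g x) => ? ? [].
rewrite (_ : (fun x => _) = (fun x => complex.Im (f x) + complex.Im (g x))).
  exact: measurable_funD.
by apply/funext => x; case: (f x) (g x) => ? ? [].
Qed.

Lemma cmeasurableM f g : cmeasurable f -> cmeasurable g ->
  cmeasurable (fun x => f x * g x).
Proof.
move=> [f1 f2] [g1 g2]; split.
  rewrite (_ : (fun x => _) = (fun x => complex.Re (f x) * complex.Re (g x) -
    complex.Im (f x) * complex.Im (g x))).
    by apply: measurable_funB; exact: measurable_funM.
  by apply/funext => x; case: (f x) (g x) => ? ? [].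
rewrite (_ : (fun x => _) = (fun x => complex.Re (f x) * complex.Im (g x) +
    complex.Im (f x) * complex.Re (g x))).
  by apply: measurable_funD; exact: measurable_funM.
by apply/funext => x; case: (f x) (g x) => ? ? [].
Qed.

Lemma cmeasurable_cst (c : R[i]) : cmeasurable (fun=> c).
Proof. by split; exact: measurable_cst. Qed.

Lemma cmeasurable_real (k : T -> R) : measurable_fun setT k ->
  cmeasurable (fun x => (k x)%:C).
Proof. by move=> mk; split; [exact: mk|exact: measurable_cst]. Qed.

Lemma cmeasurableJ f : cmeasurable f -> cmeasurable (fun x => (f x)^*).
Proof.
move=> [f1 f2]; split.
  by rewrite (_ : (fun x => _) = (fun x => complex.Re (f x))) //;
    apply/funext => x; case: (f x).
rewrite (_ : (fun x => _) = (fun x => - complex.Im (f x))).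
  exact: measurableT_comp.
by apply/funext => x; case: (f x).
Qed.

Lemma measurable_sqnorm f : cmeasurable f ->
  measurable_fun setT (fun x => sqnorm (f x)).
Proof.
by move=> [f1 f2]; apply: measurable_funD; exact: measurable_funX.
Qed.

Lemma measurable_sqnormE f D : cmeasurable f ->
  measurable_fun D (fun x => (sqnorm (f x))%:E).
Proof.
by move=> mf; apply: measurable_funTS; apply/measurable_EFinP; exact: measurable_sqnorm.
Qed.

Definition int_sq f : \bar R := (\int[m]_x (sqnorm (f x))%:E)%E.

Definition sq_integrable : {pred T -> R[i]} :=
  fun f => `[< cmeasurable f /\ (int_sq f < +oo)%E >].

Lemma int_sq_ge0 f : (0 <= int_sq f)%E.
Proof. by apply: integral_ge0 => x _; rewrite lee_fin sqnorm_ge0. Qed.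

Fact sq_integrable_submod : submod_closed sq_integrable.
Proof.
split.
  apply/asboolP; split; first exact: cmeasurable_cst.
  rewrite /int_sq (eq_integral (fun=> 0%E)) ?integral0 ?ltry // => x _.
  by rewrite sqnorm0.
move=> a f g /asboolP[mf sf] /asboolP[mg sg]; apply/asboolP.
have maf : cmeasurable (fun x => a * f x).
  by apply: cmeasurableM => //; exact: cmeasurable_cst.
split; first exact: cmeasurableD.
pose b := 2 * sqnorm a.
have b0 : 0 <= b by rewrite mulr_ge0 ?sqnorm_ge0.
apply: (@le_lt_trans _ _ (\int[m]_x (b%:E * (sqnorm (f x))%:E + 2%:E * (sqnorm (g x))%:E))%E).
  apply: ge0_le_integral => //.
  - by move=> x _; rewrite lee_fin sqnorm_ge0.
  - by apply: measurable_sqnormE; exact: cmeasurableD.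
  - by apply: emeasurable_funD; apply: measurable_funeM; exact: measurable_sqnormE.
  - move=> x _; rewrite -!EFinM -EFinD lee_fin.
    apply: le_trans (sqnormD_le (a * f x) (g x)) _.
    by rewrite sqnormM /b mulrA.
rewrite ge0_integralD //.
- rewrite !ge0_integralZl_EFin //.
  + by rewrite lte_add_pinfty // lte_mul_pinfty ?lee_fin.
  + by move=> x _; rewrite lee_fin sqnorm_ge0.
  + exact: measurable_sqnormE.
  + by move=> x _; rewrite lee_fin sqnorm_ge0.
  + exact: measurable_sqnormE.
- by move=> x _; rewrite mule_ge0 ?lee_fin ?sqnorm_ge0.
- by apply: measurable_funeM; exact: measurable_sqnormE.
- by move=> x _; rewrite mule_ge0 ?lee_fin ?sqnorm_ge0.
- by apply: measurable_funeM; exact: measurable_sqnormE.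
Qed.

HB.instance Definition _ :=
  GRing.isSubmodClosed.Build R[i] (T -> R[i]) sq_integrable
    sq_integrable_submod.

Record sqint := SqInt { sqint_fun :> T -> R[i]; _ : sqint_fun \in sq_integrable }.

HB.instance Definition _ := [isSub for sqint_fun].
HB.instance Definition _ := [Choice of sqint by <:].
HB.instance Definition _ := [SubChoice_isSubLmodule of sqint by <:].
Implicit Types u v w : sqint.

Lemma sqint_measurable u : cmeasurable u.
Proof. by have /asboolP[] := valP u. Qed.

Lemma sqint_fin u : (int_sq u < +oo)%E.
Proof. by have /asboolP[] := valP u. Qed.

Let Rint (k : T -> R) : R := fine (\int[m]_x (k x)%:E).

Definition sqint_dot u v : R[i] :=
  Rint (fun x => complex.Re (u x * (v x)^*)) +i*
  Rint (fun x => complex.Im (u x * (v x)^*)).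

Let integrable_le (k : T -> R) u v : measurable_fun setT k ->
  (forall x, `|k x| <= sqnorm (u x) + sqnorm (v x)) ->
  m.-integrable setT (EFin \o k).
Proof.
move=> mk kle; apply/integrableP; split; first exact/measurable_EFinP.
have mu := sqint_measurable u; have mv := sqint_measurable v.
apply: (@le_lt_trans _ _ (\int[m]_x ((sqnorm (u x))%:E + (sqnorm (v x))%:E))%E).
  apply: ge0_le_integral => //.
  - by apply/measurable_EFinP; exact: measurableT_comp.
  - by apply: emeasurable_funD; exact: measurable_sqnormE.
  - by move=> x _; rewrite -EFinD lee_fin.
rewrite ge0_integralD //; try exact: measurable_sqnormE;
  try by move=> x _; rewrite lee_fin sqnorm_ge0.
by rewrite lte_add_pinfty //; exact: sqint_fin.
Qed.

Let int_Re u v : m.-integrable setT (EFin \o (fun x => complex.Re (u x * (v x)^*))).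
Proof.
apply: (@integrable_le _ u v) => [|x]; last exact: Re_mulJ_le.
have := cmeasurableM (sqint_measurable u) (cmeasurableJ (sqint_measurable v)).
by case.
Qed.

Let int_Im u v : m.-integrable setT (EFin \o (fun x => complex.Im (u x * (v x)^*))).
Proof.
apply: (@integrable_le _ u v) => [|x]; last exact: Im_mulJ_le.
have := cmeasurableM (sqint_measurable u) (cmeasurableJ (sqint_measurable v)).
by case.
Qed.

Let RintD (k l : T -> R) : m.-integrable setT (EFin \o k) ->
  m.-integrable setT (EFin \o l) -> Rint (fun x => k x + l x) = Rint k + Rint l.
Proof. by move=> kI lI; exact: RintegralD. Qed.

Let RintZ (a : R) (k : T -> R) : m.-integrable setT (EFin \o k) ->
  Rint (fun x => a * k x) = a * Rint k.
Proof. by move=> kI; exact: RintegralZl. Qed.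

Let integrableZ (a : R) (k : T -> R) : m.-integrable setT (EFin \o k) ->
  m.-integrable setT (EFin \o (fun x => a * k x)).
Proof. by move=> kI; exact: (integrableZl measurableT a kI). Qed.

Lemma sqint_dotE u : (complex.Re (sqint_dot u u))%:E = int_sq u.
Proof.
rewrite /= /Rint fineK; last first.
  by rewrite integrable_fin_num //; exact: int_Re.
apply: eq_integral => x _; congr EFin.
by rewrite /sqnorm; case: (u x) => a b /=; ring.
Qed.

Lemma sqint_dot_linear a u v w :
  sqint_dot (a *: u + v) w = a * sqint_dot u w + sqint_dot v w.
Proof.
have E x : (a *: u + v) x = a * u x + v x by [].
rewrite /sqint_dot; under [X in Rint X +i* _]eq_fun do rewrite E.
under [X in _ +i* Rint X]eq_fun do rewrite E.
case: a {E} => a b.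
rewrite [X in Rint X +i* _](_ : _ = fun x =>
    (a * complex.Re (u x * (w x)^*) + - b * complex.Im (u x * (w x)^*)) +
    complex.Re (v x * (w x)^*)); last first.
  by apply/funext => x; case: (u x) (v x) (w x) => ? ? [? ?] [? ?] /=; ring.
rewrite [X in _ +i* Rint X](_ : _ = fun x =>
    (a * complex.Im (u x * (w x)^*) + b * complex.Re (u x * (w x)^*)) +
    complex.Im (v x * (w x)^*)); last first.
  by apply/funext => x; case: (u x) (v x) (w x) => ? ? [? ?] [? ?] /=; ring.
have iD k l : m.-integrable setT (EFin \o k) -> m.-integrable setT (EFin \o l) ->
    m.-integrable setT (EFin \o (fun x => (k x : R) + (l x : R))).
  by move=> kI lI; exact: (integrableD measurableT kI lI).
have iRe := int_Re u w; have iIm := int_Im u w.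
have i1 := iD _ _ (integrableZ a iRe) (integrableZ (- b) iIm).
have i2 := iD _ _ (integrableZ a iIm) (integrableZ b iRe).
rewrite (RintD i1 (int_Re v w)) (RintD i2 (int_Im v w)).
rewrite (RintD (integrableZ a iRe) (integrableZ (- b) iIm)).
rewrite (RintD (integrableZ a iIm) (integrableZ b iRe)) !RintZ //.
by apply/eqP; rewrite eq_complex /=; apply/andP; split; apply/eqP; ring.
Qed.

Lemma sqint_dot_herm u v : sqint_dot u v = (sqint_dot v u)^*.
Proof.
apply/eqP; rewrite eq_complex /=; apply/andP; split; apply/eqP.
  by congr Rint; apply/funext => x; case: (u x) (v x) => ? ? [? ?] /=; ring.
rewrite -mulN1r -RintZ; last exact: int_Im.
by congr Rint; apply/funext => x; case: (u x) (v x) => ? ? [? ?] /=; ring.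
Qed.

End square_integrable.

(** * Completeness of the square integrable functions *)

Section pointwise_convergence.
Context {R : realType}.

Lemma geometric_steps_cvg (u : nat -> R) (C : R) :
  (forall k, `|u k.+1 - u k| <= C * (2^-1) ^+ k) -> cvgn u.
Proof.
move=> uC.
have : cvgn (series (telescope u)).
  apply: normed_cvg; apply: (@series_le_cvg _ _ (geometric C 2^-1)).
  - by move=> k; exact: normr_ge0.
  - by move=> k; exact: le_trans (normr_ge0 _) (uC k).
  - by move=> k; exact: uC.
  - by apply: is_cvg_geometric_series; rewrite ger0_norm //; lra.
rewrite telescopeK => /cvg_ex[l ul]; apply/cvg_ex; exists (l + u 0%N).
rewrite [X in X @ _ --> _](_ : u = (fun n => (u n - u 0%N) + u 0%N)).
  by apply: cvgD => //; exact: cvg_cst.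
by apply/funext => n; rewrite subrK.
Qed.

End pointwise_convergence.

Section sqint_completeness.
Context {R : realType} {d : measure_display} {T : measurableType d}.
Variable m : {measure set T -> \bar R}.
Local Notation sqint := (sqint m).

Let nrm (u : sqint) : R := complex.Re (sqint_dot u u).

Let nrmE (u : sqint) : (nrm u)%:E = int_sq m u.
Proof. exact: sqint_dotE. Qed.

(** Riesz-Fischer: a fast subsequence converges almost everywhere, and Fatou's lemma bounds the
    distance from [x i] to the limit by the distances to the subsequence. *)
Lemma sqint_complete (x : nat -> sqint) :
  (forall e : R, 0 < e -> exists N, forall i j, (N <= i)%N -> (N <= j)%N ->
     nrm (x i - x j) < e) ->
  exists l, forall e : R, 0 < e -> exists N, forall n, (N <= n)%N ->
     nrm (x n - l) < e.
Proof.
move=> xc.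
(* Squared steps below [8^-k], weighted by [4^k], still sum to an integrable [G]; where [G] is
   finite, the steps are at most [sqrt G * 2^-k]. *)
have e0 k : 0 < (8^-1) ^+ k :> R by rewrite exprn_gt0.
have [M HM] := choice (fun k => xc _ (e0 k)).
pose n := fix n k := if k is k'.+1 then maxn (n k') (M k'.+1) else M 0%N.
have nM k : (M k <= n k)%N by case: k => //= k; exact: leq_maxr.
have nn k : (n k <= n k.+1)%N by exact: leq_maxl.
have nge k i : (k <= i)%N -> (M k <= n i)%N.
  by move=> ki; apply: leq_trans (nM k) _; elim: i ki => [|i IH];
    [rewrite leqn0 => /eqP ->|rewrite leq_eqVlt => /orP[/eqP -> //|/IH/leq_trans]; apply].
pose y k := x (n k).
have ystep k : nrm (y k.+1 - y k) < (8^-1) ^+ k.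
  by apply: HM; [apply: leq_trans (nM k) (nn k)|exact: nM].
pose G (t : T) : \bar R :=
  (\sum_(0 <= k <oo) (4 ^+ k * sqnorm ((y k.+1 - y k) t))%:E)%E.
have my k : cmeasurable (y k.+1 - y k) by exact: sqint_measurable.
have mterm k : measurable_fun setT
    (fun t => (4 ^+ k * sqnorm ((y k.+1 - y k) t))%:E).
  apply/measurable_EFinP; apply: measurable_funM; first exact: measurable_cst.
  exact: measurable_sqnorm.
have term0 k t : (0 <= (4 ^+ k * sqnorm ((y k.+1 - y k) t))%:E)%E.
  by rewrite lee_fin mulr_ge0 ?exprn_ge0 ?sqnorm_ge0.
have Gfin : (\int[m]_t G t < +oo)%E.
  rewrite integral_nneseries //.
  apply: (@le_lt_trans _ _ (\sum_(0 <= k <oo) (2^-1 ^+ k)%:E)%E).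
    apply: lee_nneseries => [k _ _|k _].
      by apply: integral_ge0 => t _; exact: term0.
    rewrite (eq_integral (fun t =>
      ((4 ^+ k)%:E * (sqnorm ((y k.+1 - y k) t))%:E)%E)); last first.
      by move=> t _; rewrite EFinM.
    rewrite ge0_integralZl_EFin ?exprn_ge0 //; last 2 first.
    - by move=> t _; rewrite lee_fin sqnorm_ge0.
    - exact: measurable_sqnormE.
    rewrite -/(int_sq m (y k.+1 - y k)) -nrmE -EFinM lee_fin.
    apply: le_trans (ler_wpM2l _ (ltW (ystep k))) _; first by rewrite exprn_ge0.
    by rewrite -exprMn (_ : 4 * 8^-1 = 2^-1 :> R) //; field.
  apply: (@le_lt_trans _ _ 2%:E); last exact: ltry.
  apply: le_trans (epsilon_trick0 xpredT (_ : 0 <= 2 :> R)); last by [].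
  apply: lee_nneseries => [k _ _|k _]; first by rewrite lee_fin exprn_ge0 // invr_ge0.
  by rewrite lee_fin natrX exprVn exprS invfM mulrA divff // mul1r.
have G0 t : (0 <= G t)%E by apply: nneseries_ge0 => k _ _; exact: term0.
have mG : measurable_fun setT G.
  by apply: ge0_emeasurable_sum => // k t _ _; exact: term0.
have intG : m.-integrable setT G.
  apply/integrableP; split => //.
  by under eq_integral do rewrite gee0_abs //.
have [Z [mZ Z0 badZ]] := integrable_ae measurableT intG.
have goodZ t : ~ Z t -> G t \is a fin_num.
  by move=> Zt; apply: contrapT => Gt; apply/Zt/badZ => /(_ I).
have step t : ~ Z t -> forall k,
    sqnorm ((y k.+1 - y k) t) <= fine (G t) * (4^-1) ^+ k.
  move=> Zt k; rewrite exprVn ler_pdivlMr ?exprn_gt0 // mulrC.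
  rewrite -lee_fin fineK ?goodZ //; rewrite /G nneseries_esumT //.
  apply: esum_ge; exists [set k]; last by rewrite fsbig_set1.
  by split.
have cvg_part (part : R[i] -> R) : (forall z w, part (z - w) = part z - part w) ->
    (forall z, part z ^+ 2 <= sqnorm z) ->
    forall t, ~ Z t -> cvgn (fun k => part (y k t)).
  move=> partB partle t Zt; apply: (@geometric_steps_cvg _ _ (Num.sqrt (fine (G t)))) => k.
  rewrite -partB -(@ler_pXn2r _ 2) // ?nnegrE ?mulr_ge0 ?sqrtr_ge0 ?exprn_ge0 //.
  rewrite -normrX ger0_norm ?sqr_ge0 // exprMn sqr_sqrtr ?fine_ge0 //.
  apply: le_trans (partle _) _; rewrite -exprM mulnC exprM.
  by rewrite (_ : 2^-1 ^+ 2 = 4^-1 :> R); [exact: step|field].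
have ReB (z w : R[i]) : complex.Re (z - w) = complex.Re z - complex.Re w.
  by case: z w => ? ? [].
have ImB (z w : R[i]) : complex.Im (z - w) = complex.Im z - complex.Im w.
  by case: z w => ? ? [].
have Re_le (z : R[i]) : complex.Re z ^+ 2 <= sqnorm z by rewrite lerDl sqr_ge0.
have Im_le (z : R[i]) : complex.Im z ^+ 2 <= sqnorm z by rewrite lerDr sqr_ge0.
have cRe := cvg_part _ ReB Re_le; have cIm := cvg_part _ ImB Im_le.
(* The cut-off makes the limit zero on the exceptional null set, so that it is measurable
   everywhere. *)
pose chi (t : T) : R := \1_(~` Z) t.
have mchi : measurable_fun setT chi by apply: measurable_indic; exact: measurableC.
pose f (t : T) : R[i] := (chi t * limn (fun k => complex.Re (y k t))) +i*
  (chi t * limn (fun k => complex.Im (y k t))).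
have cvg_chi (part : R[i] -> R) t : (forall t, ~ Z t -> cvgn (fun k => part (y k t))) ->
    (fun k => chi t * part (y k t)) @ \oo --> chi t * limn (fun k => part (y k t)).
  move=> c; have [Zt|Zt] := pselect (Z t).
    have -> : chi t = 0 by rewrite /chi indicE memNset //; exact.
    by under eq_fun do rewrite mul0r; rewrite mul0r; exact: cvg_cst.
  by apply: cvgM; [exact: cvg_cst|exact: c].
have mf : cmeasurable f.
  split.
  - apply: (@measurable_fun_cvg _ _ _ _ (fun k t => chi t * complex.Re (y k t))).
      by move=> k; apply: measurable_funM => //; have [] := sqint_measurable (y k).
    by move=> t _; exact: cvg_chi.
  - apply: (@measurable_fun_cvg _ _ _ _ (fun k t => chi t * complex.Im (y k t))).
      by move=> k; apply: measurable_funM => //; have [] := sqint_measurable (y k).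
    by move=> t _; exact: cvg_chi.
have chi1 t : ~ Z t -> chi t = 1.
  by move=> Zt; rewrite /chi indicE mem_set.
have cvg_sqr (u : nat -> R) (l : R) : u @ \oo --> l -> (fun k => u k ^+ 2) @ \oo --> l ^+ 2.
  by move=> ul; rewrite expr2; under eq_fun do rewrite expr2; exact: cvgM.
have cvg_sq i t : ~ Z t ->
    (sqnorm (x i t - y k t))%:E @[k --> \oo] --> (sqnorm (x i t - f t))%:E.
  move=> Zt; apply: cvg_EFin; first by apply: nearW.
  rewrite /sqnorm ReB ImB; under eq_fun do rewrite ReB ImB.
  rewrite /f /= chi1 // !mul1r.
  by apply: cvgD; apply: cvg_sqr; apply: cvgB; [exact: cvg_cst|exact: cRe|exact: cvg_cst|exact: cIm].
have mxf i : cmeasurable (fun t => x i t - f t).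
  rewrite (_ : (fun t => _) = (fun t => x i t + -1 * f t)).
    apply: cmeasurableD; first exact: sqint_measurable.
    by apply: cmeasurableM => //; exact: cmeasurable_cst.
  by apply/funext => t; rewrite mulN1r.
have mxy i k : cmeasurable (fun t => x i t - y k t).
  exact: (sqint_measurable (x i - y k)).
have mD : measurable (~` Z) by exact: measurableC.
have dist K i : (M K <= i)%N -> (int_sq m (fun t => x i t - f t)%R <= ((8^-1) ^+ K)%:E)%E.
  move=> Ki; rewrite /int_sq (ge0_negligible_integral mZ) //; last 2 first.
  - exact: measurable_sqnormE.
  - by move=> t _; rewrite lee_fin sqnorm_ge0.
  rewrite setTD.
  apply: (@le_trans _ _ (\int[m]_(t in ~` Z)
      limn_einf (fun k => (sqnorm (x i t - y k t))%:E))%E).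
    rewrite le_eqVlt; apply/orP; left; apply/eqP; apply: eq_integral => t.
    rewrite inE => Zt; have c := cvg_sq i t Zt.
    rewrite is_cvg_limn_einfE; first by rewrite (cvg_lim _ c).
    by apply/cvg_ex; eexists; exact: c.
  apply: le_trans (fatou m mD _ _) _.
  - by move=> k; exact: measurable_sqnormE.
  - by move=> k t _; rewrite lee_fin sqnorm_ge0.
  rewrite limn_einf_lim; apply: lime_le; first exact: is_cvg_einfs.
  exists K => // k /= Kk; apply: (@le_trans _ _ (int_sq m (x i - y k))).
    apply: (@le_trans _ _ (\int[m]_(t in ~` Z) (sqnorm (x i t - y k t))%:E)%E).
      by apply: ereal_inf_lbound; exists k => //=.
    apply: ge0_subset_integral => //.
    - exact: measurable_sqnormE.
    - by move=> t _; rewrite lee_fin sqnorm_ge0.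
  rewrite -nrmE lee_fin ltW //; apply: HM => //.
  exact: nge.
have fS : f \in sq_integrable m.
  have d0 : ((fun t => x (M 0%N) t - f t) : T -> R[i]) \in sq_integrable m.
    apply/asboolP; split => //; apply: le_lt_trans (dist 0%N _ (leqnn _)) _.
    exact: ltry.
  have -> : f = (x (M 0%N) : T -> R[i]) - (fun t => x (M 0%N) t - f t).
    by apply/funext => t; rewrite !fctE opprB addrC subrK.
  by rewrite rpredB //; exact: valP.
exists (SqInt fS) => e e_gt0.
have [K HK] : exists K, (8^-1) ^+ K < e.
  have /cvgrPdist_lt/(_ _ e_gt0)[K _ HK] : (fun k => (8^-1 : R) ^+ k) @ \oo --> (0 : R).
    by apply: cvg_expr; rewrite ger0_norm //; lra.
  by exists K; have := HK K (leqnn K); rewrite /= sub0r normrN ger0_norm ?exprn_ge0.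
exists (M K) => i Ki; apply: le_lt_trans HK.
by rewrite -lee_fin nrmE; exact: dist.
Qed.

Lemma sqint_semi_hilbert : semi_hilbert (@sqint_dot R d T m).
Proof.
split.
- exact: sqint_dot_linear.
- exact: sqint_dot_herm.
- by move=> u; rewrite -lee_fin sqint_dotE int_sq_ge0.
- exact: sqint_complete.
Qed.

End sqint_completeness.

(** * Multiplication by a real function is selfadjoint *)

Section multiplication.
Context {R : realType} {d : measure_display} {T : measurableType d}.
Variable m : {measure set T -> \bar R}.
Local Notation sqint := (sqint m).
Implicit Types (u v w : sqint) (k : T -> R) (f g : T -> R[i]).

Definition mult k f : T -> R[i] := fun x => (k x)%:C * f x.

Lemma sqnorm_mult k f x : sqnorm (mult k f x) = k x ^+ 2 * sqnorm (f x).
Proof. exact: sqnorm_real. Qed.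

Lemma cmeasurable_mult k f : measurable_fun setT k -> cmeasurable f ->
  cmeasurable (mult k f).
Proof. by move=> mk mf; apply: cmeasurableM => //; exact: cmeasurable_real. Qed.

Lemma sq_integrableP f :
  f \in sq_integrable m <-> cmeasurable f /\ (int_sq m f < +oo)%E.
Proof. by split=> [/asboolP//|h]; exact/asboolP. Qed.

Lemma int_sq_le f g : cmeasurable f -> cmeasurable g ->
  (forall x, sqnorm (f x) <= sqnorm (g x)) -> (int_sq m f <= int_sq m g)%E.
Proof.
move=> mf mg fg; apply: ge0_le_integral => //.
- by move=> x _; rewrite lee_fin sqnorm_ge0.
- exact: measurable_sqnormE.
- exact: measurable_sqnormE.
- by move=> x _; rewrite lee_fin.
Qed.

Lemma int_sq_null_mult k f : measurable_fun setT k -> cmeasurable f ->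
  int_sq m f = 0%E -> int_sq m (mult k f) = 0%E.
Proof.
move=> mk mf f0; have mkf := cmeasurable_mult mk mf.
have absE g : (\int[m]_x `|(sqnorm (g x))%:E| = int_sq m g)%E.
  by apply: eq_integral => x _; rewrite gee0_abs // lee_fin sqnorm_ge0.
rewrite -absE; apply/(ae_eq_integral_abs m measurableT (measurable_sqnormE mkf)).
move: f0; rewrite -absE => /(ae_eq_integral_abs m measurableT (measurable_sqnormE mf)).1.
apply: filterS => x /= h xT; have := h xT; rewrite sqnorm_mult => -[->].
by rewrite mulr0.
Qed.

Context {K : hilbertType R} (pi : {linear sqint -> K}).
Hypothesis pi_dot : forall u v, innerp (pi u) (pi v) = sqint_dot u v.
Hypothesis pi_surj : forall z, exists u, pi u = z.

Lemma hnorm_pi u : ((hnorm (pi u) ^+ 2)%:E = int_sq m u)%E.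
Proof. by rewrite hnormE /ip pi_dot sqint_dotE. Qed.

Lemma pi_eqP u v : pi u = pi v <-> int_sq m (fun x => u x - v x) = 0%E.
Proof.
have -> : (fun x => u x - v x) = (u - v : sqint) :> (T -> R[i]) by [].
rewrite -hnorm_pi linearB /=; split=> [->|[]].
  by rewrite subrr hnormE ip0l.
move=> /eqP; rewrite sqrf_eq0 => /eqP/hnorm_eq0/eqP.
by rewrite subr_eq0 => /eqP.
Qed.

Section operator.
Variable k : T -> R.
Hypothesis mk : measurable_fun setT k.

Let rep (z : K) : sqint := projT1 (cid (pi_surj z)).
Let repK z : pi (rep z) = z. Proof. exact: (projT2 (cid (pi_surj z))). Qed.

Definition mult_dom u := mult k u \in sq_integrable m.

(** Defined through chosen representatives; [mult_operator_dom] and [mult_operatorE] remove the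
    choice, because multiplication by [k] preserves null functions. *)
Definition mult_operator : operator K :=
  Operator [set z | mult_dom (rep z)]
    (fun z => pi (insubd (0 : sqint) (mult k (rep z)))).

Lemma multB f g x : mult k f x - mult k g x = mult k (fun x => f x - g x) x.
Proof. by rewrite /mult mulrBr. Qed.

Lemma mult_dom_eq u v : pi u = pi v -> mult_dom u -> mult_dom v.
Proof.
move=> /esym/pi_eqP uv ku; rewrite /mult_dom.
have -> : mult k v = mult k u + mult k (fun x => v x - u x).
  by apply/funext => x; rewrite fctE -multB addrC subrK.
apply: rpredD => //; apply/sq_integrableP.
have mvu : cmeasurable (fun x => v x - u x) by exact: (sqint_measurable (v - u)).
split; first exact: cmeasurable_mult.
by rewrite int_sq_null_mult // ltry.
Qed.

Lemma mult_operator_dom u : dom mult_operator (pi u) <-> mult_dom u.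
Proof. by split; apply: mult_dom_eq; rewrite repK. Qed.

Lemma mult_domP u v : (forall x, v x = mult k u x) -> mult_dom u.
Proof.
move=> vE; rewrite /mult_dom (_ : mult k u = v) ?(valP v) //.
by apply/funext => x; rewrite vE.
Qed.

Lemma mult_operatorE u v : (forall x, v x = mult k u x) ->
  mult_operator (pi u) = pi v.
Proof.
move=> vE; have ku := mult_domP vE.
have kr : mult_dom (rep (pi u)) by exact/mult_operator_dom.
rewrite /=; apply/pi_eqP; rewrite /= insubdK //.
have -> : (fun x => mult k (rep (pi u)) x - v x) =
    mult k (fun x => rep (pi u) x - u x).
  by apply/funext => x; rewrite vE multB.
apply: int_sq_null_mult => //; first exact: (sqint_measurable (rep (pi u) - u)).
by apply/pi_eqP; rewrite repK.
Qed.

(** These sets exhaust [T], and functions cut off to one of them lie in the domain because [k] is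
    bounded there. *)
Let level (n : nat) : set T := [set x | `|k x| <= n%:R].

Let mlevel n : measurable (level n).
Proof.
rewrite (_ : level n = (fun x => `|k x|) @^-1` `]-oo, n%:R]%classic).
  rewrite -[X in measurable X]setTI.
  by apply: (measurableT_comp (@normr_measurable _ _) mk) => //; exact: measurable_itv.
by apply/seteqP; split=> x; rewrite /level /= in_itv.
Qed.

Let chi n x : R := \1_(level n) x.

Let mchi n : measurable_fun setT (chi n).
Proof. exact: measurable_indic. Qed.

Let chi_le1 n x : chi n x ^+ 2 <= 1.
Proof. by rewrite /chi indicE; case: (_ \in _); rewrite ?expr1n // expr0n ler01. Qed.

Let chiK n x : chi n x * chi n x = chi n x.
Proof. by rewrite /chi indicE; case: (_ \in _); rewrite ?mulr1 ?mulr0. Qed.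

Let cut_subproof n u : mult (chi n) u \in sq_integrable m.
Proof.
apply/sq_integrableP; have mu := sqint_measurable u.
split; first exact: cmeasurable_mult.
apply: le_lt_trans (sqint_fin u); apply: int_sq_le => //.
  exact: cmeasurable_mult.
by move=> x; rewrite sqnorm_mult ler_piMl ?sqnorm_ge0.
Qed.

Let cut n u : sqint := SqInt (cut_subproof n u).

Let mult_cut_subproof n u : mult (fun x => k x * chi n x) u \in sq_integrable m.
Proof.
apply/sq_integrableP; have mu := sqint_measurable u.
have mkc : measurable_fun setT (fun x => k x * chi n x) by exact: measurable_funM.
split; first exact: cmeasurable_mult.
apply: (@le_lt_trans _ _ (int_sq m (mult (cst n%:R) u))).
  apply: int_sq_le => //; try exact: cmeasurable_mult.
  move=> x; rewrite !sqnorm_mult ler_wpM2r ?sqnorm_ge0 //.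
  rewrite -[leLHS]real_normK ?num_real // lerXn2r ?nnegrE //.
  rewrite normrM /chi indicE; have [xl|xl] := boolP (x \in level n).
    by rewrite normr1 mulr1; rewrite inE in xl.
  by rewrite normr0 mulr0.
have := valP ((n%:R : R[i]) *: u); rewrite /= => /sq_integrableP[_].
by congr (int_sq m _ < _)%E; apply/funext => x; rewrite /mult /= rmorph_nat.
Qed.

Let mult_cut n u : sqint := SqInt (mult_cut_subproof n u).

Let mult_cutE n u x : mult_cut n u x = mult k (cut n u) x.
Proof. by rewrite /= /mult rmorphM mulrA. Qed.

Lemma dom_cut n u : dom mult_operator (pi (cut n u)).
Proof.
by apply/mult_operator_dom; exact: (mult_domP (mult_cutE n u)).
Qed.

Let level_cvg f : cmeasurable f ->
  (\int[m]_(x in level n) (sqnorm (f x))%:E @[n --> \oo] --> int_sq m f)%E.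
Proof.
move=> mf; have levelT : \bigcup_n level n = setT.
  apply/seteqP; split=> // x _; exists (Num.bound `|k x|) => //=.
  by apply/ltW/archi_boundP.
rewrite /int_sq -levelT; apply: ge0_nondecreasing_set_cvg_integral => //.
- move=> i j ij; apply/subsetPset => x /= h.
  by apply: le_trans h _; rewrite ler_nat.
- by move=> i; exact: measurable_sqnormE.
- by move=> i x _; rewrite lee_fin sqnorm_ge0.
Qed.

Let mult_selfadjoint_dense : densely_defined mult_operator.
Proof.
move=> z e e0; have [u <-] := pi_surj z.
have mu := sqint_measurable u; have e2 := exprn_gt0 2 e0.
have fin := sqint_fin u.
have ufin : int_sq m u \is a fin_num by rewrite ge0_fin_numE ?int_sq_ge0.
have splitE n : (int_sq m (fun x => u x - cut n u x)%R +
    \int[m]_(x in level n) (sqnorm (u x))%:E = int_sq m u)%E.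
  rewrite integral_mkcond -ge0_integralD //.
  - apply: eq_integral => x _; rewrite /= /mult /chi /patch indicE.
    case: ifPn => xl.
      by rewrite mul1r subrr sqnorm0 add0e.
    by rewrite mul0r subr0 adde0.
  - by move=> x _; rewrite lee_fin sqnorm_ge0.
  - exact: (measurable_sqnormE (sqint_measurable (u - cut n u))).
  - by move=> x _; rewrite /patch; case: ifP; rewrite // lee_fin sqnorm_ge0.
  - apply/(measurable_restrictT _ _).1 => //; exact: measurable_sqnormE.
have [n Hn] : exists n, (int_sq m u - (e ^+ 2)%:E < \int[m]_(x in level n) (sqnorm (u x))%:E)%E.
  apply: contrapT => h.
  have : (int_sq m u <= int_sq m u - (e ^+ 2)%:E)%E.
    rewrite -{1}(cvg_lim _ (level_cvg mu)) //; apply: lime_le.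
      by apply/cvg_ex; eexists; exact: level_cvg.
    by apply: nearW => n; rewrite leNgt; apply/negP => hn; apply: h; exists n.
  rewrite -(fineK ufin) -EFinB lee_fin; lra.
exists (pi (cut n u)); first exact: dom_cut.
rewrite -linearB /= -(@ltr_pXn2r _ 2) ?nnegrE ?hnorm_ge0 ?(ltW e0) //.
rewrite -lte_fin hnorm_pi; have := splitE n.
have i0 : (0 <= \int[m]_(x in level n) (sqnorm (u x))%:E)%E.
  by apply: integral_ge0 => x _; rewrite lee_fin sqnorm_ge0.
have j0 := int_sq_ge0 m (fun x => u x - cut n u x).
move: Hn i0 j0; rewrite -(fineK ufin).
case: (\int[m]_(x in level n) _)%E => [a| |] //;
  case: (int_sq m (fun x => u x - cut n u x)) => [b| |] //.
rewrite lte_fin => h _ _ [h2]; rewrite lte_fin.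
by move: h2 h; lra.
Qed.

Let dot_real_sym (g : T -> R) u u' v v' : (forall x, u' x = mult g u x) ->
  (forall x, v' x = mult g v x) -> sqint_dot u' v = sqint_dot u v'.
Proof.
move=> uE vE; congr (_ +i* _); congr fine; apply: eq_integral => t _;
  congr EFin; rewrite uE vE /mult; case: (u t) (v t) => a b [c e] /=; ring.
Qed.

(** If [(v, w)] is in the graph of the adjoint, [f = k v - w] is tested against its own truncation
    [u] to a level, which lies in the domain. This yields [|u|^2 = 0] on every level, hence
    [k v = w] almost everywhere. *)
Lemma mult_selfadjoint : selfadjoint mult_operator.
Proof.
split.
- split.
    rewrite -(linear0 pi); apply/mult_operator_dom.
    by apply: (@mult_domP _ 0) => x; rewrite /mult mulr0.
  move=> a z z'; have [u <-] := pi_surj z; have [u' <-] := pi_surj z'.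
  move=> /mult_operator_dom ku /mult_operator_dom ku'.
  pose v := SqInt ku; pose v' := SqInt ku'.
  have E x : (a *: v + v') x = mult k (a *: u + u') x.
    by rewrite /= /mult mulrDr mulrCA.
  rewrite -linearP (mult_operatorE E); split.
    by apply/mult_operator_dom; exact: mult_domP E.
  by rewrite linearP (@mult_operatorE u v) // (@mult_operatorE u' v').
- exact: mult_selfadjoint_dense.
move=> y z; have [v <-] := pi_surj y; have [w <-] := pi_surj z; split; last first.
  move=> [/mult_operator_dom kv]; pose v1 := SqInt kv.
  rewrite (@mult_operatorE v v1) // => <- x; have [u <-] := pi_surj x.
  move=> /mult_operator_dom ku; pose u1 := SqInt ku.
  rewrite (@mult_operatorE u u1) // !pi_dot.
  exact: dot_real_sym.
move=> h; pose f x := mult k v x - w x.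
have mf : cmeasurable f.
  have mv := cmeasurable_mult mk (sqint_measurable v).
  rewrite (_ : f = fun x => mult k v x + -1 * w x).
    apply: cmeasurableD => //; apply: cmeasurableM; last exact: sqint_measurable.
    exact: cmeasurable_cst.
  by apply/funext => x; rewrite mulN1r.
have f0 : int_sq m f = 0%E.
  have key n : (\int[m]_(x in level n) (sqnorm (f x))%:E = 0)%E.
    pose u := mult_cut n v - cut n w.
    have uE x : u x = (chi n x)%:C * f x.
      rewrite (_ : u x = mult_cut n v x - cut n w x) // mult_cutE /f /= /mult.
      by rewrite mulrBr mulrCA.
    have chiu x : (chi n x)%:C * u x = u x by rewrite uE mulrA -rmorphM /= chiK.
    have kuE x : mult_cut n u x = mult k u x.
      by rewrite mult_cutE; congr (_ * _); exact: chiu.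
    have du : dom mult_operator (pi u).
      by apply/mult_operator_dom; exact: mult_domP kuE.
    have := h _ du; rewrite (mult_operatorE kuE) !pi_dot => h1.
    have cutu : cut n u = u by apply/val_inj/funext => x; exact: chiu.
    have h3 : sqint_dot u (cut n w) = sqint_dot u w.
      by rewrite -[X in _ = sqint_dot X w]cutu; apply/esym/(@dot_real_sym (chi n)).
    have uvw : ip (pi u) (pi (mult_cut n v)) = ip (pi u) (pi (cut n w)).
      rewrite /ip !pi_dot h3 -h1; congr (complex.Re _).
      by apply/esym/(@dot_real_sym (fun x => k x * chi n x)).
    have uu : ip (pi u) (pi u) = 0.
      by rewrite [X in ip _ X](linearB pi) ipBr uvw subrr.
    have := hnorm_pi u; rewrite hnormE uu => u0.
    transitivity (int_sq m u); last exact/esym.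
    rewrite /int_sq integral_mkcond; apply: eq_integral => x _.
    rewrite /patch uE sqnormM /chi indicE; case: ifPn => xl.
      by rewrite {2}/sqnorm /= expr1n [0 ^+ 2]expr0n addr0 mul1r.
    by rewrite sqnorm0 mul0r.
  have := level_cvg mf; rewrite (_ : (fun n => _) = fun=> 0%E); last exact/funext.
  by move=> /(cvg_unique _ (cvg_cst _)) <-.
have kvE : mult k v = (w : T -> R[i]) + f.
  by apply/funext => x; rewrite fctE /f addrC subrK.
have kv : mult_dom v.
  rewrite /mult_dom kvE; apply: rpredD; first exact: valP.
  by apply/sq_integrableP; rewrite f0 ltry.
split; first exact/mult_operator_dom.
rewrite (@mult_operatorE v (SqInt kv)) //; apply/pi_eqP; exact: f0.
Qed.

End operator.

End multiplication.

(** * The model of a consistent system *)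

Section fibered.
Context {V : choiceType} {d : measure_display} {T : measurableType d}.

(* The disjoint union of copies of [T] indexed by [V]; the vertex [v0] only
   serves to make the type pointed. *)
Definition fibered (v0 : V) : Type := (V * T)%type.

Variable v0 : V.
Local Notation X := (fibered v0).

HB.instance Definition _ := Choice.on X.
HB.instance Definition _ := isPointed.Build X (v0, point).

Definition fiber (v : V) (A : set X) : set T := [set s | A (v, s)].

(** Nothing is required in the direction of [V], so every function of the vertex alone is
    measurable, however large [V] is. *)
Definition fiberwise_measurable : set (set X) :=
  [set A | forall v, measurable (fiber v A)].

Let measurable_fiberwise0 : fiberwise_measurable set0.
Proof. by move=> v; exact: measurable0. Qed.

Let measurable_fiberwiseC A :
  fiberwise_measurable A -> fiberwise_measurable (~` A).
Proof. by move=> mA v; exact: (measurableC (mA v)). Qed.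

Let measurable_fiberwiseU (F : (set X)^nat) :
  (forall i, fiberwise_measurable (F i)) ->
  fiberwise_measurable (\bigcup_i F i).
Proof.
move=> mF v; rewrite (_ : fiber v _ = \bigcup_i fiber v (F i)).
  by apply: bigcup_measurable => i _; exact: (mF i v).
by [].
Qed.

HB.instance Definition _ := isMeasurable.Build d X
  measurable_fiberwise0 measurable_fiberwiseC measurable_fiberwiseU.

Lemma measurable_fun_fibered d' (Y : measurableType d') (F : X -> Y) :
  measurable_fun setT F <-> forall v, measurable_fun setT (fun s => F (v, s)).
Proof.
split=> [mF v|mF] _ A mA; rewrite setTI.
  by have := mF measurableT _ mA; rewrite setTI => /(_ v).
by move=> v; have := mF v measurableT _ mA; rewrite setTI.
Qed.

Lemma measurable_fiber v : measurable_fun setT (fun s => (v, s) : X).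
Proof. by move=> _ A mA; rewrite setTI; exact: mA. Qed.

(** The sum of the images of the [mu v] under the inclusions of the fibers; later arguments use only
    its integration formula. *)
Lemma fibered_measure (R : realType) (mu : V -> {measure set T -> \bar R}) :
  exists m : {measure set X -> \bar R}, forall F : X -> \bar R,
    measurable_fun setT F -> (forall p, 0 <= F p)%E ->
    (\int[m]_p F p = \esum_(v in [set: V]) \int[mu v]_s F (v, s))%E.
Proof.
have pushE v : exists nu : {measure set X -> \bar R},
    forall F : X -> \bar R, measurable_fun setT F -> (forall p, 0 <= F p)%E ->
      (\int[nu]_p F p = \int[mu v]_s F (v, s))%E.
  unshelve eexists (pushforward (mu v) (fun s : T => (v, s) : X)).
    exact: measurable_fiber.
  by move=> F mF F0; exact: (ge0_integral_pushforward (measurable_fiber v)).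
have [nu nuE] := choice pushE.
have [m mE] := @esum_measure R _ X V setT (fun=> 1) nu (fun=> ler01).
exists m => F mF F0.
rewrite (@integral_esum_measure R _ X V setT (fun=> 1) nu (fun=> ler01) m setT F) //.
by apply: eq_esum => v _; rewrite mul1e; exact: nuE.
Qed.

End fibered.

Section isometry.
Context {R : realType}.

Lemma isometry_innerp (H K : hilbertType R) (U : {linear H -> K}) :
  (forall x, hnorm (U x) = hnorm x) ->
  forall x y, innerp (U x) (U y) = innerp x y.
Proof.
move=> Un; have ipU x y : ip (U x) (U y) = ip x y.
  rewrite polarization [RHS]polarization -!hnormE.
  by rewrite -linearD -linearB !Un.
by move=> x y; rewrite innerp_ip [RHS]innerp_ip -linearZ !ipU.
Qed.

Context {d : measure_display} {T : measurableType d}.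
Context {m : {measure set T -> \bar R}}.
Context {K : hilbertType R} (pi : {linear sqint m -> K}).
Hypothesis pi_dot : forall u v, innerp (pi u) (pi v) = sqint_dot u v.
Hypothesis pi_surj : forall z, exists u, pi u = z.

(** A linear map preserving the integral of the square sends null differences to null differences,
    so it acts on classes. *)
Lemma sqint_isometry_lift (F : {linear sqint m -> sqint m}) :
  (forall u, int_sq m (F u) = int_sq m u) ->
  exists U : {linear K -> K}, (forall u, U (pi u) = pi (F u)) /\
    forall x y, innerp (U x) (U y) = innerp x y.
Proof.
move=> Fn; have [rep repK] := choice pi_surj.
have repE u v : pi u = pi v -> pi (F u) = pi (F v).
  move=> /(pi_eqP pi_dot) uv; apply/(pi_eqP pi_dot).
  by rewrite -[RHS]uv -(Fn (u - v)) linearB.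
pose U0 z := pi (F (rep z)).
have U0E u : U0 (pi u) = pi (F u) by apply: repE; rewrite repK.
have U0_linear : linear U0.
  move=> a x y; rewrite -{1}(repK x) -{1}(repK y) -linearP U0E.
  by rewrite !linearP.
pose U : {linear K -> K} :=
  HB.pack U0 (GRing.isLinear.Build R[i] K K *:%R U0 U0_linear).
exists U; split=> //; apply: isometry_innerp => z.
have [u <-] := pi_surj z; rewrite [U _]U0E.
apply/eqP; rewrite -(@eqrXn2 _ 2) ?hnorm_ge0 //; apply/eqP/EFin_inj.
by rewrite !(hnorm_pi pi_dot) Fn.
Qed.

End isometry.

(** * Consequences of consistency *)

Section consistent.
Context {R : realType} {V : choiceType} {E : rel V} {lambda : V -> R[i]}.
Hypothesis treeE : directed_tree E.
Local Notation mT := (measurableTypeR R).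
Local Notation w := (fun v => normc (lambda v) ^+ 2).

Definition consistent (mu : V -> probability mT R) (eps : V -> R) :=
  [/\ forall u, on_halfline (mu u),
      forall u, 0 <= eps u &
      forall u (sigma : set mT),
        measurable sigma -> sigma `<=` `[0%R, +oo[%classic ->
        (mu u sigma =
          \esum_(v in Chi E u) ((w v)%:E * \int[mu v]_(s in sigma) (s%:E)^-1)
          + (eps u)%:E * \d_(0%R : R) sigma)%E].

Context {mu : V -> probability mT R} {eps : V -> R}.
Hypothesis muP : consistent mu eps.
Local Notation D := (`]0%R, +oo[%classic : set mT).

Let mD : measurable D. Proof. exact: measurable_itv. Qed.

Let mu_half u : on_halfline (mu u). Proof. by have [h _ _] := muP. Qed.

(** On the open half-line the Dirac term disappears and [1/s] is finite, so consistency takes the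
    form that [integral_esum] requires. *)
Lemma consistent_integral u (g : mT -> \bar R) : measurable_fun D g ->
  (forall s, D s -> 0 <= g s)%E ->
  (\int[mu u]_(s in D) g s =
   \esum_(v in Chi E u) ((w v)%:E * \int[mu v]_(s in D) (g s * (s^-1)%:E)))%E.
Proof.
move=> mg g0; have [_ eps0 cons] := muP.
apply: (@integral_esum R _ mT V (Chi E u) w mu (mu u) D (fun s => s^-1)) => //.
- by move=> v _; exact: sqr_ge0.
- apply: open_continuous_measurable_fun; first exact: interval_open.
  move=> x; rewrite inE /= in_itv /= andbT => x0.
  by apply: inv_continuous; rewrite gt_eqF.
- by move=> x; rewrite /= in_itv /= andbT => x0; rewrite invr_ge0 ltW.
move=> A mA AD; have := cons u A mA; have /[swap] /[apply] : A `<=` `[0%R, +oo[%classic.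
  by move=> x /AD; rewrite /= !in_itv /= !andbT => /ltW.
move=> muA; transitivity (mu u A) => //; rewrite muA diracE memNset ?mule0 ?adde0; last first.
  by move=> /AD; rewrite /= in_itv /= ltxx.
apply: eq_esum => v _; congr (_ * _)%E; apply: eq_integral => s.
by rewrite inE => /AD; rewrite /= in_itv /= andbT => s0; rewrite inver gt_eqF.
Qed.

(** An atom of [mu v] at 0 would give its parent infinite mass at 0, because [1/0 = +oo]. *)
Lemma consistent_null v : nonroot E v -> lambda v != 0 ->
  mu v `]-oo, 0%R]%classic = 0%E.
Proof.
move=> /(nonrootP treeE) pv l0; have [_ eps0 cons] := muP.
have wv : 0 < w v.
  by rewrite exprn_even_gt0 //=; apply: contra l0 => /eqP/eq0_normc ->.
have m0 : mu v [set 0%R] = 0%E.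
  apply/eqP; rewrite eq_le measure_ge0 andbT leNgt; apply/negP => m0.
  have s0 : ([set 0%R] : set R) `<=` `[0%R, +oo[%classic.
    by move=> x /= ->; rewrite in_itv /= lexx.
  have := cons (par E v) [set 0%R] (measurable_set1 _) s0.
  have : (+oo <= \esum_(v0 in Chi E (par E v))
      ((w v0)%:E * \int[mu v0]_(s in [set 0%R]) (s%:E)^-1))%E.
    apply: esum_ge; exists [set v]; first by split => // _ ->.
    rewrite fsbig_set1 (eq_integral (cst +oo%E)); last first.
      by move=> x; rewrite inE /= => ->; rewrite inve0.
    by rewrite integral_cst // gt0_mulye // gt0_muley // lte_fin.
  rewrite leye_eq => /eqP ->; rewrite addye.
    by move=> mu1; have := probability_le1 (mu (par E v)) (measurable_set1 0%R); rewrite mu1.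
  by rewrite -EFinM.
have -> : `]-oo, 0%R]%classic = `]-oo, 0%R[%classic `|` ([set 0%R] : set R).
  by rewrite setUitv1.
rewrite measureU //.
- by rewrite -[RHS]adde0; congr (_ + _)%E; [exact: mu_half|exact: m0].
- by apply/disj_set2P/disj_setPS => x [] /=; rewrite in_itv /= => + x0; rewrite x0 ltxx.
Qed.

(** Consistency applied to [s] cancels [1/s] and leaves masses at most 1. This bound places the
    image of the domain of [S] in the domain of multiplication by [sqrt s]. *)
Lemma consistent_mass u :
  (\int[mu u]_(s in D) s%:E <= \esum_(v in Chi E u) (w v)%:E)%E.
Proof.
rewrite consistent_integral //.
- apply: le_esum => v _; rewrite -[leRHS]mule1.
  apply: lee_wpmul2l; first by rewrite lee_fin sqr_ge0.
  rewrite (eq_integral (cst 1%E)) ?integral_cst ?mul1e ?probability_le1 //.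
  move=> s; rewrite inE /= in_itv /= andbT => s0.
  by rewrite -EFinM mulfV ?gt_eqF.
- by move=> s; rewrite /= in_itv /= andbT => /ltW.
Qed.

End consistent.

(** * Linearity of the shift and density of the basis span *)

Section weighted_shift_operator.
Context {R : realType} {V : choiceType} {E : rel V} {lambda : V -> R[i]}.
Local Notation S := (weighted_shift E lambda).
Local Notation l2 := (l2 R V).

Lemma tree_shiftP (a : R[i]) (f g : V -> R[i]) :
  tree_shift E lambda (a *: f + g) =
  a *: tree_shift E lambda f + tree_shift E lambda g.
Proof.
apply/funext => v; rewrite !fctE /tree_shift; case: ifP => _.
  by rewrite mulrDr mulrCA.
by rewrite scaler0 addr0.
Qed.

Lemma weighted_shift_linear : linear_operator S.
Proof.
split.
  rewrite /= (_ : tree_shift _ _ _ = 0) ?rpred0 //.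
  by apply/funext => v; rewrite /tree_shift mulr0; case: ifP.
move=> a f g Sf Sg.
have Sfg : dom S (a *: f + g).
  rewrite /= (_ : tree_shift E lambda _ =
    a *: tree_shift E lambda f + tree_shift E lambda g).
    by rewrite rpredD // rpredZ.
  exact: tree_shiftP.
split=> //; apply/val_inj; rewrite (weighted_shiftE Sfg).
transitivity (a *: val (S f) + val (S g)) => //.
rewrite (weighted_shiftE Sf) (weighted_shiftE Sg); exact: tree_shiftP.
Qed.

Lemma l2_delta_sumE (f : l2) (s : seq V) u : uniq s ->
  (\sum_(v <- s) f v *: l2_delta v : l2) u = if u \in s then f u else 0.
Proof.
elim: s => [|v s IH] /=; first by rewrite big_nil.
move=> /andP[vs us]; rewrite big_cons.
transitivity (f v * (u == v)%:R + (\sum_(v <- s) f v *: l2_delta v : l2) u) => //.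
rewrite IH // inE; have [->|_] /= := eqVneq u v.
  by rewrite (negbTE vs) mulr1 addr0.
by rewrite mulr0 add0r.
Qed.

Lemma l2_lin_delta_dense (f : l2) (e : R) : 0 < e ->
  exists2 g, l2_lin_delta g & hnorm (f - g) < e.
Proof.
move=> e0; have e2 := exprn_gt0 2 e0.
have fE := l2_hnormE f.
have fin : (\esum_(v in [set: V]) (normc (f v) ^+ 2)%:E)%E \is a fin_num.
  by rewrite -fE.
have [_ [F [finF _] <-]] := ub_ereal_sup_adherent e2 fin.
rewrite -/(esum _ _) -fE.
rewrite fsbig_finite //= sumEFin -EFinB lte_fin.
set s := finmap.enum_fset _ => near.
have us : uniq s by exact: finmap.fset_uniq.
pose g : l2 := \sum_(v <- s) f v *: l2_delta v.
exists g.
  exists (size s), (fun i => f (tnth (in_tuple s) i)), (tnth (in_tuple s)).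
  by rewrite /g big_tnth.
rewrite hnorm_lt // -hnormE.
suff : hnorm (f - g) ^+ 2 + \sum_(v <- s) normc (f v) ^+ 2 = hnorm f ^+ 2.
  by move: near; lra.
apply: EFin_inj; rewrite EFinD !l2_hnormE.
rewrite (_ : (\sum_(v <- s) normc (f v) ^+ 2)%:E =
  (\esum_(v in [set: V]) (if v \in F then (normc (f v) ^+ 2)%:E else 0)))%E; last first.
  rewrite -esum_mkcond esum_fset //; last by move=> v _; rewrite lee_fin sqr_ge0.
  by rewrite fsbig_finite //= sumEFin.
have inF v : (v \in F) = (v \in s) by rewrite in_fset_set.

rewrite -esumD; last 2 first.
- by move=> v _; rewrite lee_fin sqr_ge0.
- by move=> v _; case: ifP; rewrite ?lee_fin ?sqr_ge0.
apply: eq_esum => v _; rewrite inF.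
rewrite (_ : (f - g) v = f v - g v) // l2_delta_sumE //.
case: ifP => _; first by rewrite subrr normc0 expr0n add0e.
by rewrite subr0 adde0.
Qed.

End weighted_shift_operator.

(** * The isometry, the embedding and the normal extension *)

Section model.
Context {R : realType} {V : choiceType} {E : rel V} {lambda : V -> R[i]}.
Hypothesis treeE : directed_tree E.
Local Notation mT := (measurableTypeR R).
Local Notation w := (fun v => normc (lambda v) ^+ 2).
Local Notation S := (weighted_shift E lambda).
Context {mu : V -> probability mT R} {eps : V -> R}.
Hypothesis muP : consistent (E := E) (lambda := lambda) mu eps.
Local Notation D := (`]0%R, +oo[%classic : set mT).

Context {v0 : V}.
Local Notation X := (@fibered V _ mT v0).
Context {m : {measure set X -> \bar R}}.
Hypothesis mE : forall F : X -> \bar R,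
  measurable_fun setT F -> (forall p, 0 <= F p)%E ->
  (\int[m]_p F p = \esum_(v in [set: V]) \int[mu v]_s F (v, s))%E.

Lemma cmeasurable_fibered (f : X -> R[i]) :
  cmeasurable f <-> forall v, cmeasurable (fun s : mT => f (v, s)).
Proof.
split=> [[/measurable_fun_fibered f1 /measurable_fun_fibered f2] v|h].
  by split; [exact: f1|exact: f2].
by split; apply/measurable_fun_fibered => v; have [] := h v.
Qed.

Lemma int_sq_fibered (f : X -> R[i]) : cmeasurable f ->
  (int_sq m f =
   \esum_(v in [set: V]) \int[mu v]_s (sqnorm (f (v, s)))%:E)%E.
Proof.
move=> mf; rewrite /int_sq mE //; first exact: measurable_sqnormE.
by move=> p; rewrite lee_fin sqnorm_ge0.
Qed.

Let mD : measurable D. Proof. exact: measurable_itv. Qed.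

Let in_D (s : mT) : (s \in D) = (0 < s).
Proof. by rewrite mem_setE in_itv /= andbT. Qed.

Definition root (p : X) : R := Num.sqrt p.2.

Definition inv_root (s : mT) : R := if 0 < s then (Num.sqrt s)^-1 else 0.

Definition pole (s : mT) : R := if 0 < s then 0 else 1.

Lemma measurable_inv_halfline : measurable_fun D (fun s : mT => s^-1 : R).
Proof.
apply: open_continuous_measurable_fun; first exact: interval_open.
by move=> s; rewrite in_D => s0; apply: inv_continuous; rewrite gt_eqF.
Qed.

Lemma measurable_root : measurable_fun setT root.
Proof.
apply/measurable_fun_fibered => v; apply: continuous_measurable_fun.
exact: sqrt_continuous.
Qed.

Lemma measurable_inv_root : measurable_fun setT inv_root.
Proof.
rewrite (_ : inv_root = (fun s => (Num.sqrt s)^-1) \_ D); last first.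
  by apply/funext => s; rewrite /inv_root patchE in_D.
apply/(measurable_restrictT _ _).1 => //.
apply: open_continuous_measurable_fun; first exact: interval_open.
move=> s; rewrite in_D => s0.
apply: (@cvg_comp _ _ _ Num.sqrt (fun x => x^-1)); first exact: sqrt_continuous.
by apply: inv_continuous; rewrite gt_eqF // sqrtr_gt0.
Qed.

Lemma measurable_pole : measurable_fun setT pole.
Proof.
rewrite (_ : pole = \1_(~` D)).
  by apply: measurable_indic; exact: measurableC.
apply/funext => s; rewrite indicE /pole in_setC in_D.
by case: (0 < s).
Qed.

(* Fiberwise, this is the shift divided by the square root on the positive
   half-line, and the identity elsewhere. *)
Definition tree_rotation (f : X -> R[i]) : X -> R[i] := fun p =>
  (inv_root p.2)%:C * tree_shift E lambda (fun u => f (u, p.2)) p.1 +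
  (pole p.2)%:C * f p.

Lemma cmeasurable_shift (f : X -> R[i]) v : cmeasurable f ->
  cmeasurable (fun s : mT => tree_shift E lambda (fun u => f (u, s)) v).
Proof.
move=> /cmeasurable_fibered mf.
rewrite /tree_shift; case: (v \in nonroot E); last exact: cmeasurable_cst.
by apply: cmeasurableM => //; exact: cmeasurable_cst.
Qed.

Lemma cmeasurable_rotation f : cmeasurable f -> cmeasurable (tree_rotation f).
Proof.
move=> mf; apply/cmeasurable_fibered => v.
apply: cmeasurableD; apply: cmeasurableM.
- by apply: cmeasurable_real; exact: measurable_inv_root.
- exact: cmeasurable_shift.
- by apply: cmeasurable_real; exact: measurable_pole.
- exact: (cmeasurable_fibered f).1 mf v.
Qed.

(** No cross term appears since [inv_root] and [pole] have disjoint supports. *)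
Lemma sqnorm_rotation f v (s : mT) : sqnorm (tree_rotation f (v, s)) =
  inv_root s ^+ 2 * sqnorm (tree_shift E lambda (fun u => f (u, s)) v) +
  pole s ^+ 2 * sqnorm (f (v, s)).
Proof.
rewrite /tree_rotation /inv_root /pole /=; case: ifP => _.
  by rewrite mul0r addr0 sqnorm_real expr0n mul0r addr0.
by rewrite mul0r add0r sqnorm_real expr0n mul0r add0r.
Qed.

(** Regrouping the sum by parents, consistency turns the contributions of the children of [u] into
    the integral of [|f(u, s)|^2] over [s > 0]; the [pole] term supplies the rest of the fiber of
    [u]. *)
Lemma int_sq_rotation f : cmeasurable f ->
  int_sq m (tree_rotation f) = int_sq m f.
Proof.
move=> mf; have mrf := cmeasurable_rotation mf.
rewrite !int_sq_fibered //.
have mfv := (cmeasurable_fibered f).1 mf.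
pose a u v := ((w v)%:E *
  \int[mu v]_(s in D) ((sqnorm (f (u, s)))%:E * (s^-1)%:E))%E.
have a0 u v : (0 <= a u v)%E.
  rewrite mule_ge0 ?lee_fin ?sqr_ge0 //; apply: integral_ge0 => s.
  rewrite /= in_itv /= andbT => s0.
  by rewrite mule_ge0 ?lee_fin ?sqnorm_ge0 // invr_ge0 ltW.
pose P u : \bar R := (\int[mu u]_s (pole s ^+ 2 * sqnorm (f (u, s)))%:E)%E.
have P0 u : (0 <= P u)%E.
  by apply: integral_ge0 => s _; rewrite lee_fin mulr_ge0 ?sqr_ge0 ?sqnorm_ge0.
have mP u : measurable_fun setT (fun s : mT => (pole s ^+ 2 * sqnorm (f (u, s)))%:E).
  apply/measurable_EFinP; apply: measurable_funM.
    by apply: measurable_funX; exact: measurable_pole.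
  exact: measurable_sqnorm.
transitivity (\esum_(v in [set: V])
    ((if v \in nonroot E then a (par E v) v else 0) + P v))%E.
  apply: eq_esum => v _.
  under eq_integral do rewrite sqnorm_rotation EFinD.
  rewrite ge0_integralD //; last 3 first.
  - by move=> s _; rewrite lee_fin mulr_ge0 ?sqr_ge0 ?sqnorm_ge0.
  - apply/measurable_EFinP; apply: measurable_funM.
      by apply: measurable_funX; exact: measurable_inv_root.
    by apply: measurable_sqnorm; exact: cmeasurable_shift.
  - by move=> s _; rewrite lee_fin mulr_ge0 ?sqr_ge0 ?sqnorm_ge0.
  congr (_ + _)%E; rewrite /tree_shift; case: ifP => vE.
    rewrite /a [in RHS]integral_mkcond -ge0_integralZl //; last 3 first.
    - apply/(measurable_restrictT _ _).1 => //; apply: emeasurable_funM.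
        exact: measurable_sqnormE.
      by apply/measurable_EFinP; exact: measurable_inv_halfline.
    - move=> s _; rewrite patchE in_D; case: ifP => // s0.
      by rewrite mule_ge0 ?lee_fin ?sqnorm_ge0 // invr_ge0 ltW.
    - by rewrite lee_fin sqr_ge0.
    apply: eq_integral => s _; rewrite patchE in_D /inv_root.
    case: ifP => s0; last by rewrite expr0n mul0r mule0.
    rewrite -!EFinM sqnormM exprVn sqr_sqrtr ?(ltW s0) // sqnorm_normc.
    by congr EFin; ring.
  by apply: integral0_eq => s _; rewrite sqnorm0 mulr0.
rewrite esumD //; last by move=> v _; case: ifP.
rewrite -esum_mkcond esum_nonroot // -esumD //; last first.
  by move=> u _; apply: esum_ge0.
apply: eq_esum => u _; rewrite /a -(consistent_integral muP) //; last 2 first.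
- exact: measurable_sqnormE.
- by move=> s _; rewrite lee_fin sqnorm_ge0.
rewrite integral_mkcond /P -ge0_integralD //; last 3 first.
- by move=> s _; rewrite patchE; case: ifP => // _; rewrite lee_fin sqnorm_ge0.
- apply/(measurable_restrictT _ _).1 => //; exact: measurable_sqnormE.
- by move=> s _; rewrite lee_fin mulr_ge0 ?sqr_ge0 ?sqnorm_ge0.
apply: eq_integral => s _; rewrite patchE in_D /pole; case: ifP => _.
  by rewrite expr0n mul0r adde0.
by rewrite expr1n mul1r add0e.
Qed.

Fact tree_rotation_subproof (f : sqint m) :
  tree_rotation f \in sq_integrable m.
Proof.
have mf := sqint_measurable f; apply/sq_integrableP.
by rewrite int_sq_rotation //; split; [exact: cmeasurable_rotation|exact: sqint_fin].
Qed.

Definition sqint_rotation (f : sqint m) := SqInt (tree_rotation_subproof f).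

Fact sqint_rotation_linear : linear sqint_rotation.
Proof.
move=> a f g; apply/val_inj/funext => p.
transitivity (a * tree_rotation f p + tree_rotation g p) => //.
transitivity (tree_rotation (a *: (f : X -> R[i]) + g) p) => //.
rewrite /tree_rotation (_ : (fun u => _) =
  a *: (fun u => f (u, p.2)) + (fun u => g (u, p.2))) // tree_shiftP !fctE.
by rewrite /GRing.scale /=; ring.
Qed.

HB.instance Definition _ :=
  GRing.isLinear.Build R[i] (sqint m) (sqint m) *:%R sqint_rotation
    sqint_rotation_linear.

Lemma cmeasurable_embedding (f : V -> R[i]) : cmeasurable (fun p : X => f p.1).
Proof. by apply/cmeasurable_fibered => v; exact: (cmeasurable_cst (f v)). Qed.

Lemma int_sq_embedding (f : V -> R[i]) :
  int_sq m (fun p => f p.1) = normsq f.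
Proof.
rewrite int_sq_fibered; last exact: cmeasurable_embedding.
apply: eq_esum => v _; rewrite sqnorm_normc.
transitivity (\int[mu v]_s cst (sqnorm (f v))%:E s)%E => //.
by rewrite integral_cst // -[RHS]mule1; congr (_ * _)%E; exact: probability_setT.
Qed.

Fact embedding_subproof (f : l2 R V) : (fun p : X => f p.1) \in sq_integrable m.
Proof.
apply/sq_integrableP; split; first exact: cmeasurable_embedding.
by rewrite int_sq_embedding; exact: (valP f).
Qed.

Definition sqint_embedding (f : l2 R V) := SqInt (embedding_subproof f).

Fact sqint_embedding_linear : linear sqint_embedding.
Proof. by move=> a f g; apply/val_inj/funext. Qed.

HB.instance Definition _ :=
  GRing.isLinear.Build R[i] (l2 R V) (sqint m) *:%R sqint_embedding
    sqint_embedding_linear.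

(** By [consistent_mass], the fiber of [v] contributes at most [|f(v)|^2] times the sum of the
    squared weights of its children, and these bounds add up to [|S f|^2]. *)
Lemma mult_dom_embedding (f : l2 R V) : dom S f ->
  mult_dom root (sqint_embedding f).
Proof.
move=> Sf; have mf := cmeasurable_embedding f.
have mkf := cmeasurable_mult measurable_root mf.
apply/sq_integrableP; split=> //; rewrite int_sq_fibered //.
apply: le_lt_trans (_ : (normsq (tree_shift E lambda f) < +oo)%E); last exact: Sf.
have -> : normsq (tree_shift E lambda f) = (\esum_(v in [set: V])
    ((normc (tree_shift E lambda f v) ^+ 2)%:E * 1))%E.
  by apply: eq_esum => v _; rewrite mule1.
rewrite (normsq_shift_weighted treeE) //; apply: le_esum => v _.
under eq_integral do rewrite sqnorm_mult mulrC EFinM /=.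
rewrite ge0_integralZl ?lee_fin ?sqnorm_ge0 //; last 2 first.
- apply/measurable_EFinP; apply: measurable_funX.
  exact: (measurable_fun_fibered root).1 measurable_root v.
- by move=> s _; rewrite lee_fin sqr_ge0.
rewrite sqnorm_normc; apply: lee_wpmul2l; first by rewrite lee_fin sqnorm_ge0.
under [leRHS]eq_esum do rewrite mule1.
apply: le_trans (consistent_mass muP v); rewrite [leRHS]integral_mkcond.
rewrite le_eqVlt; apply/orP; left; apply/eqP/eq_integral => s _.
rewrite patchE in_D /root /=; case: ifP => s0; first by rewrite sqr_sqrtr // ltW.
by rewrite ler0_sqrtr ?expr0n // leNgt s0.
Qed.

(** For [s > 0] the two roots cancel. For [s <= 0] the first term vanishes with [sqrt s], and [S f]
    does not contribute: either it is zero at [v], or [mu v] does not charge []-oo, 0]]. *)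
Lemma int_sq_rotation_embedding (f : l2 R V) : dom S f ->
  int_sq m (fun p => tree_rotation (mult root (sqint_embedding f)) p -
                     sqint_embedding (S f) p) = 0%E.
Proof.
move=> Sf; set g := (X in int_sq m X).
have gE v (s : mT) :
    g (v, s) = if 0 < s then 0 else - tree_shift E lambda f v.
  rewrite (_ : g (v, s) = tree_rotation (mult root (sqint_embedding f)) (v, s) -
    val (S f) v) // (weighted_shiftE Sf) /tree_rotation /inv_root /pole /=.
  have -> : tree_shift E lambda (fun u => mult root (sqint_embedding f) (u, s)) v =
      (Num.sqrt s)%:C * tree_shift E lambda f v.
    by rewrite /tree_shift; case: ifP => _; rewrite ?mulr0 // mulrCA.
  case: ifP => s0.
    rewrite mul0r addr0 mulrA -rmorphM /= mulVf ?mul1r ?subrr //.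
    by rewrite gt_eqF // sqrtr_gt0.
  rewrite mul0r add0r mul1r /mult /root /= ler0_sqrtr ?mul0r ?sub0r //.
  by rewrite leNgt s0.
have mg : cmeasurable g.
  have h := cmeasurable_mult measurable_root (sqint_measurable (sqint_embedding f)).
  rewrite (_ : g = fun p => tree_rotation (mult root (sqint_embedding f)) p +
    -1 * sqint_embedding (S f) p).
    apply: cmeasurableD; first exact: cmeasurable_rotation.
    apply: cmeasurableM; first exact: cmeasurable_cst.
    exact: sqint_measurable.
  by apply/funext => p; rewrite mulN1r.
rewrite int_sq_fibered //; apply: esum1 => v _.
have [vE|vE] := boolP (v \in nonroot E); last first.
  apply: integral0_eq => s _; rewrite gE /tree_shift (negbTE vE) oppr0.
  by case: ifP; rewrite sqnorm0.
have [l0|l0] := eqVneq (lambda v) 0.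
  apply: integral0_eq => s _; rewrite gE /tree_shift l0 mul0r if_same oppr0.
  by case: ifP; rewrite sqnorm0.
rewrite inE in vE; have null := consistent_null treeE muP vE l0.
rewrite (eq_integral ((fun=> (sqnorm (tree_shift E lambda f v))%:E)
    \_ (`]-oo, 0%R]%classic : set mT))); last first.
  move=> s _; rewrite patchE mem_setE in_itv /= gE leNgt.
  by case: ifP => _ /=; rewrite ?sqnorm0 // -sqnorm_normc normcN sqnorm_normc.
rewrite -integral_mkcond; apply: null_set_integral => //.
Qed.

Lemma consistent_normal_extension : exists (K : hilbertType R)
    (J : {linear l2 R V -> K}) (N : operator K),
  [/\ forall x y, innerp (J x) (J y) = innerp x y, normal_operator N &
      forall f, dom S f -> dom N (J f) /\ N (J f) = J (S f)].
Proof.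
have [K [pi [pi_dot pi_surj]]] := semi_hilbert_quotient (sqint_semi_hilbert m).
have rotation_iso (u : sqint m) : int_sq m (sqint_rotation u) = int_sq m u.
  by apply: int_sq_rotation; exact: sqint_measurable.
have [U [UE Uiso]] := sqint_isometry_lift pi_dot pi_surj rotation_iso.
have domM := mult_operator_dom pi_dot pi_surj measurable_root.
have ME := mult_operatorE pi_dot pi_surj measurable_root.
have UM x : dom (mult_operator pi_surj root) x ->
    dom (mult_operator pi_surj root) (U x) /\
    mult_operator pi_surj root (U x) = U (mult_operator pi_surj root x).
  have [u <-] := pi_surj x => /domM ku; pose v := SqInt ku.
  (* The rotation moves values between fibers at a fixed [s], so it commutes with multiplication by
     a function of [s] alone. *)
  have vE p : sqint_rotation v p = mult root (sqint_rotation u) p.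
    rewrite /= /tree_rotation /mult mulrDr; congr (_ + _); last by rewrite /= mulrCA.
    rewrite /root /tree_shift /=; case: ifP => _; last by rewrite !mulr0.
    by ring.
  rewrite UE (ME u v) // UE; split; last exact: ME.
  by apply/domM; exact: mult_domP vE.
have Msa := mult_selfadjoint pi_dot pi_surj measurable_root.
have [K' [J' [N [J'iso Nnormal NE]]]] := quasinormal_extension Msa Uiso UM.
exists K', (J' \o pi \o sqint_embedding : {linear l2 R V -> K'}), N; split=> //.
  apply: isometry_innerp => f /=.
  apply/eqP; rewrite -(@eqrXn2 _ 2) ?hnorm_ge0 //; apply/eqP/EFin_inj.
  rewrite hnormE /ip J'iso -/(ip _ _) -hnormE (hnorm_pi pi_dot).
  by rewrite int_sq_embedding l2_hnormE.
move=> f Sf /=; have kf := mult_dom_embedding Sf; pose v := SqInt kf.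
have [|dN ->] := NE (pi (sqint_embedding f)); first exact/domM.
split=> //; congr (J' _); rewrite (ME _ v) // UE.
apply/(pi_eqP pi_dot); exact: int_sq_rotation_embedding.
Qed.

End model.

Theorem theorem5p1p3 (R : realType) (V : choiceType) (E : rel V)
    (lambda : V -> R[i]) :
  directed_tree E ->
  @l2_lin_delta R V `<=` dom_infty (weighted_shift E lambda) ->
  (forall u, determinate_stieltjes (fun n =>
     hnorm (op_pow (weighted_shift E lambda) n.+1 (l2_delta u)) ^+ 2)) ->
  [<-> subnormal_operator (weighted_shift E lambda);
       forall u, stieltjes_moment_sequence (fun n =>
         hnorm (op_pow (weighted_shift E lambda) n (l2_delta u)) ^+ 2);
       exists (mu : V -> probability (measurableTypeR R) R) (eps : V -> R),
         [/\ forall u, on_halfline (mu u),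
             forall u, 0 <= eps u &
             forall u (sigma : set (measurableTypeR R)),
               measurable sigma -> sigma `<=` `[0%R, +oo[%classic ->
               (mu u sigma =
                 \esum_(v in Chi E u) ((normc (lambda v) ^+ 2)%:E *
                    \int[mu v]_(s in sigma) (s%:E)^-1)
                 + (eps u)%:E * \d_(0%R : R) sigma)%E] ].

Proof.
move=> treeE S_basis det; tfae.
- move=> Ssub u; apply: subnormal_stieltjes => //.
  by apply: S_basis; exact: l2_lin_delta_basis.
- exact: stieltjes_consistent_system.
move=> [mu [eps muP]].
(* Nonemptiness of the tree supplies the base vertex needed by [fibered]. *)
have [[v0 _] _ _ _ _] := treeE.
have [m mE] := @fibered_measure V _ (measurableTypeR R) v0 R mu.
split; first exact: weighted_shift_linear.
  move=> f e e0; have [g Lg fg] := l2_lin_delta_dense f e0.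
  by exists g => //; have [] := S_basis _ Lg 1%N I.
exact: consistent_normal_extension treeE mu eps muP v0 m mE.
Qed.
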